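(* Let $F,G\in L^2(B,\mathcal B,\mu)$. Suppose that all Malliavin derivatives $D^pF$ and $D^pG$, $p\ge1$, exist and that $$\sum_{p=1}^\infty\frac1{p!}\,\mathbb E\|D^pK\|^2_{H^{\hat\otimes p}}<\infty\qquad\text{for }K=F\text{ and }K=G.$$ Then the Wick product $F\diamond G$ exists as an element of $L^1(B,\mathcal B,\mu)$ and $$F\diamond G=\sum_{p=0}^\infty\frac{(-1)^p}{p!}\langle D^pF,D^pG\rangle_{H^{\hat\otimes p}}.$$
   Context: $(B,H,\mu)$ is an abstract Wiener space: $H$ is a separable real Hilbert space, continuously and densely embedded in a Banach space $B$ with Borel $\sigma$-algebra $\mathcal B$, the dual $B'$ is identified with a dense subspace of $H$, and $\mu$ is a Borel measure on $B$ with $\int_B e^{i\langle l,x\rangle}d\mu(x)=e^{-\|l\|_H^2/2}$ for $l\in B'$. For $l\in H$, $\tilde l$ denotes the centered Gaussian random variable of variance $\|l\|_H^2$ obtained as the $L^2$-extension of $l\mapsto\langle l,\cdot\rangle$, $l\in B'$. $H^{\hat\otimes n}$ is the $n$-fold symmetric tensor product of $H$ (with the norm and inner product inherited from the full Hilbert tensor product). $H_n(x)=(-1)^ne^{x^2/2}\frac{d^n}{dx^n}e^{-x^2/2}$ is the $n$-th Hermite polynomial. The multiple integral $I_n:H^{\hat\otimes n}\to L^2(B,\mathcal B,\mu)$ is the continuous linear map with $I_n(h^{\otimes n})=\|h\|_H^nH_n(\tilde h/\|h\|_H)$ for $0\ne h\in H$ ($I_0$ is the identity on constants); $\mathbb E|I_n(f_n)|^2=n!\|f_n\|^2_{H^{\hat\otimes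 n}}$. Every $F\in L^2(B,\mathcal B,\mu)$ has a unique chaos expansion $F=\sum_{n\ge0}I_n(f_n)$. Wick product: for finite sums, $\big(\sum_{n\le N_1}I_n(f_n)\big)\diamond\big(\sum_{m\le N_2}I_m(g_m)\big)=\sum_{n\le N_1}\sum_{m\le N_2}I_{n+m}(f_n\hat\otimes g_m)$. For general $F=\sum_nI_n(f_n)$, $G=\sum_mI_m(g_m)$, put $F_N=\sum_{n\le N}I_n(f_n)$, $G_N=\sum_{m\le N}I_m(g_m)$; $F\diamond G$ exists in $L^r$ if $F_N\diamond G_N$ converges in $L^r$, and then $F\diamond G$ is the limit. Malliavin derivatives: $DI_n(f_n)=nI_{n-1}(f_n)$, regarded as an $H$-valued random variable (one variable of $f_n$ is left free: $\langle DI_n(f_n),g\rangle_H=nI_{n-1}(\langle f_n,g\rangle_H)$ for $g\in H$, with $\langle f_n,g\rangle_H$ the contraction of $f_n$ with $g$). Similarly $D^pI_n(f_n)=n(n-1)\cdots(n-p+1)I_{n-p}(f_n)$ is $H^{\hat\otimes p}$-valued with $p$ variables left free (zero if $p>n$). For $F=\sum_nI_n(f_n)$, $D^pF=\sum_{n\ge p}D^pI_n(f_n)$, which exists if the series converges in $L^2(B;H^{\hat\otimes p})$; $D^0F=F$ and $\langle D^0F,D^0G\rangle_{H^{\hat\otimes0}}=FG$. The series in $p$ is understood as convergent in $L^1(B,\mathcal B,\mu)$. *)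

(* Defs.v *)
From HB Require Import structures.
From mathcomp Require Import all_boot all_order all_algebra all_fingroup.
From mathcomp Require Import sesquilinear.
From mathcomp Require Import all_classical all_reals all_analysis.

Set Implicit Arguments.
Unset Strict Implicit.
Unset Printing Implicit Defensive.
Import Order.TTheory GRing.Theory Num.Theory.
Import numFieldNormedType.Exports.

Local Open Scope classical_set_scope.
Local Open Scope ring_scope.

HB.mixin Record isHilbert (R : realType) V of CompleteNormedModule R V := {
  hdot : {dot V for @idfun R};
  hdot_norm : forall x : V, hdot x x = `|x| ^+ 2
}.

#[short(type=hilbertType)]
HB.structure Definition Hilbert (R : realType) :=
  {V of isHilbert R V & CompleteNormedModule R V}.

Notation "'<[ x , y ]>" := (hdot x y) (at level 0, x, y at level 99).

Definition separable_space (T : topologicalType) : Prop :=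
  exists2 S : set T, countable S & dense S.

Notation borel B := (g_sigma_algebraType (@open B)).

Definition cat_fam (T : Type) n m (u : 'I_n -> T) (v : 'I_m -> T)
    (k : 'I_(n + m)) : T :=
  match fintype.split k with inl i => u i | inr j => v j end.

(* A realization of the Hilbert tensor powers of H.  [pure_dot] and
   [pure_total] say that [tpow n] is a completion of the n-fold algebraic
   tensor product, so it is unique up to a unique isometry; [tprod] and [tperm]
   are determined by their continuity and their values on pure tensors, and
   [contr] by its being the adjoint of [tprod]. *)
Record tensor_powers (R : realType) (H : hilbertType R) := TensorPowers {
  tpow :> nat -> hilbertType R;
  pure : forall n, ('I_n -> H) -> tpow n;
  pure_multilinear : forall n (u : 'I_n -> H) (i : 'I_n) (a : R) (x y : H),
    pure [eta u with i |-> a *: x + y] =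
    a *: pure [eta u with i |-> x] + pure [eta u with i |-> y];
  pure_dot : forall n (u v : 'I_n -> H),
    '<[pure u, pure v]> = \prod_(i < n) '<[u i, v i]>;
  pure_total : forall n, dense [set t : tpow n |
    exists s : seq (R * ('I_n -> H)), t = \sum_(c <- s) c.1 *: pure c.2];
  tprod : forall n m, {bilinear tpow n -> tpow m -> tpow (n + m)};
  tprod_norm : forall n m (f : tpow n) (g : tpow m),
    `|tprod n m f g| = `|f| * `|g|;
  tprod_pure : forall n m (u : 'I_n -> H) (v : 'I_m -> H),
    tprod n m (pure u) (pure v) = pure (cat_fam u v);
  tperm : forall n, 'S_n -> {linear tpow n -> tpow n};
  tperm_continuous : forall n (s : 'S_n), continuous (tperm s);
  tperm_pure : forall n (s : 'S_n) (u : 'I_n -> H),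
    tperm s (pure u) = pure (u \o s);
  contr : forall p q, tpow (p + q) -> tpow p -> tpow q;
  contr_dot : forall p q (f : tpow (p + q)) (v : tpow p) (w : tpow q),
    '<[contr f v, w]> = '<[f, tprod p q v w]>
}.
Arguments pure {R H} t {n} u.
Arguments tprod {R H t n m}.
Arguments tperm {R H t n} s.
Arguments contr {R H t p q} f v.

Section Tensors.
Context (R : realType) (H : hilbertType R) (T : tensor_powers H).

Definition symmetric n : set (T n) :=
  [set f | forall s : 'S_n, tperm s f = f].

Definition symmetrize n (f : T n) : T n :=
  (n`!%:R)^-1 *: \sum_(s : 'S_n) tperm s f.

Definition symprod n m (f : T n) (g : T m) : T (n + m)%N :=
  symmetrize (tprod f g).

Definition tpower n (h : H) : T n := pure T (fun=> h).

End Tensors.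
Arguments symmetric {R H} T n.
Arguments tpower {R H} T n h.

Definition hermite (R : realType) (n : nat) (x : R) : R :=
  (-1) ^+ n * expR (x ^+ 2 / 2) *
  derive1n n (fun y : R => expR (- (y ^+ 2 / 2))) x.

Section WienerSpace.
Context (R : realType) (H : hilbertType R) (B : completeNormedModType R).

(* h is the element of H with which the functional l on B is identified
   (through the embedding j of H in B and the Riesz theorem). *)
Definition represents (j : {linear H -> B}) (l : {linear B -> R^o}) (h : H) :=
  forall k : H, l (j k) = '<[h, k]>.

Record abstract_wiener_space (j : {linear H -> B})
    (P : probability (borel B) R) : Prop := AbstractWienerSpace {
  aws_separable : separable_space H;
  aws_continuous : continuous j;
  aws_injective : injective j;
  aws_dense : dense (range j);
  aws_dual_dense : dense [set h : H | exists l : {linear B -> R^o},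
    continuous l /\ represents j l h];
  (* real and imaginary parts of the characteristic function *)
  aws_cos : forall (l : {linear B -> R^o}) (h : H), continuous l ->
    represents j l h ->
    (\int[P]_x (cos (l x : R))%:E = (expR (- (`|h| ^+ 2 / 2)))%:E)%E;
  aws_sin : forall (l : {linear B -> R^o}) (h : H), continuous l ->
    represents j l h -> (\int[P]_x (sin (l x : R))%:E = 0)%E
}.

Variable P : probability (borel B) R.

Definition cvg_Lr (r : \bar R) (u : nat -> borel B -> R) (W : borel B -> R) :=
  [/\ forall N, u N \in Lfun P r, W \in Lfun P r &
      'N[P]_r[EFin \o (u N \- W)%R]%E @[N --> \oo] --> 0%E].

(* Random variables are represented by functions, so maps into L^2(P) are
   linear only up to almost sure equality. *)
Definition bounded_linear_L2 (V : normedModType R) (D : set V)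
    (A : V -> borel B -> R) : Prop :=
  [/\ forall f, D f -> A f \in Lfun P 2%:E,
      forall (a : R) f g, D f -> D g ->
        A (a *: f + g) = (fun x => a * A f x + A g x) %[ae P] &
      exists C : R, forall f, D f ->
        ('N[P]_2%:E[EFin \o A f] <= (C * `|f|)%:E)%E].

(* The map sending h to the random variable written h with a tilde. *)
Definition wiener_map (j : {linear H -> B}) (tld : H -> borel B -> R) : Prop :=
  bounded_linear_L2 setT tld /\
  forall (l : {linear B -> R^o}) (h : H), continuous l -> represents j l h ->
    tld h = (fun x => l x : R) %[ae P].

Variable T : tensor_powers H.

(* Only the values of [I n] on symmetric tensors are meaningful. *)
Definition multiple_integral (tld : H -> borel B -> R)
    (I : forall n, T n -> borel B -> R) : Prop :=
  [/\ forall n, bounded_linear_L2 (symmetric T n) (I n),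
      forall (c : R) (u : 'I_0 -> H), I 0 (c *: pure T u) = cst c %[ae P] &
      forall n (h : H), h != 0 ->
        I n (tpower T n h) =
        (fun x => `|h| ^+ n * hermite n (tld h x / `|h|)) %[ae P]].

Variable I : forall n, T n -> borel B -> R.

Definition chaos_expansion (F : borel B -> R) (f : forall n, T n) : Prop :=
  (forall n, symmetric T n (f n)) /\
  cvg_Lr 2%:E (fun N x => \sum_(n < N.+1) I (f n) x) F.

Definition is_wick (r : \bar R) (F G W : borel B -> R) : Prop :=
  exists f g : forall n, T n,
    [/\ chaos_expansion F f, chaos_expansion G g &
        cvg_Lr r (fun N x => \sum_(n < N.+1) \sum_(m < N.+1)
                               I (symprod (f n) (g m)) x) W].

(* X represents an element of L^2(B; H^{sym p}). *)
Definition L2_sym p (X : borel B -> T p) : Prop :=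
  [/\ forall U : set (T p), open U -> measurable (X @^-1` U),
      forall x, symmetric T p (X x) &
      (\int[P]_x (`|X x| ^+ 2)%:E < +oo)%E].

(* Y is D^p I_{p+q}(f): p variables of f are left free.  Tested against v, it
   is (p+q)(p+q-1)...(q+1) I_q(<f, v>). *)
Definition is_deriv_integral (p q : nat) (f : T (p + q)%N) (Y : borel B -> T p) : Prop :=
  L2_sym Y /\
  forall v : T p, (fun x => '<[Y x, v]>) =
    (fun x => ((p + q) ^_ p)%N%:R * I (contr f v) x) %[ae P].

(* X is D^p F; the index n >= p of the chaos is written p + q. *)
Definition is_malliavin p (F : borel B -> R) (X : borel B -> T p) : Prop :=
  exists f : forall n, T n, chaos_expansion F f /\
  exists Y : nat -> borel B -> T p,
    [/\ forall q, is_deriv_integral (f (p + q)%N) (Y q),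
        L2_sym X &
        (\int[P]_x (`|\sum_(q < N) Y q x - X x| ^+ 2)%:E)%E
          @[N --> \oo] --> 0%E].

(* <D^p F, D^p G>, with D^0 F = F *)
Definition deriv_pairing (F G : borel B -> R)
    (DF DG : forall p, borel B -> T p) (p : nat) (x : borel B) : R :=
  if p is 0 then F x * G x else '<[DF p x, DG p x]>.

End WienerSpace.

(* Main.v *)
(* By Cauchy-Schwarz the hypotheses make the series
   sum_p (-1)^p/p! <D^p F, D^p G> absolutely convergent in L^1.
   For I_n(f) and I_m(g) the formula
     I_{n+m}(f (x) g) = sum_p (-1)^p/p! <D^p I_n(f), D^p I_m(g)>
   is, for f = h^n and g = k^m, the coefficient of s^n in the expansion of the
   Hermite polynomial of s h + k of degree n + m, and it extends to all symmetric
   tensors because both sides are continuous and powers span a dense subspace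
   (polarization).  Summing over n, m <= N gives F_N <> G_N as the same series for
   the truncations.  By orthogonality of the chaoses |D^p F_N| and |D^p F_N - D^p F|
   are bounded by |D^p F| in L^2, so dominated convergence in p concludes.  The
   isometry of I_n itself follows from the displayed formula by taking
   expectations, since E I_n(f) = 0 for n > 0; on powers the latter is Gaussian
   integration by parts, obtained by differentiating the characteristic function. *)
Require Import Defs.
From HB Require Import structures.
From mathcomp Require Import all_boot all_order all_algebra all_fingroup.
From mathcomp Require Import sesquilinear.
From mathcomp Require Import all_classical all_reals all_analysis.
From mathcomp Require Import measurable_realfun zify ring lra.
(* Imported again so that [tperm] denotes the action on tensors and not the
   transposition of [perm]. *)
Require Import Defs.
Set Implicit Arguments.
Unset Strict Implicit.
Unset Printing Implicit Defensive.
Import Order.TTheory GRing.Theory Num.Theory.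
Import numFieldNormedType.Exports.

Local Open Scope classical_set_scope.
Local Open Scope ring_scope.

(** * Hilbert spaces and their tensor powers *)

(** Random variables are functions and each [I n] is linear only almost surely, so an identity may
    be used at one point for countably many arguments at most. Hence s runs through the natural
    numbers in the Hermite expansion, and coefficients are compared through a polynomial with too
    many roots. The derivatives are given weakly: [is_deriv_integral] prescribes ['<[Y x, v]>] for
    each v, off a null set that depends on v. Norm bounds on Y must be recovered, by comparison with
    the explicit derivatives [dspan] of finite combinations of powers; separability of the tensor
    powers makes countably many v suffice. The continuity of [I n] comes with an unspecified
    constant. It is enough for density arguments, where a combination within e of f leaves an error
    at most K e; the exact norm appears only after the second moments of Hermite polynomials,
    obtained by induction from the vanishing mean of a Wick product. Finally, [is_malliavin] and
    [is_wick] each bring their own chaos kernels; orthogonality identifies them, so that all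
    derivatives and all Wick products refer to the same kernels. *)

Lemma dense_continuous_ext (R : realType) (V : topologicalType) (D : set V)
  (f g : V -> R) : dense D -> continuous f -> continuous g ->
  (forall v, D v -> f v = g v) -> f =1 g.
Proof.
move=> dD cf cg fg t.
apply/eqP; rewrite -subr_eq0 -normr_le0 leNgt; apply/negP => fg0.
pose h x := `|f x - g x|.
have ch : continuous h.
  move=> x; apply: (@continuous_comp _ _ _ (fun x => f x - g x) Num.norm).
    by apply: continuousB; [exact: cf|exact: cg].
  exact: norm_continuous.
have oh : open (h @^-1` [set x | 0 < x]).
  by apply: open_comp; [move=> ? _; exact: ch|exact: open_gt].
have [t' [h0 Dt]] := dD _ (ex_intro _ t fg0) oh.
by move: h0; rewrite /= /h fg// subrr normr0 ltxx.
Qed.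

Section HilbertDot.
Context (R : realType) (V : hilbertType R).
Implicit Types x y z : V.

Lemma dotC x y : '<[x, y]> = '<[y, x]>.
Proof. by rewrite hermC /= expr0 mul1r. Qed.
Lemma dotDl x y z : '<[x + y, z]> = '<[x, z]> + '<[y, z]>.
Proof. exact: linearDl. Qed.
Lemma dotDr x y z : '<[x, y + z]> = '<[x, y]> + '<[x, z]>.
Proof. exact: linearDr. Qed.
Lemma dotZl a x z : '<[a *: x, z]> = a * '<[x, z]>.
Proof. exact: linearZl_LR. Qed.
Lemma dotZr a x z : '<[x, a *: z]> = a * '<[x, z]>.
Proof. exact: linearZr_LR. Qed.
Lemma dotBl x y z : '<[x - y, z]> = '<[x, z]> - '<[y, z]>.
Proof. exact: linearBl. Qed.
Lemma dotBr x y z : '<[x, y - z]> = '<[x, y]> - '<[x, z]>.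
Proof. exact: linearBr. Qed.
Lemma dot0l x : '<[0, x]> = 0.
Proof. exact: linear0l. Qed.
Lemma dot_suml I (r : seq I) (Q : pred I) (f : I -> V) z :
  '<[\sum_(i <- r | Q i) f i, z]> = \sum_(i <- r | Q i) '<[f i, z]>.
Proof. exact: linear_sumlz. Qed.
Lemma dot_sumr I (r : seq I) (Q : pred I) (f : I -> V) z :
  '<[z, \sum_(i <- r | Q i) f i]> = \sum_(i <- r | Q i) '<[z, f i]>.
Proof. exact: linear_sumr. Qed.

Lemma dotxx_ge0 x : 0 <= '<[x, x]>.
Proof. by rewrite hdot_norm sqr_ge0. Qed.

Lemma dot_le x y : `|'<[x, y]>| <= `|x| * `|y|.
Proof.
have [->|y0] := eqVneq y 0.
  by rewrite dotC dot0l !normr0 mulr0.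
have ny : 0 < `|y| by rewrite normr_gt0.
(* This vector is |y|^2 times the component of x orthogonal to y; its squared norm is |y|^2 (|x|^2
   |y|^2 - <x,y>^2). *)
have := dotxx_ge0 (`|y| ^+ 2 *: x - '<[x, y]> *: y).
rewrite dotBl !dotBr !dotZl !dotZr !(dotC y x) !hdot_norm => h.
have h2 : '<[x, y]> ^+ 2 <= (`|x| * `|y|) ^+ 2.
  rewrite -subr_ge0 -(pmulr_rge0 _ (exprn_gt0 2 ny)).
  by apply: le_trans h _; rewrite le_eqVlt; apply/orP; left; apply/eqP; ring.
by rewrite -ler_sqr ?nnegrE ?mulr_ge0// real_normK ?num_real.
Qed.

Lemma dot_continuousl y : continuous (fun x => '<[x, y]>).
Proof.
move=> x; apply/cvgrPdist_le => e e0.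
near=> z; rewrite -dotBl (le_trans (dot_le _ _))//.
have : `|x - z| <= e / (`|y| + 1).
  near: z; apply: cvgr_dist_le; first exact: cvg_id.
  by rewrite divr_gt0// ltr_wpDl.
move=> /ler_wpM2r => /(_ (`|y|)) h; apply: le_trans (h _) _ => //.
rewrite -mulrA; apply: ler_piMr; first exact: ltW.
by rewrite mulrC ler_pdivrMr ?ltr_wpDl// mul1r lerDl.
Unshelve. all: by end_near. Qed.

Lemma dense_approx (D : set V) : dense D -> forall x (e : R), 0 < e ->
  exists2 d, D d & `|x - d| < e.
Proof.
move=> dD x e e0.
have b0 : ball x e !=set0 by exists x; exact: ballxx.
have [d [+ Dd]] := dD (ball x e) b0 (ball_open x e).
by rewrite -ball_normE /= => xd; exists d.
Qed.

Lemma dot_ext x y : (forall z, '<[x, z]> = '<[y, z]>) -> x = y.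
Proof.
move=> h; apply/eqP.
by rewrite -subr_eq0 -normr_eq0 -sqrf_eq0 -hdot_norm dotBl h subrr.
Qed.

End HilbertDot.

Section Tensors.
Context (R : realType) (H : hilbertType R) (T : tensor_powers H).

(** Pure tensors span a dense subspace. Linearity is asked as a bare equation, so that the lemma
    applies directly to functions assembled from [hdot], [tperm] and [tprod]. *)
Lemma pure_scalar_ext n (f g : T n -> R) : continuous f -> continuous g ->
  (forall a x y, f (a *: x + y) = a * f x + f y) ->
  (forall a x y, g (a *: x + y) = a * g x + g y) ->
  (forall u, f (pure T u) = g (pure T u)) -> f =1 g.
Proof.
move=> cf cg lf lg fg t.
have f0 : f 0 = 0 by have := lf 1 0 0; rewrite scale1r addr0 mul1r; lra.
have g0 : g 0 = 0 by have := lg 1 0 0; rewrite scale1r addr0 mul1r; lra.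
have span s : f (\sum_(c <- s) c.1 *: pure T c.2) =
              g (\sum_(c <- s) c.1 *: pure T c.2).
  elim: s => [|c s IH]; first by rewrite !big_nil f0 g0.
  by rewrite !big_cons lf lg fg IH.
by move: t; apply: (dense_continuous_ext (@pure_total _ _ T n)) => // _ [s ->].
Qed.

Lemma dot_pure_scalar n (x : T n) :
  continuous (fun y => '<[y, x]>) /\
  forall a y z, '<[a *: y + z, x]> = a * '<[y, x]> + '<[z, x]>.
Proof.
split; first exact: dot_continuousl.
by move=> a y z; rewrite dotDl dotZl.
Qed.

Lemma pure_ext n (x y : T n) :
  (forall u, '<[x, pure T u]> = '<[y, pure T u]>) -> x = y.
Proof.
move=> h; apply: dot_ext => z; rewrite !(dotC _ z); move: z.
have [c1 l1] := dot_pure_scalar x; have [c2 l2] := dot_pure_scalar y.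
by apply: pure_scalar_ext => // u; rewrite !(dotC (pure T u)).
Qed.

(** On pure tensors this is a reindexing of the product of inner products by s; continuity and
    linearity in each argument do the rest. *)
Lemma dot_tperm n (s : 'S_n) (f g : T n) :
  '<[tperm s f, tperm s g]> = '<[f, g]>.
Proof.
have ct (h : T n) : continuous (fun f : T n => '<[tperm s f, h]>).
  move=> x; apply: (@continuous_comp _ _ _ (tperm s) (fun x => '<[x, h]>)).
    exact: tperm_continuous.
  exact: dot_continuousl.
have lt (h : T n) a x y : '<[tperm s (a *: x + y), h]> =
    a * '<[tperm s x, h]> + '<[tperm s y, h]>.
  by rewrite linearP dotDl dotZl.
have [c1 l1] := dot_pure_scalar g.
move: f; apply: pure_scalar_ext => // u.
rewrite [LHS]dotC [RHS]dotC; have [c2 l2] := dot_pure_scalar (pure T u).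
move: g {c1 l1}; apply: pure_scalar_ext => // v.
rewrite !tperm_pure !pure_dot [RHS](reindex_inj (@perm_inj _ s)).
by apply: eq_bigr => i _.
Qed.

(** Precomposition reverses the order of composition, and so does the left-to-right product of
    permutations; hence s and t keep their order. *)
Lemma tpermM n (s t : 'S_n) (f : T n) : tperm s (tperm t f) = tperm (s * t)%g f.
Proof.
apply: dot_ext => z; move: f.
have ct (r : 'S_n) (h : T n) : continuous (fun f : T n => '<[tperm r f, h]>).
  move=> x; apply: (@continuous_comp _ _ _ (tperm r) (fun x => '<[x, h]>)).
    exact: tperm_continuous.
  exact: dot_continuousl.
apply: pure_scalar_ext.
- move=> x; apply: (@continuous_comp _ _ _ (tperm t) (fun x => '<[tperm s x, z]>)).
    exact: tperm_continuous.
  exact: ct.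
- exact: ct.
- by move=> a x y; rewrite !linearP dotDl dotZl.
- by move=> a x y; rewrite !linearP dotDl dotZl.
- move=> u; rewrite !tperm_pure; congr ('<[pure T _, z]>).
  by apply/funext => i /=; rewrite permM.
Qed.

Lemma norm_tperm n (s : 'S_n) (f : T n) : `|tperm s f| = `|f|.
Proof.
by apply/eqP; rewrite -(@eqrXn2 _ 2)// -!hdot_norm dot_tperm.
Qed.

Lemma symmetrize_linear n a (f g : T n) :
  symmetrize (a *: f + g) = a *: symmetrize f + symmetrize g.
Proof.
rewrite /symmetrize scalerA [a * _]mulrC -scalerA -scalerDr; congr (_ *: _).
by rewrite scaler_sumr -big_split; apply: eq_bigr => s _; rewrite linearP.
Qed.

Lemma symmetrize0 n : symmetrize (0 : T n) = 0.
Proof. by rewrite /symmetrize big1 ?scaler0// => s _; rewrite linear0. Qed.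

Lemma symmetrize_sum n I (r : seq I) (Q : pred I) (c : I -> R) (F : I -> T n) :
  symmetrize (\sum_(i <- r | Q i) c i *: F i) =
  \sum_(i <- r | Q i) c i *: symmetrize (F i).
Proof.
elim: r => [|i r IH]; first by rewrite !big_nil symmetrize0.
by rewrite !big_cons; case: ifP => // _; rewrite symmetrize_linear IH.
Qed.

Lemma symmetrize_tperm n (s : 'S_n) (f : T n) :
  symmetrize (tperm s f) = symmetrize f.
Proof.
congr (_ *: _); rewrite [RHS](reindex_inj (mulIg s)) /=.
by apply: eq_bigr => t _; rewrite tpermM.
Qed.

Lemma symmetrize_symmetric n (f : T n) : symmetric T n (symmetrize f).
Proof.
move=> s; rewrite /symmetrize linearZ_LR /= linear_sum; congr (_ *: _).
rewrite [RHS](reindex_inj (mulgI s)) /=.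
by apply: eq_bigr => t _; rewrite tpermM.
Qed.

Lemma fact_neq0 n : n`!%:R != 0 :> R.
Proof. by rewrite pnatr_eq0 -lt0n fact_gt0. Qed.

Lemma symmetrize_id n (f : T n) : symmetric T n f -> symmetrize f = f.
Proof.
move=> sf; rewrite /symmetrize (eq_bigr (fun=> f)) => [|s _]; last exact: sf.
rewrite sumr_const card_Sn -(scaler_nat _ f) scalerA mulVf ?scale1r//.
Qed.

Lemma norm_symmetrize n (f : T n) : `|symmetrize f| <= `|f|.
Proof.
rewrite /symmetrize normrZ gtr0_norm ?invr_gt0 ?ltr0n ?fact_gt0//.
rewrite ler_pdivrMl ?ltr0n ?fact_gt0//.
apply: le_trans (ler_norm_sum _ _ _) _.
rewrite (eq_bigr (fun=> `|f|)) => [|s _]; last exact: norm_tperm.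
by rewrite sumr_const card_Sn mulr_natl.
Qed.

Lemma symmetric_linear n a (f g : T n) :
  symmetric T n f -> symmetric T n g -> symmetric T n (a *: f + g).
Proof. by move=> sf sg s; rewrite linearP /= sf sg. Qed.

Lemma symmetric0 n : symmetric T n 0.
Proof. by move=> s; rewrite linear0. Qed.

Lemma symmetricB n (f g : T n) :
  symmetric T n f -> symmetric T n g -> symmetric T n (f - g).
Proof. by move=> sf sg s; rewrite linearB /= sf sg. Qed.

Lemma symmetric_closed n (f : T n) :
  (forall e : R, 0 < e -> exists2 g, symmetric T n g & `|f - g| < e) ->
  symmetric T n f.
Proof.
move=> h s; apply/eqP; rewrite -subr_eq0 -normr_le0 leNgt; apply/negP => d0.
(* A symmetric g is fixed by [tperm s], which is isometric, so the defect of f is at most twice its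
   distance to g. *)
have [g sg fg] := h _ (divr_gt0 d0 (ltr0n _ 2)).
have : `|tperm s f - f| <= `|tperm s (f - g)| + `|g - f|.
  by rewrite linearB /= sg (le_trans _ (ler_normD _ _))// addrA subrK.
by rewrite norm_tperm (distrC g) leNgt; move: fg; lra.
Qed.

Lemma tpower_symmetric n (h : H) : symmetric T n (tpower T n h).
Proof. by move=> s; rewrite /tpower tperm_pure. Qed.

Lemma dot_tpower n (h k : H) : '<[tpower T n h, tpower T n k]> = '<[h, k]> ^+ n.
Proof. by rewrite pure_dot prodr_const card_ord. Qed.

Lemma tpower_pure n (h : H) (w : 'I_n -> H) :
  '<[tpower T n h, pure T w]> = \prod_i '<[h, w i]>.
Proof. by rewrite pure_dot. Qed.

(** Inclusion-exclusion. Tested against a pure tensor, the power of a sum over A expands over the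
    maps f into A; the alternating sum over A cancels every f that is not surjective and leaves the
    permutations. *)
Lemma polarization n (u : 'I_n -> H) :
  n`!%:R *: symmetrize (pure T u) =
  \sum_(A : {set 'I_n}) (-1) ^+ #|~: A| *: tpower T n (\sum_(i in A) u i).
Proof.
rewrite /symmetrize scalerA mulfV ?fact_neq0// scale1r.
apply: pure_ext => w; rewrite dot_suml.
under eq_bigr do rewrite tperm_pure pure_dot /=.
rewrite dot_suml.
under [RHS]eq_bigr => A _.
  rewrite dotZl tpower_pure; under eq_bigr do rewrite dot_suml.
  rewrite (bigA_distr_big _ (fun j i => '<[u i, w j]>)) mulr_sumr.
  over.
rewrite (exchange_big_dep predT)//=.
have inner (f : {ffun 'I_n -> 'I_n}) :
    \sum_(A : {set 'I_n} | f \in ffun_on (mem A)) (-1) ^+ #|~: A| *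
      \prod_j '<[u (f j), w j]> =
    (injectiveb f)%:R * \prod_j '<[u (f j), w j]>.
  rewrite -mulr_suml; congr (_ * _).
  (* Expanding this product, i in A contributes 1 and i outside A contributes -1, or 0 when i is a
     value of f: exactly the sets A that contain the image of f survive. *)
  transitivity (\prod_i (1 + (if i \in codom f then 0 else -1 : R))).
    rewrite bigA_distr big_mkcond /=; apply: eq_bigr => A _.
    case: ifPn => [/ffun_onP fA|fA].
      rewrite (bigID (mem A)) /= big1 ?mul1r => [|i ->//].
      rewrite (eq_bigr (fun=> -1 : R)) => [|i iA].
        rewrite prodr_const; congr (_ ^+ _).
        by apply: eq_card => i; rewrite !inE.
      rewrite (negbTE iA); case: codomP => // -[j ij].
      by move: iA; rewrite ij (fA j).
    have /existsP[j fj] : [exists j, f j \notin A].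
      rewrite -negb_forall; apply: contra fA => /forallP h.
      by apply/ffun_onP => j; exact: h.
    by rewrite (bigD1 (f j))//= (negbTE fj) codom_f mul0r.
  have [/injectiveP fi|] := boolP (injectiveb f).
    rewrite big1 // => i _; suff -> : i \in codom f by rewrite addr0.
    by have /inj_card_onto -> := fi.
  (* A map of a finite set to itself that is not injective misses some i, whose factor is 1 - 1. *)
  move=> fi; have : ~~ [forall i, i \in codom f].
    apply: contra fi => /forallP fs; rewrite /injectiveb /dinjectiveb -/(codom f).
    apply/card_uniqP; rewrite size_codom; apply: eq_card => i.
    by rewrite inE; exact: fs.
  rewrite negb_forall => /existsP[i fi']; rewrite (bigD1 i)//= (negbTE fi').
  by rewrite subrr mul0r.
under [RHS]eq_bigr do rewrite inner.
rewrite [RHS](bigID (fun f : {ffun 'I_n -> 'I_n} => injectiveb f)) /=.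
rewrite [X in _ + X]big1 ?addr0 => [|f /negbTE->]; last by rewrite mul0r.
rewrite [RHS](reindex (@pval _)) /=; last first.
  pose in_Sn := insubd (1%g : 'S_n).
  by exists in_Sn => /= f Uf; first apply: val_inj; apply: insubdK.
apply: eq_big => [s|s _]; first by rewrite (valP s).
rewrite (valP s) mul1r; apply: eq_bigr => i _.
by rewrite -pvalE.
Qed.

Definition tspan n (s : seq (R * H)) : T n := \sum_(c <- s) c.1 *: tpower T n c.2.

Lemma tspan_symmetric n s : symmetric T n (tspan n s).
Proof.
rewrite /tspan; elim: s => [|c s IH]; first by rewrite big_nil; exact: symmetric0.
by rewrite big_cons; apply: symmetric_linear => //; exact: tpower_symmetric.
Qed.

Lemma tspan_cat n s t : tspan n (s ++ t) = tspan n s + tspan n t.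
Proof. by rewrite /tspan big_cat. Qed.

Lemma tspanN n s : tspan n [seq (- c.1, c.2) | c <- s] = - tspan n s.
Proof.
by rewrite /tspan big_map -sumrN; apply: eq_bigr => c _; rewrite scaleNr.
Qed.

Lemma tspan_scale n (a : R) s : tspan n [seq (a * c.1, c.2) | c <- s] = a *: tspan n s.
Proof.
by rewrite /tspan big_map scaler_sumr; apply: eq_bigr => c _; rewrite scalerA.
Qed.

Lemma symmetrize_pure_tspan n (u : 'I_n -> H) :
  exists s, symmetrize (pure T u) = tspan n s.
Proof.
exists [seq (n`!%:R^-1 * (-1) ^+ #|~: A|, \sum_(i in A) u i) | A <- index_enum {set 'I_n}].
apply: (scalerI (fact_neq0 n)); rewrite polarization /tspan big_map scaler_sumr.
apply: eq_bigr => A _ /=; rewrite scalerA mulrA mulfV ?fact_neq0//.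
by rewrite mul1r.
Qed.

(** Symmetrization fixes f and does not increase norms, so an approximation of f by pure tensors may
    be symmetrized; polarization then makes it a combination of powers. *)
Lemma tspan_dense n (f : T n) : symmetric T n f -> forall e : R, 0 < e ->
  exists s, `|f - tspan n s| < e.
Proof.
move=> sf e e0; have [_ [s ->] fs] := dense_approx (@pure_total _ _ T n) f e0.
have [t st] : exists t, symmetrize (\sum_(c <- s) c.1 *: pure T c.2) = tspan n t.
  elim: s {fs} => [|c s [t IH]].
    by exists [::]; rewrite /tspan !big_nil symmetrize0.
  have [t' ht'] := symmetrize_pure_tspan c.2.
  exists ([seq (c.1 * d.1, d.2) | d <- t'] ++ t).
  by rewrite big_cons symmetrize_linear IH ht' tspan_cat tspan_scale.
exists t; apply: le_lt_trans fs.
rewrite -st -{1}(symmetrize_id sf) -[X in symmetrize X - _]scale1r.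
set g := \sum_(c <- s) _.
have <- : symmetrize (f - g) = symmetrize (1 *: f) - symmetrize g.
  by rewrite addrC -scaleN1r symmetrize_linear scaleN1r scale1r addrC.
exact: norm_symmetrize.
Qed.

End Tensors.

(** * Binomial expansion of powers, contractions, degree zero, separability *)

Section TensorsBis.
Context (R : realType) (H : hilbertType R) (T : tensor_powers H).

(** The permutation lists A first and its complement afterwards; it will bring the factors h to the
    initial positions that they occupy in [mixed]. *)
Lemma perm_initial n (A : {set 'I_n}) :
  exists s : 'S_n, forall i, (s i \in A) = (i < #|A|)%N.
Proof.
pose l := enum A ++ enum (~: A).
have sl : size l = n by rewrite size_cat -!cardE cardsC card_ord.
have ul : uniq l.
  rewrite cat_uniq !enum_uniq andbT /=; apply/hasPn => i.
  by rewrite !mem_enum inE.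
have si (i : 'I_n) : (i < size l)%N by rewrite sl.
have inj : injective (fun i : 'I_n => nth i l i).
  move=> i j /eqP; rewrite (set_nth_default i j)// nth_uniq// => /eqP ij.
  exact: val_inj.
exists (perm inj) => i; rewrite permE nth_cat -cardE; case: ltnP => iA.
  by rewrite -mem_enum mem_nth// -cardE.
apply/negbTE; have : nth i (enum (~: A)) (i - #|A|) \in enum (~: A).
  apply: mem_nth; rewrite -cardE -(ltn_add2r #|A|) subnK// addnC cardsC card_ord.
  by [].
by rewrite mem_enum inE.
Qed.

(** For m <= n, the symmetric product of m copies of h and n - m copies of k. The degree n is kept
    as the index, so that all terms of the binomial expansion have the same type. *)
Definition mixed n m (h k : H) : T n :=
  symmetrize (pure T (fun i : 'I_n => if (i < m)%N then h else k)).

Lemma symprod_tpower n m (h k : H) :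
  symprod (tpower T n h) (tpower T m k) = mixed (n + m) n h k.
Proof.
rewrite /symprod /tpower tprod_pure; congr (symmetrize (pure T _)).
by apply/funext => i; rewrite /cat_fam; case: fintype.splitP.
Qed.

Lemma tpower_binomial n (s : R) (h k : H) :
  tpower T n (s *: h + k) =
  \sum_(m < n.+1) ('C(n, m)%:R * s ^+ m) *: mixed n m h k.
Proof.
have tE : tpower T n (s *: h + k) = \sum_(A : {set 'I_n})
    s ^+ #|A| *: pure T (fun i => if i \in A then h else k).
  apply: pure_ext => w; rewrite tpower_pure dot_suml.
  under eq_bigr do rewrite dotDl.
  rewrite bigA_distr; apply: eq_bigr => A _; rewrite dotZl pure_dot.
  rewrite -prodr_const [X in X * _]big_mkcond -big_split /=.
  by apply: eq_bigr => i _; case: ifP => _; rewrite ?mul1r// dotZl.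
rewrite -(symmetrize_id (@tpower_symmetric _ _ T n (s *: h + k))) tE symmetrize_sum.
have cA (A : {set 'I_n}) : (#|A| < n.+1)%N.
  by rewrite ltnS (leq_trans (max_card _))// card_ord.
(* After symmetrization the term of A depends only on its cardinality, and 'C(n, m) sets have
   cardinality m. *)
rewrite (partition_big (fun A : {set 'I_n} => Ordinal (cA A)) predT)//=.
apply: eq_bigr => m _.
rewrite (eq_bigr (fun=> s ^+ m *: mixed n m h k)) => [|A /eqP Am].
  rewrite sumr_const -scaler_nat scalerA; congr ((_%:R * _) *: _).
  have := card_draws 'I_n m; rewrite card_ord => <-; apply: eq_card => A.
  by rewrite !inE.
have {}Am : #|A| = m :> nat by rewrite -Am.
rewrite Am; congr (_ *: _); have [t tA] := perm_initial A.
rewrite /mixed -(symmetrize_tperm t) tperm_pure; congr (symmetrize (pure T _)).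
by apply/funext => i /=; rewrite tA Am.
Qed.

Lemma contr_linear p q a (f g : T (p + q)%N) (v : T p) :
  contr (a *: f + g) v = a *: contr f v + contr g v.
Proof. by apply: dot_ext => z; rewrite !(dotDl, dotZl, contr_dot). Qed.

Lemma contrB p q (f g : T (p + q)%N) (v : T p) :
  contr (f - g) v = contr f v - contr g v.
Proof. by apply: dot_ext => z; rewrite !(dotBl, contr_dot). Qed.

Lemma contr_sum p q (s : seq (R * H)) (F : H -> T (p + q)%N) (v : T p) :
  contr (\sum_(c <- s) c.1 *: F c.2) v = \sum_(c <- s) c.1 *: contr (F c.2) v.
Proof.
elim: s => [|c s IH]; last by rewrite !big_cons contr_linear IH.
by rewrite !big_nil; apply: dot_ext => z; rewrite contr_dot !dot0l.
Qed.

(** Duality: the squared norm of [contr f v] is the pairing of f with the tensor product of v and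
    [contr f v]. *)
Lemma norm_contr p q (f : T (p + q)%N) (v : T p) : `|contr f v| <= `|f| * `|v|.
Proof.
have [->|c0] := eqVneq (contr f v) 0; first by rewrite normr0 mulr_ge0.
rewrite -(ler_pM2r (_ : 0 < `|contr f v|)) ?normr_gt0//.
rewrite -expr2 -hdot_norm contr_dot -mulrA -tprod_norm.
exact: le_trans (ler_norm _) (dot_le _ _).
Qed.

Lemma dot_tprod_linear p q (f : T (p + q)%N) (w : T q) :
  continuous (fun v : T p => '<[f, tprod v w]>) /\
  forall a x y, '<[f, tprod (a *: x + y) w]> =
    a * '<[f, tprod x w]> + '<[f, tprod y w]>.
Proof.
have lin a x y : '<[f, tprod (a *: x + y) w]> =
    a * '<[f, tprod x w]> + '<[f, tprod y w]>.
  by rewrite linearPl dotDr dotZr.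
split=> // x; apply/cvgrPdist_le => e e0.
pose c := `|f| * `|w| + 1.
have c0 : 0 < c by rewrite ltr_wpDl// mulr_ge0.
near=> y.
have -> : '<[f, tprod x w]> - '<[f, tprod y w]> = '<[f, tprod (x - y) w]>.
  by rewrite linearBl dotBr.
apply: (le_trans (dot_le _ _)); rewrite tprod_norm.
have : `|x - y| <= e / c.
  by near: y; apply: cvgr_dist_le; [exact: cvg_id|rewrite divr_gt0].
rewrite ler_pdivlMr// => h; apply: le_trans h.
by rewrite /c; have := normr_ge0 (x - y); nra.
Unshelve. all: by end_near. Qed.

Lemma contr_tpower p q (h : H) (v : T p) :
  contr (tpower T (p + q) h) v = '<[tpower T p h, v]> *: tpower T q h.
Proof.
apply: pure_ext => w; rewrite dotZl contr_dot; move: v.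
have [c1 l1] := dot_tprod_linear (tpower T (p + q) h) (pure T w).
apply: pure_scalar_ext => //.
- move=> x; apply: continuousM; last exact: cst_continuous.
  have /= := @dot_continuousl _ _ (tpower T p h) x.
  by under eq_fun do rewrite dotC.
- by move=> a x y; rewrite dotDr dotZr; ring.
- move=> u; rewrite tprod_pure !tpower_pure big_split_ord /=; congr (_ * _).
    by apply: eq_bigr => i _; rewrite /cat_fam (unsplitK (inl i)).
  by apply: eq_bigr => i _; rewrite /cat_fam (unsplitK (inr i)).
Qed.

(** Contracting a power gives a multiple of a power; the general case follows since symmetric
    tensors are closed. *)
Lemma contr_symmetric p q (f : T (p + q)%N) (v : T p) :
  symmetric T (p + q) f -> symmetric T q (contr f v).
Proof.
move=> sf; apply: symmetric_closed => e e0.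
have v0 : 0 < `|v| + 1 by rewrite ltr_wpDl.
have [s fs] := tspan_dense sf (divr_gt0 e0 v0).
exists (contr (tspan T (p + q) s) v).
  rewrite /tspan contr_sum; elim: (s) => [|c r IH].
    by rewrite big_nil; exact: symmetric0.
  rewrite big_cons contr_tpower; apply: symmetric_linear => //.
  rewrite -[X in symmetric T q X]addr0; apply: symmetric_linear.
    exact: tpower_symmetric.
  exact: symmetric0.
rewrite -contrB (le_lt_trans (norm_contr _ _))//.
move: fs; rewrite ltr_pdivlMr// => fs; apply: le_lt_trans fs.
by rewrite ler_wpM2l// lerDl.
Qed.

(** There is only one map out of ['I_0], so the value 0 is immaterial: this is the empty tensor
    product, a unit vector that spans [T 0]. *)
Definition tunit : T 0 := pure T (fun=> 0).

Lemma pure0E (u : 'I_0 -> H) : pure T u = tunit.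
Proof. by congr (pure T _); apply/funext => -[]. Qed.

Lemma dot_tunit : '<[tunit, tunit]> = 1.
Proof. by rewrite pure_dot big_ord0. Qed.

Lemma norm_tunit : `|tunit| = 1.
Proof. by apply/eqP; rewrite -(@eqrXn2 _ 2)// expr1n -hdot_norm dot_tunit. Qed.

Lemma tensor0E (v : T 0) : v = '<[v, tunit]> *: tunit.
Proof. by apply: pure_ext => u; rewrite pure0E dotZl dot_tunit mulr1. Qed.

Lemma symmetric_tensor0 (v : T 0) : symmetric T 0 v.
Proof. by move=> s; rewrite (tensor0E v) linearZ_LR /= tperm_pure pure0E. Qed.

Lemma contr_tensor0 q (f : T q) (v : T 0) :
  contr (p := 0) f v = '<[tunit, v]> *: f.
Proof.
apply: pure_ext => w; rewrite dotZl contr_dot (tensor0E v) linearZl_LR !dotZr.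
rewrite dot_tunit mulr1; congr (_ * '<[_, _]>).
rewrite tprod_pure; congr (pure T _); apply/funext => i.
rewrite /cat_fam; case: fintype.splitP => [[]//|k ik].
by congr w; apply: val_inj.
Qed.

Lemma norm_pure n (u : 'I_n -> H) : `|pure T u| = \prod_i `|u i|.
Proof.
apply/eqP; rewrite -(@eqrXn2 _ 2)// ?prodr_ge0// -hdot_norm pure_dot -prodrXl.
by apply/eqP; apply: eq_bigr => i _; rewrite hdot_norm.
Qed.

Lemma dense_normP (V : normedModType R) (D : set V) :
  (forall x (e : R), 0 < e -> exists2 d, D d & `|x - d| < e) -> dense D.
Proof.
move=> h O [x Ox] oO; have /nbhs_ballP[e /= e0 xO] := open_nbhs_nbhs (conj oO Ox).
have [d Dd xd] := h x e e0; exists d; split=> //; apply: xO.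
by rewrite -ball_normE.
Qed.

Lemma pure_update_diff n (u : 'I_n -> H) i (d : H) :
  `|pure T u - pure T [eta u with i |-> d]| =
  `|u i - d| * \prod_(j < n | j != i) `|u j|.
Proof.
have uE : u = [eta u with i |-> u i].
  by apply/funext => j /=; case: eqP => // ->.
have -> : pure T u - pure T [eta u with i |-> d] =
    pure T [eta u with i |-> u i - d].
  by rewrite [u i - d]addrC -(scaleN1r d) pure_multilinear scaleN1r addrC -uE.
rewrite norm_pure (bigD1 i)//= eqxx; congr (_ * _).
by apply: eq_bigr => j /negbTE ->.
Qed.

(** Rational combinations of pure tensors with entries in a countable dense subset of H are dense.
    Measurability of vector-valued sums and the reduction to countably many test vectors rest on
    this. *)
Lemma tensor_separable n : separable_space H -> separable_space (T n).
Proof.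
move=> [S cS dS]; have [p0 Sp0 _] := dense_approx dS 0 ltr01.
have /countable_injP[f fI] := cS.
pose g m := xget p0 [set x | S x /\ f x = m].
have gf x : S x -> g (f x) = x.
  move=> Sx; have : [set y | S y /\ f y = f x] (g (f x)).
    by apply: (@xgetPex _ p0 [set y | S y /\ f y = f x]); exists x.
  by move=> -[Sg fg]; apply: fI => //; rewrite inE.
(* Vectors are replaced by their numbers under f, with g as decoding, so that the domain is a
   countable type. *)
pose Phi (s : seq (rat * {ffun 'I_n -> nat})) : T n :=
  \sum_(c <- s) ratr c.1 *: pure T (g \o c.2).
exists (range Phi).
  by apply: (sub_countable (card_image_le _ _)); exact: countableP.
apply: dense_normP.
(* K is the closure of the range of [Phi]. It is shown to be a closed subspace that contains all
   pure tensors. *)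
pose K (t : T n) := forall e : R, 0 < e -> exists s, `|t - Phi s| < e.
have Kcl t : (forall e : R, 0 < e -> exists2 x, K x & `|t - x| < e) -> K t.
  move=> h e e0; have e2 : 0 < e / 2 by lra.
  have [x Kx tx] := h _ e2; have [s xs] := Kx _ e2.
  exists s; rewrite -(subrK x t) -addrA (le_lt_trans (ler_normD _ _))//.
  lra.
have Klin a x y : K x -> K y -> K (a *: x + y).
  move=> Kx Ky e e0; have e3 : 0 < e / 3 by lra.
  have nx : 0 < `|x| + 1 by rewrite ltr_wpDl.
  have lta : a - e / 3 / (`|x| + 1) < a by rewrite gtrDl oppr_lt0 divr_gt0.
  have [q] := rat_in_itvoo lta.
  rewrite in_itv /= => /andP[aq qa].
  have nq : 0 < `|ratr q : R| + 1 by rewrite ltr_wpDl.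
  have [s xs] := Kx _ (divr_gt0 e3 nq); have [t yt] := Ky _ e3.
  exists ([seq (q * c.1, c.2) | c <- s] ++ t).
  have -> : Phi ([seq (q * c.1, c.2) | c <- s] ++ t) = ratr q *: Phi s + Phi t.
    rewrite /Phi big_cat big_map scaler_sumr /=; congr (_ + _).
    by apply: eq_bigr => c _; rewrite rmorphM scalerA.
  have -> : a *: x + y - (ratr q *: Phi s + Phi t) =
      (a - ratr q) *: x + (ratr q *: (x - Phi s) + (y - Phi t)).
    by rewrite scalerBl scalerBr [RHS]addrA [X in _ = X + _]addrA subrK opprD addrACA.
  apply: le_lt_trans (ler_normD _ _) _; rewrite normrZ.
  have h1 : `|a - ratr q| * `|x| <= e / 3.
    rewrite gtr0_norm ?subr_gt0//; move: aq; rewrite ltrBlDr -ltrBlDl.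
    rewrite ltr_pdivlMr// => aq; apply: le_trans (ltW aq).
    by rewrite ler_wpM2l ?lerDl// subr_ge0 ltW.
  have h2 : `|ratr q *: (x - Phi s) + (y - Phi t)| < e / 3 + e / 3.
    apply: le_lt_trans (ler_normD _ _) _; rewrite normrZ.
    move: xs; rewrite ltr_pdivlMr// => xs.
    have := normr_ge0 (x - Phi s); nra.
  lra.
have K0 : K 0.
  by move=> e e0; exists [::]; rewrite /Phi big_nil subrr normr0.
(* Induction on the number k of initial entries that are arbitrary: each step moves one entry into S
   at a small cost, by [pure_update_diff]. *)
have Kpure k : (k <= n)%N -> forall u : 'I_n -> H,
    (forall i : 'I_n, (k <= i)%N -> S (u i)) -> K (pure T u).
  elim: k => [_ u Su|k IH kn u Su].
    move=> e e0; exists [:: (1%Q, [ffun i => f (u i)])].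
    rewrite /Phi big_cons big_nil addr0 rmorph1 scale1r /=.
    suff -> : g \o [ffun i => f (u i)] = u by rewrite subrr normr0.
    by apply/funext => i /=; rewrite ffunE gf//; exact: Su.
  apply: Kcl => e e0; pose i := Ordinal kn.
  pose c := \prod_(j < n | j != i) `|u j|.
  have c0 : 0 <= c by exact: prodr_ge0.
  have c1 : 0 < c + 1 by rewrite ltr_wpDl.
  have [d Sd ud] := dense_approx dS (u i) (divr_gt0 e0 c1).
  exists (pure T [eta u with i |-> d]).
    apply: IH; first exact: ltnW.
    move=> j; rewrite leq_eqVlt => /orP[/eqP kj|kj] /=.
      by rewrite -val_eqE /= kj eqxx.
    by rewrite -val_eqE /= gtn_eqF//; exact: Su.
  rewrite pure_update_diff -/c; move: ud; rewrite ltr_pdivlMr// => ud.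
  by have := normr_ge0 (u i - d); nra.
suff KT t : K t by move=> x e /(KT x)[s xs]; exists (Phi s).
apply: Kcl => e e0; have [_ [s ->] ts] := dense_approx (@pure_total _ _ T n) t e0.
exists (\sum_(c <- s) c.1 *: pure T c.2) => //.
elim: s {ts} => [|c s IH]; first by rewrite big_nil.
rewrite big_cons; apply: Klin => //; apply: (Kpure n) => // i.
by rewrite leqNgt ltn_ord.
Qed.

End TensorsBis.

(** * Hermite polynomials *)

Section WickProductSequences.
Context (R : comNzRingType).

(* The value of [I (symprod (tpower T n h) (tpower T m k))] when [u] and [v] are
   the Hermite polynomials in the variables of [h] and [k], and [c = '<[h, k]>]. *)
Definition wick_seq (c : R) (u v : nat -> R) n m : R :=
  \sum_(p < n.+1) (- c) ^+ p * (p`! * 'C(n, p) * 'C(m, p))%:R *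
     (u (n - p)%N * v (m - p)%N).

Lemma wick_seq_widen c u v n m K : (n < K)%N ->
  wick_seq c u v n m = \sum_(p < K) (- c) ^+ p * (p`! * 'C(n, p) * 'C(m, p))%:R *
     (u (n - p)%N * v (m - p)%N).
Proof.
move=> nK; pose F p := (- c) ^+ p * (p`! * 'C(n, p) * 'C(m, p))%:R *
     (u (n - p)%N * v (m - p)%N).
rewrite /wick_seq (big_ord_widen _ F nK) big_mkcond /=; apply: eq_bigr => p _.
by case: ltnP => // np; rewrite bin_small// muln0 mul0n mulr0 mul0r.
Qed.

Lemma wick_seqC c u v n m : wick_seq c u v n m = wick_seq c v u m n.
Proof.
rewrite (@wick_seq_widen _ _ _ n m (n + m).+1) ?ltnS ?leq_addr//.
rewrite (@wick_seq_widen _ _ _ m n (n + m).+1) ?ltnS ?leq_addl//.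
apply: eq_bigr => p _; congr (_ * _%:R * _); last exact: mulrC.
by rewrite mulnAC.
Qed.

Variables (x a c : R) (u : nat -> R).
Hypothesis uS : forall n, u n.+1 = x * u n - n%:R * a * u n.-1.

(** Multiplication by the variable x, corrected by a contraction with each of the two factors.
    Pascal's rule for 'C(n.+1, p) separates the two kinds of terms. *)
Lemma wick_seqSl (w : nat -> R) n m :
  wick_seq c u w n.+1 m = x * wick_seq c u w n m -
    n%:R * a * wick_seq c u w n.-1 m - m%:R * c * wick_seq c u w n m.-1.
Proof.
rewrite [LHS]/wick_seq big_ord_recl /=.
under eq_bigr => p _.
  rewrite /bump /= add1n binS mulnDr mulnDl natrD mulrDr mulrDl subSS.
  over.
rewrite big_split /= addrA.
(* A collects p = 0 and the terms with 'C(n, p.+1), and gives the recurrence of u; in B' the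
   identity (p + 1) 'C(m, p + 1) = m 'C(m - 1, p) lowers m. *)
set A := (X in X + _); set B' := (X in _ + X).
have -> : A = \sum_(p < n.+2) (- c) ^+ p * (p`! * 'C(n, p) * 'C(m, p))%:R *
     (u (n.+1 - p)%N * w (m - p)%N).
  by rewrite [RHS]big_ord_recl /A /= !bin0.
have -> : B' = - (m%:R * c * wick_seq c u w n m.-1).
  rewrite /wick_seq mulr_sumr -sumrN; apply: eq_bigr => p _.
  have -> : (p.+1`! * 'C(n, p) * 'C(m, p.+1))%N =
      (m * (p`! * 'C(n, p) * 'C(m.-1, p)))%N.
    transitivity (p`! * 'C(n, p) * (p.+1 * 'C(m, p.+1)))%N.
      by rewrite factS; ring.
    by rewrite -mul_bin_diag; ring.
  rewrite exprS natrM (_ : m - p.+1 = m.-1 - p)%N; last by lia.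
  ring.
congr (_ - _).
rewrite (@wick_seq_widen _ _ _ n m n.+2)//.
rewrite (@wick_seq_widen _ _ _ n.-1 m n.+2); last by lia.
rewrite !mulr_sumr -sumrB; apply: eq_bigr => p _.
have [np|pn] := ltnP n p.
  rewrite (bin_small np) (@bin_small n.-1) ?(leq_ltn_trans (leq_pred _))//.
  by rewrite !muln0 !mul0n; ring.
rewrite subSn// uS.
have -> : n%:R * a * ((- c) ^+ p * (p`! * 'C(n.-1, p) * 'C(m, p))%:R *
   (u (n.-1 - p)%N * w (m - p)%N)) =
   a * (- c) ^+ p * (p`! * (n * 'C(n.-1, p)) * 'C(m, p))%:R *
   (u (n.-1 - p)%N * w (m - p)%N) by rewrite !natrM; ring.
rewrite mul_bin_down (_ : n.-1 - p = (n - p).-1)%N; last by lia.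
by rewrite !natrM; ring.
Qed.

End WickProductSequences.

Section WickBinomial.
Context (R : comNzRingType) (x y a b c s : R) (u v w : nat -> R).
Hypotheses (u0 : u 0%N = 1)
  (uS : forall n, u n.+1 = x * u n - n%:R * a * u n.-1).
Hypotheses (v0 : v 0%N = 1)
  (vS : forall n, v n.+1 = y * v n - n%:R * b * v n.-1).
Hypotheses (w0 : w 0%N = 1) (wS : forall n, w n.+1 = (s * x + y) * w n -
    n%:R * (s ^+ 2 * a + 2 * s * c + b) * w n.-1).

Lemma wick_seqSr n m :
  wick_seq c u v n m.+1 = y * wick_seq c u v n m -
    m%:R * b * wick_seq c u v n m.-1 - n%:R * c * wick_seq c u v n.-1 m.
Proof.
by rewrite !(wick_seqC _ u v) (wick_seqSl _ vS).
Qed.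

Let G N := \sum_(n < N.+1) 'C(N, n)%:R * s ^+ n * wick_seq c u v n (N - n)%N.

(** Both sides start at 1 and satisfy the recurrence of w, whose variance s^2 a + 2 s c + b is that
    of s h + k. At N = 0 the truncated predecessor is harmless, as its coefficient vanishes. *)
Lemma wick_binomial N :
  w N = \sum_(n < N.+1) 'C(N, n)%:R * s ^+ n * wick_seq c u v n (N - n)%N.
Proof.
rewrite -/(G N).
have G0 : G 0 = 1.
  by rewrite /G /wick_seq !big_ord1 /= !expr0 u0 v0 !(mulr1, mul1r).
have GS M : G M.+1 = (s * x + y) * G M -
    M%:R * (s ^+ 2 * a + 2 * s * c + b) * G M.-1.
  (* By Pascal's rule the additional factor is either s h, which raises the first degree, or k,
     which raises the second. *)
  have -> : G M.+1 = \sum_(n < M.+1) 'C(M, n)%:R * s ^+ n *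
      (s * wick_seq c u v n.+1 (M - n)%N + wick_seq c u v n (M - n).+1).
    rewrite /G big_ord_recl /=.
    under eq_bigr => n _.
      rewrite /bump /= add1n binS natrD !mulrDl subSS; over.
    rewrite big_split /= addrA.
    under [RHS]eq_bigr do rewrite mulrDr.
    rewrite [RHS]big_split /= addrC; congr (_ + _).
      by apply: eq_bigr => n _; rewrite exprS; ring.
    rewrite [RHS]big_ord_recl [in LHS]big_ord_recr /= (@bin_small M M.+1)//.
    rewrite mul0r mul0r addr0 !bin0 !subn0; congr (_ + _).
    apply: eq_bigr => n _; rewrite /bump /= add1n subnSK//.
  under eq_bigr do rewrite (wick_seqSl _ uS) wick_seqSr.
  (* The variance is split as s (s a + c) + (s c + b), since the recurrences in the first and in the
     second degree produce these two parts. *)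
  have -> : M%:R * (s ^+ 2 * a + 2 * s * c + b) * G M.-1 =
      (s * a + c) * (M%:R * s * G M.-1) + (s * c + b) * (M%:R * G M.-1).
    by ring.
  have h1 : M%:R * s * G M.-1 = \sum_(n < M.+1) 'C(M, n)%:R * s ^+ n * n%:R *
      wick_seq c u v n.-1 (M - n)%N.
    rewrite big_ord_recl /= mulr0 mul0r add0r /G mulr_sumr.
    case: M => [|M]; first by rewrite big_ord0 big_ord1 mulr0n !mul0r.
    apply: eq_bigr => n _; rewrite /bump /= add1n subSS exprS.
    have -> : 'C(M.+1, n.+1)%:R * (s * s ^+ n) * n.+1%:R =
        s * s ^+ n * (n.+1 * 'C(M.+1, n.+1))%:R by rewrite natrM; ring.
    by rewrite -mul_bin_diag natrM; ring.
  have h2 : M%:R * G M.-1 = \sum_(n < M.+1) 'C(M, n)%:R * s ^+ n * (M - n)%:R *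
      wick_seq c u v n (M - n).-1.
    rewrite big_ord_recr /= subnn mulr0 mul0r addr0 /G mulr_sumr.
    case: M {h1} => [|M]; first by rewrite big_ord0 big_ord1 mulr0n !mul0r.
    apply: eq_bigr => n _.
    have -> : 'C(M.+1, n)%:R * s ^+ n * (M.+1 - n)%:R =
        s ^+ n * ((M.+1 - n) * 'C(M.+1, n))%:R by rewrite natrM; ring.
    rewrite -mul_bin_down natrM subSn ?leq_ord//=; ring.
  rewrite h1 h2 [G M]/G !mulr_sumr -big_split -sumrB; apply: eq_bigr => n _ /=.
  ring.
elim/ltn_ind: N => -[_|N IH]; first by rewrite w0 G0.
by rewrite wS GS !IH// (leq_ltn_trans (leq_pred _)).
Qed.

End WickBinomial.

Section HermitePolynomials.
Context (R : realType).
Implicit Types (a x : R).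

(* [hpoly a n] is the n-th Hermite polynomial for the centered Gaussian law of
   variance a. *)
Fixpoint hpoly a n : {poly R} :=
  if n is m.+1 then 'X * hpoly a m - a *: (hpoly a m)^`() else 1.

Lemma deriv_hpoly a n : (hpoly a n)^`() = n%:R *: hpoly a n.-1.
Proof.
elim: n => [|n IH]; first by rewrite /= derivC scale0r.
rewrite [hpoly a n.+1]/= derivB derivM derivX mul1r derivZ IH.
case: n IH => [|n] IH.
  by rewrite !scale0r mulr0 deriv0 scaler0 addr0 subr0 scale1r.
rewrite derivZ -scalerAr scalerA [a * _]mulrC -scalerA -addrA -scalerBr.
rewrite -[_ - _]/(hpoly a n.+1).
by rewrite -[in RHS]natr1 scalerDl scale1r addrC.
Qed.

Lemma hpolyS a n x : (hpoly a n.+1).[x] =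
  x * (hpoly a n).[x] - n%:R * a * (hpoly a n.-1).[x].
Proof.
rewrite /= hornerD hornerN hornerM hornerX hornerZ deriv_hpoly hornerZ.
by rewrite mulrA (mulrC a).
Qed.

(** Passes from the normalized polynomials of [multiple_integral] to those of variance l^2, which
    involve no division and make sense for h = 0 as well. *)
Lemma hpoly_scale n (l x : R) : l != 0 ->
  l ^+ n * (hpoly 1 n).[x / l] = (hpoly (l ^+ 2) n).[x].
Proof.
move=> l0; elim/ltn_ind: n => -[_|n IH]; first by rewrite /= !hornerC expr0 mul1r.
rewrite !hpolyS -!IH// ?(leq_ltn_trans (leq_pred _))//.
case: n IH => [|n] _ /=; first by rewrite expr0 expr1; field.
by rewrite !exprS; field.
Qed.

End HermitePolynomials.

(** * Random variables in L^1 and L^2 *)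

Section RandomVariables.
Context d (Om : measurableType d) (R : realType) (P : probability Om R).
Implicit Types X Y : Om -> R.

Definition L1 X := P.-integrable setT (EFin \o X).
(** As a real number an infinite expectation becomes 0, hence the [L1] side conditions below. *)
Definition mean X : R := \int[P]_x X x.
Definition L2 X := measurable_fun setT X /\ L1 (fun x => X x ^+ 2).
Definition nrm2 X := Num.sqrt (mean (fun x => X x ^+ 2)).

Lemma L1_measurable X : L1 X -> measurable_fun setT X.
Proof. by move=> /integrableP[/measurable_EFinP]. Qed.

Lemma L1P X : L1 X <-> X \in Lfun P 1%E.
Proof. by symmetry; exact: Lfun1_integrable. Qed.

Lemma EFin_mean X : L1 X -> (mean X)%:E = (\int[P]_x (X x)%:E)%E.
Proof. by move=> X1; rewrite /mean /Rintegral fineK//; exact: integrable_fin_num. Qed.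

Lemma L1D X Y : L1 X -> L1 Y -> L1 (fun x => X x + Y x).
Proof.
move=> X1 Y1; rewrite /L1 (_ : _ \o _ = (EFin \o X) \+ (EFin \o Y))%E//.
exact: integrableD.
Qed.

Lemma L1Z a X : L1 X -> L1 (fun x => a * X x).
Proof.
move=> X1; rewrite /L1 (_ : _ \o _ = (fun x => a%:E * (EFin \o X) x)%E)//.
exact: integrableZl.
Qed.

Lemma L1B X Y : L1 X -> L1 Y -> L1 (fun x => X x - Y x).
Proof.
move=> X1 Y1; rewrite /L1 (_ : _ \o _ = (EFin \o X) \- (EFin \o Y))%E//.
exact: integrableB.
Qed.

Lemma L1_cst a : L1 (fun=> a).
Proof. by apply/L1P; exact: (Lfun_cst _ a 1). Qed.

Lemma L1_sum I (r : seq I) (Q : pred I) (F : I -> Om -> R) :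
  (forall i, Q i -> L1 (F i)) -> L1 (fun x => \sum_(i <- r | Q i) F i x).
Proof.
move=> F1; elim: r => [|i r IH].
  rewrite (_ : (fun _ => _) = fun=> 0); first exact: L1_cst.
  by apply/funext => x; rewrite big_nil.
have [Qi|Qi] := boolP (Q i); last first.
  by under eq_fun do rewrite big_cons (negbTE Qi).
rewrite (_ : (fun _ => _) = fun x => F i x + \sum_(i <- r | Q i) F i x).
  by apply: L1D => //; exact: F1.
by apply/funext => x; rewrite big_cons Qi.
Qed.

Lemma L1_abs X : L1 X -> L1 (fun x => `|X x|).
Proof. by move=> X1; exact: (integrable_abse X1). Qed.

Lemma L1_le X Y : measurable_fun setT X -> L1 Y ->
  (forall x, `|X x| <= Y x) -> L1 X.
Proof.
move=> mX Y1 XY; apply: (@le_integrable _ _ _ P _ measurableT _ (EFin \o Y)) => //.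
  exact/measurable_EFinP.
move=> x _ /=; rewrite lee_fin (le_trans (XY x))//.
by rewrite ler_norm.
Qed.

Lemma L1_ae X Y : measurable_fun setT X -> L1 Y -> X = Y %[ae P] -> L1 X.
Proof.
move=> mX Y1 XY; have mY := L1_measurable Y1.
move: (Y1) => /integrableP[_ Yoo]; apply/integrableP; split.
  exact/measurable_EFinP.
apply: le_lt_trans Yoo; rewrite le_eqVlt; apply/orP; left; apply/eqP.
apply: ae_eq_integral => //.
- by apply: measurableT_comp => //; exact/measurable_EFinP.
- by apply: measurableT_comp => //; exact/measurable_EFinP.
by apply: filterS XY => x /= h _; rewrite h.
Qed.

Lemma mean_ae X Y : measurable_fun setT X -> measurable_fun setT Y ->
  X = Y %[ae P] -> mean X = mean Y.
Proof.
move=> mX mY XY; congr fine; apply: ae_eq_integral => //.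
- exact/measurable_EFinP.
- exact/measurable_EFinP.
by apply: filterS XY => x /= h _; rewrite h.
Qed.

Lemma meanD X Y : L1 X -> L1 Y -> mean (fun x => X x + Y x) = mean X + mean Y.
Proof. exact: RintegralD. Qed.

Lemma meanB X Y : L1 X -> L1 Y -> mean (fun x => X x - Y x) = mean X - mean Y.
Proof. exact: RintegralB. Qed.

Lemma meanZ a X : L1 X -> mean (fun x => a * X x) = a * mean X.
Proof. exact: RintegralZl. Qed.

Lemma mean_cst a : mean (fun=> a) = a.
Proof. by rewrite /mean Rintegral_cst// [X in fine X]probability_setT mulr1. Qed.

Lemma mean_sum I (r : seq I) (Q : pred I) (F : I -> Om -> R) :
  (forall i, Q i -> L1 (F i)) ->
  mean (fun x => \sum_(i <- r | Q i) F i x) = \sum_(i <- r | Q i) mean (F i).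
Proof.
move=> F1; elim: r => [|i r IH].
  rewrite big_nil -[RHS]mean_cst; congr mean.
  by apply/funext => x; rewrite big_nil.
rewrite big_cons; have [Qi|Qi] := boolP (Q i); last first.
  by rewrite -IH; congr mean; apply/funext => x; rewrite big_cons (negbTE Qi).
rewrite -IH -meanD; [|exact: F1|exact: L1_sum].
by congr mean; apply/funext => x; rewrite big_cons Qi.
Qed.

Lemma mean_ge0 X : (forall x, 0 <= X x) -> 0 <= mean X.
Proof. by move=> X0; apply: Rintegral_ge0 => x _; exact: X0. Qed.

Lemma le_mean X Y : L1 X -> L1 Y -> (forall x, X x <= Y x) -> mean X <= mean Y.
Proof. by move=> X1 Y1 XY; apply: le_Rintegral => // x _; exact: XY. Qed.

Lemma norm_mean_le X : L1 X -> `|mean X| <= mean (fun x => `|X x|).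
Proof. exact: le_normr_Rintegral. Qed.

Lemma mean_abs_eq0 X : L1 X -> mean (fun x => `|X x|) = 0 -> X = cst 0 %[ae P].
Proof.
move=> X1 E0; have mX := L1_measurable X1.
have /(ae_eq_integral_abs P measurableT (iffRL (measurable_EFinP _ _) mX)) h :
    (\int[P]_x `|(X x)%:E|)%E = 0.
  by have := EFin_mean (L1_abs X1); rewrite E0.
by apply: filterS h => x /= h _; have [] := h I.
Qed.

Lemma quadratic_discriminant (a b c : R) : 0 <= a ->
  (forall l, 0 <= l ^+ 2 * a - 2 * l * c + b) -> c ^+ 2 <= a * b.
Proof.
move=> a0 h; have [a00|an0] := eqVneq a 0.
  have [->|c0] := eqVneq c 0; first by rewrite a00 mul0r expr0n.
  (* For a = 0 the expression is affine in l and takes the value -1 here; for a > 0 the minimizer c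
     / a is used below. *)
  have := h ((b + 1) / (2 * c)); rewrite a00 mulr0.
  have -> : 2 * ((b + 1) / (2 * c)) * c = b + 1 by field.
  lra.
have ap : 0 < a by rewrite lt_def an0.
have := h (c / a).
have -> : (c / a) ^+ 2 * a - 2 * (c / a) * c + b = (a * b - c ^+ 2) / a by field.
by rewrite pmulr_lge0 ?invr_gt0// subr_ge0.
Qed.

Lemma L2_mul X Y : L2 X -> L2 Y -> L1 (fun x => X x * Y x).
Proof.
move=> [mX X2] [mY Y2]; apply: L1_le (L1D X2 Y2) _; first exact: measurable_funM.
by move=> x; rewrite ler_norml; apply/andP; split; nra.
Qed.

Lemma L2_abs X : L2 X -> L2 (fun x => `|X x|).
Proof.
move=> [mX X2]; split; first exact: measurableT_comp.
by under eq_fun do rewrite real_normK ?num_real//.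
Qed.

Lemma L2D X Y : L2 X -> L2 Y -> L2 (fun x => X x + Y x).
Proof.
move=> X2 Y2; split; first by apply: measurable_funD; [case: X2|case: Y2].
have -> : (fun x => (X x + Y x) ^+ 2) =
    (fun x => (X x ^+ 2 + Y x ^+ 2) + 2 * (X x * Y x)).
  by apply/funext => x; ring.
apply: L1D; first by apply: L1D; [case: X2|case: Y2].
exact/L1Z/L2_mul.
Qed.

Lemma L2Z a X : L2 X -> L2 (fun x => a * X x).
Proof.
move=> [mX X2]; split; first by apply: measurable_funM => //; exact: measurable_cst.
by under eq_fun do rewrite exprMn; exact: L1Z.
Qed.

Lemma L2_cst a : L2 (fun=> a).
Proof. by split; [exact: measurable_cst|exact: L1_cst]. Qed.

Lemma L2B X Y : L2 X -> L2 Y -> L2 (fun x => X x - Y x).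
Proof.
move=> X2 Y2; have -> : (fun x => X x - Y x) = (fun x => X x + -1 * Y x).
  by apply/funext => x; rewrite mulN1r.
by apply: L2D => //; exact: L2Z.
Qed.

Lemma L2_L1 X : L2 X -> L1 X.
Proof.
move=> X2; have := L2_mul X2 (L2_cst 1).
by under eq_fun do rewrite mulr1.
Qed.

Lemma L2_ae X Y : measurable_fun setT X -> L2 Y -> X = Y %[ae P] -> L2 X.
Proof.
move=> mX [mY Y2] XY; split=> //; apply: (L1_ae _ Y2).
  exact: measurable_funX.
by apply: filterS XY => x /= h _; rewrite h.
Qed.

Lemma nrm2_ge0 X : 0 <= nrm2 X. Proof. exact: sqrtr_ge0. Qed.

Lemma sqr_nrm2 X : nrm2 X ^+ 2 = mean (fun x => X x ^+ 2).
Proof. by rewrite sqr_sqrtr//; apply: mean_ge0 => x; exact: sqr_ge0. Qed.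

(** The discriminant of the expectation of (l |X| - |Y|)^2. The absolute value stays under the
    expectation because L^1 norms of products are to be bounded. *)
Lemma cauchy_schwarz X Y : L2 X -> L2 Y ->
  mean (fun x => `|X x * Y x|) <= nrm2 X * nrm2 Y.
Proof.
move=> X2 Y2; have c0 : 0 <= mean (fun x => `|X x * Y x|) by exact: mean_ge0.
rewrite -ler_sqr ?nnegrE ?mulr_ge0 ?nrm2_ge0// exprMn !sqr_nrm2.
apply: quadratic_discriminant; first by apply: mean_ge0 => x; exact: sqr_ge0.
move=> l; have XY := L1_abs (L2_mul X2 Y2).
have [_ X1] := X2; have [_ Y1] := Y2.
rewrite -!meanZ// -meanB; [|exact: L1Z|exact: L1Z].
rewrite -meanD//; last by apply: L1B; exact: L1Z.
apply: mean_ge0 => x; rewrite normrM.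
have -> : l ^+ 2 * X x ^+ 2 - 2 * l * (`|X x| * `|Y x|) + Y x ^+ 2 =
    (l * `|X x| - `|Y x|) ^+ 2.
  rewrite sqrrB exprMn !real_normK ?num_real//; ring.
exact: sqr_ge0.
Qed.

Lemma mean_abs_le X : L2 X -> mean (fun x => `|X x|) <= nrm2 X.
Proof.
move=> X2; have := cauchy_schwarz X2 (L2_cst 1).
rewrite /nrm2 expr1n mean_cst sqrtr1 mulr1.
by under eq_fun do rewrite mulr1.
Qed.

Lemma nrm2D X Y : L2 X -> L2 Y -> nrm2 (fun x => X x + Y x) <= nrm2 X + nrm2 Y.
Proof.
move=> X2 Y2; rewrite -ler_sqr ?nnegrE ?addr_ge0 ?nrm2_ge0//.
rewrite sqrrD !sqr_nrm2; have [_ X1] := X2; have [_ Y1] := Y2.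
have XY := L2_mul X2 Y2.
have -> : (fun x => (X x + Y x) ^+ 2) =
    (fun x => (X x ^+ 2 + Y x ^+ 2) + 2 * (X x * Y x)).
  by apply/funext => x; ring.
rewrite meanD; [|exact: L1D|exact: L1Z]; rewrite meanD// meanZ//.
have := le_trans (le_trans (ler_norm _) (norm_mean_le XY)) (cauchy_schwarz X2 Y2).
rewrite -mulr_natl; lra.
Qed.

Lemma nrm2_ae X Y : measurable_fun setT X -> measurable_fun setT Y ->
  X = Y %[ae P] -> nrm2 X = nrm2 Y.
Proof.
move=> mX mY XY; congr Num.sqrt; apply: mean_ae.
- exact: measurable_funX.
- exact: measurable_funX.
by apply: filterS XY => x /= h _; rewrite h.
Qed.

Lemma Lnorm2E X :
  ('N[P]_2%:E[EFin \o X] = (\int[P]_x (X x ^+ 2)%:E) `^ 2^-1)%E.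
Proof.
rewrite unlock /=; congr (_ `^ _)%E; apply: eq_integral => x _ /=.
by rewrite powR_mulrn// real_normK ?num_real.
Qed.

Lemma L2P X : L2 X <-> X \in Lfun P 2%:E.
Proof.
split=> [[mX X2]|X2]; last first.
  split; last exact: (Lfun2_integrable_sqr X2).
  by have := sub_Lfun_mfun X2; rewrite inE /=.
rewrite inE; apply/andP; split; rewrite inE //=.
rewrite /finite_norm Lnorm2E; apply: poweR_lty.
exact: (integrable_lty measurableT X2).
Qed.

Lemma Lnorm2_nrm2 X : L2 X -> ('N[P]_2%:E[EFin \o X])%E = (nrm2 X)%:E.
Proof.
move=> [mX X2]; rewrite Lnorm2E -(EFin_mean X2) poweR_EFin /nrm2 powR12_sqrt//.
by apply: mean_ge0 => x; exact: sqr_ge0.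
Qed.

Lemma Lnorm1_mean X : L1 X -> ('N[P]_1%E[EFin \o X])%E = (mean (fun x => `|X x|))%:E.
Proof. by move=> X1; rewrite Lnorm1 EFin_mean//; exact: L1_abs. Qed.

End RandomVariables.

(** * Moments of a Gaussian variable *)

Section HermiteDerivative.
Context (R : realType).

Lemma is_derive_gauss (x : R) :
  is_derive x 1 (fun y : R => expR (- (y ^+ 2 / 2))) (- x * expR (- (x ^+ 2 / 2))).
Proof.
pose p : {poly R} := - (2^-1 *: 'X^2).
have hp : horner p = (fun y : R => - (y ^+ 2 / 2)).
  by apply/funext => y; rewrite /p hornerN hornerZ hornerXn mulrC.
have := is_derive_poly p x; rewrite hp => dp.
have := @is_derive1_comp R expR (fun y => - (y ^+ 2 / 2)) x _ _ (is_derive_expR _) dp.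
move=> h; apply: (is_derive_eq h); rewrite mulrC; congr (_ * _).
by rewrite /p derivN derivZ derivXn hornerN hornerZ hornerMn hornerXn; field.
Qed.

Lemma derive1n_gauss n (x : R) :
  derive1n n (fun y : R => expR (- (y ^+ 2 / 2))) x =
  (-1) ^+ n * (hpoly 1 n).[x] * expR (- (x ^+ 2 / 2)).
Proof.
elim: n x => [|n IH] x; first by rewrite derive1n0 /= hornerC expr0 !mul1r.
rewrite derive1nS (_ : derive1n n _ = fun x => ((-1) ^+ n *: hpoly 1 n).[x] *
    expR (- (x ^+ 2 / 2))); last first.
  by apply/funext => y; rewrite IH hornerZ.
rewrite derive1E.
have := is_deriveM (is_derive_poly ((-1) ^+ n *: hpoly 1 n) x) (is_derive_gauss x).
move=> h; rewrite (derive_val (is_derive := h)).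
rewrite derivZ /GRing.scale /= !hornerZ hornerD hornerN hornerZ hornerM hornerX.
rewrite (exprS (-1) n); ring.
Qed.

Lemma hermite_hpoly n (x : R) : hermite n x = (hpoly 1 n).[x].
Proof.
rewrite /hermite derive1n_gauss mulrACA -expRD subrr expR0 mulr1 mulrA -expr2.
by rewrite sqrr_sign mul1r.
Qed.

Lemma lipschitz_derive (f df : R -> R) (a b : R) :
  (forall x : R, is_derive x 1 f (df x)) -> (forall x, `|df x| <= 1) ->
  `|f b - f a| <= `|b - a|.
Proof.
move=> fdf df1; wlog ab : a b / a <= b => [h|].
  by have [/h//|/ltW/h] := leP a b; rewrite distrC (distrC b).
have cf : {within `[a, b], continuous f}.
  apply: continuous_subspaceT => x; apply: differentiable_continuous.
  by apply/derivable1_diffP; exact: ex_derive.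
have [c _ ->] := MVT_segment ab (fun x _ => fdf x) cf.
by rewrite normrM ler_piMl.
Qed.

Lemma cos_lipschitz (a b : R) : `|cos b - cos a| <= `|b - a|.
Proof.
apply: (@lipschitz_derive cos (fun x => - sin x)) => x.
by rewrite normrN sin_max.
Qed.

Lemma sin_lipschitz (a b : R) : `|sin b - sin a| <= `|b - a|.
Proof.
by apply: (@lipschitz_derive sin cos) => x; exact: cos_max.
Qed.

Lemma measurable_cos : measurable_fun setT (@cos R).
Proof. by apply: continuous_measurable_fun; exact: continuous_cos. Qed.

Lemma measurable_sin : measurable_fun setT (@sin R).
Proof. by apply: continuous_measurable_fun; exact: continuous_sin. Qed.

End HermiteDerivative.

Section GaussianMoments.
Context d (Om : measurableType d) (R : realType) (P : probability Om R).
Variables (X : Om -> R) (v : R).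
Hypothesis Xn : forall n, L1 P (fun x => X x ^+ n).
Hypothesis Xcos : forall t, mean P (fun x => cos (t * X x)) = expR (- (t ^+ 2 * v / 2)).
Hypothesis Xsin : forall t, mean P (fun x => sin (t * X x)) = 0.

Let mX : measurable_fun setT X.
Proof. by have := L1_measurable (Xn 1); under eq_fun do rewrite expr1. Qed.

(** Differentiation under the expectation: as [df] is bounded by 1, |X|^(n+1) dominates the
    derivative for all values of the parameter, and any interval around t will do. *)
Lemma is_derive_mean_trig n (f df : R -> R) :
  (forall x : R, is_derive x 1 f (df x)) -> measurable_fun setT f ->
  (forall x, `|f x| <= 1) -> (forall x, `|df x| <= 1) -> forall t : R,
  is_derive t 1 (fun s => mean P (fun x => X x ^+ n * f (s * X x)))
    (mean P (fun x => X x ^+ n.+1 * df (t * X x))).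
Proof.
move=> fdf mf f1 df1 t.
pose F t (x : Om) := X x ^+ n * f (t * X x).
have dF (s : R) x : is_derive s 1 (F ^~ x) (X x ^+ n.+1 * df (s * X x)).
  have dX : is_derive s 1 ( *%R^~ (X x)) (X x).
    pose p : {poly R} := X x *: 'X.
    have hp : horner p = ( *%R^~ (X x)).
      by apply/funext => y; rewrite /p hornerZ hornerX mulrC.
    have := is_derive_poly p s; rewrite hp => dp.
    apply: (is_derive_eq dp).
    by rewrite /p derivZ derivX hornerZ hornerC mulr1.
  have := is_deriveZ (X x ^+ n) (@is_derive1_comp R f ( *%R^~ (X x)) s _ _ (fdf (s * X x)) dX).
  move=> h; apply: (is_derive_eq h).
  by rewrite /GRing.scale /= exprS; ring.
have mfX s : measurable_fun setT (fun x => f (s * X x)).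
  have ms : measurable_fun setT (fun x => s * X x).
    by apply: measurable_funM; [exact: measurable_cst|exact: mX].
  exact: (measurableT_comp mf ms).
have F1 s : L1 P (F s).
  apply: L1_le (L1_abs (Xn n)) _.
    by apply: measurable_funM => //; exact: measurable_funX.
  by move=> x; rewrite /F normrM ler_piMr.
have Ft : `]t - 1, t + 1[%classic t by rewrite /= in_itv /= ltrBlDr ltrDl ltr01.
have ub (s : R) y : `|partial1of2 F s y| <= `|X y ^+ n.+1|.
  by rewrite partial1of2E (derive_val (is_derive := dF s y)) normrM ler_piMr.
have cv := @cvg_differentiation_under_integral R _ Om P F setT measurableT t _ _ Ft
  (fun s _ => F1 s) (fun s y _ _ => ex_derive (is_derive := dF s y))
  (fun y => `|X y ^+ n.+1|) (fun y => normr_ge0 _) (L1_abs (Xn n.+1))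
  (fun s y _ _ => ub s y).
have pE : \int[P]_y partial1of2 F t y = mean P (fun x => X x ^+ n.+1 * df (t * X x)).
  apply: eq_Rintegral => y _.
  by rewrite partial1of2E (derive_val (is_derive := dF t y)).
rewrite -pE; apply: DeriveDef.
  apply/cvg_ex; eexists.
  by under eq_fun do rewrite [_ *: 1]mulr1; exact: cv.
by apply/cvg_lim => //; under eq_fun do rewrite [_ *: 1]mulr1; exact: cv.
Qed.

(** [C n] and [S n] are the real and imaginary parts of the expectation of X^n e^(itX), which up to
    a power of i is the n-th derivative of the characteristic function. *)
Let C n t := mean P (fun x => X x ^+ n * cos (t * X x)).
Let S n t := mean P (fun x => X x ^+ n * sin (t * X x)).

Let dC n (t : R) : is_derive t 1 (C n) (- S n.+1 t).
Proof.
have := @is_derive_mean_trig n cos (fun x => - sin x) (@is_derive_cos R).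
have sN x : `|- sin x| <= 1 :> R by rewrite normrN sin_max.
move=> /(_ (@measurable_cos R) (@cos_max R) sN t) h.
apply: (is_derive_eq h).
rewrite /S -mulN1r -meanZ; first by congr mean; apply/funext => x; ring.
apply: L1_le (L1_abs (Xn n.+1)) _.
  apply: measurable_funM; first exact: measurable_funX.
  apply: (measurableT_comp (@measurable_sin R)).
  by apply: measurable_funM; [exact: measurable_cst|exact: mX].
by move=> x; rewrite normrM ler_piMr// sin_max.
Qed.

Let dS n (t : R) : is_derive t 1 (S n) (C n.+1 t).
Proof.
exact: (@is_derive_mean_trig n sin cos (@is_derive_sin R) (@measurable_sin R)
  (@sin_max R) (@cos_max R)).
Qed.

Let derive_ext (f g : R -> R) (t a b : R) :
  f = g -> is_derive t 1 f a -> is_derive t 1 g b -> a = b.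
Proof.
by move=> -> h1 h2; rewrite -(derive_val (is_derive := h1))
  (derive_val (is_derive := h2)).
Qed.

Let dlin (f : R -> R) (t k a : R) : is_derive t 1 f a ->
  is_derive t 1 (fun s => k * s * f s) (k * f t + k * t * a).
Proof.
move=> df; have dp := is_derive_poly (k *: 'X) t.
have hp : horner (k *: 'X) = (fun y => k * y).
  by apply/funext => y; rewrite hornerZ hornerX.
rewrite hp in dp; have h := is_deriveM dp df; apply: (is_derive_eq h).
by rewrite derivZ derivX hornerZ hornerC /GRing.scale /=; ring.
Qed.

Let dZ (f : R -> R) (t k a : R) : is_derive t 1 f a ->
  is_derive t 1 (fun s => k * f s) (k * a).
Proof. by move=> df; exact: (is_deriveZ k df). Qed.

(** The characteristic function satisfies phi' = - v t phi; Leibniz' rule gives its higher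
    derivatives, here split into real and imaginary parts. Each induction step differentiates the
    identity for the other function. *)
Lemma gaussian_trig_moments n :
  C n.+1 = (fun t => (- v * t) * S n t + n%:R * v * C n.-1 t) /\
  S n.+1 = (fun t => (v * t) * C n t + n%:R * v * S n.-1 t).
Proof.
have S0 : S 0 = fun=> 0.
  by apply/funext => t; rewrite /S; under eq_fun do rewrite mul1r; exact: Xsin.
elim: n => [|n [IC IS]].
  have C0 : C 0 = fun t => expR (- (t ^+ 2 * v / 2)).
    by apply/funext => t; rewrite /C; under eq_fun do rewrite mul1r; exact: Xcos.
  split; apply/funext => t.
    rewrite /= S0 mulr0 mul0r mul0r addr0.
    by apply: (derive_ext S0 (dS 0 t)); exact: is_derive_cst.
  rewrite /= !mul0r addr0; apply: oppr_inj.
  apply: (derive_ext C0 (dC 0 t)).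
  pose p : {poly R} := - ((v / 2) *: 'X^2).
  have hp : horner p = (fun y : R => - (y ^+ 2 * v / 2)).
    by apply/funext => y; rewrite /p hornerN hornerZ hornerXn; ring.
  have := is_derive_poly p t; rewrite hp => dp.
  have
    := @is_derive1_comp R expR (fun y => - (y ^+ 2 * v / 2)) t _ _ (is_derive_expR _) dp.
  move=> h; apply: (is_derive_eq h); rewrite C0.
  by rewrite /p derivN derivZ derivXn hornerN hornerZ hornerMn hornerXn; field.
split; apply/funext => t.
  apply: (derive_ext IS (dS n.+1 t)).
  have h := is_deriveD (dlin v (dC n t)) (dZ (n%:R * v) (dS n.-1 t)).
  apply: (is_derive_eq h) => /=.
  (* The successor of [n.-1] is n only for n > 0; for n = 0 the coefficient of that term
     vanishes. *)
  case: n {IC IS h} => [|n] /=; first by rewrite !mul0r; ring.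
  by rewrite /= -(natr1 n.+1); ring.
apply: oppr_inj; apply: (derive_ext IC (dC n.+1 t)).
have h := is_deriveD (dlin (- v) (dS n t)) (dZ (n%:R * v) (dC n.-1 t)).
apply: (is_derive_eq h) => /=.
case: n {IC IS h} => [|n] /=; first by rewrite !mul0r; ring.
by rewrite /= -(natr1 n.+1); ring.
Qed.

Lemma gaussian_moments n : mean P (fun x => X x ^+ n.+1) =
  n%:R * v * mean P (fun x => X x ^+ n.-1).
Proof.
have := congr1 (fun f => f 0) (gaussian_trig_moments n).1.
rewrite mulr0 mul0r add0r /C.
by under eq_fun do rewrite mul0r cos0 mulr1;
  under [in RHS]eq_fun do rewrite mul0r cos0 mulr1.
Qed.

Lemma L1_horner (p : {poly R}) : L1 P (fun x => p.[X x]).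
Proof.
under eq_fun do rewrite horner_coef.
by apply: L1_sum => i _; apply: L1Z.
Qed.

Lemma gaussian_integration_by_parts (p : {poly R}) :
  mean P (fun x => ('X * p).[X x]) = v * mean P (fun x => p^`().[X x]).
Proof.
rewrite -[p]coefK poly_def mulr_sumr linear_sum /=.
rewrite (_ : (fun x => _) = fun x => \sum_(i < size p) ('X * (p`_i *: 'X^i)).[X x]);
  last first.
  by apply/funext => x; rewrite horner_sum.
rewrite (_ : (fun x => _.[X x]) = fun x => \sum_(i < size p) (p`_i *: 'X^i)^`().[X x]);
  last first.
  by apply/funext => x; rewrite horner_sum.
rewrite mean_sum; last by move=> i _; exact: L1_horner.
rewrite mean_sum; last by move=> i _; exact: L1_horner.
rewrite mulr_sumr; apply: eq_bigr => i _.
under eq_fun do rewrite -scalerAr -exprS hornerZ hornerXn.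
under [in RHS]eq_fun
  do rewrite derivZ derivXn hornerZ hornerMn hornerXn -mulr_natl mulrA.
rewrite !meanZ// gaussian_moments; ring.
Qed.

(** By its recursive definition [hpoly v n.+1] is the difference of the two sides of the integration
    by parts for [hpoly v n]. *)
Lemma mean_hpoly n : mean P (fun x => (hpoly v n.+1).[X x]) = 0.
Proof.
rewrite (_ : (fun x => _) = fun x => ('X * hpoly v n).[X x] - v * (hpoly v n)^`().[X x]);
  last first.
  by apply/funext => x; rewrite /= hornerD hornerN hornerZ.
rewrite meanB ?meanZ ?gaussian_integration_by_parts ?subrr//; try exact: L1_horner.
exact/L1Z/L1_horner.
Qed.

End GaussianMoments.

(** * Vector-valued random variables *)

Section VectorRandomVariables.
Context d (Om : measurableType d) (R : realType).

(** Measurability as in [L2_sym], for values in a space that carries no sigma-algebra structure. *)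
Definition borel_fun (V : topologicalType) (X : Om -> V) :=
  forall U : set V, open U -> measurable (X @^-1` U).

Lemma borel_fun_comp (V W : topologicalType) (X : Om -> V) (f : V -> W) :
  borel_fun X -> continuous f -> borel_fun (f \o X).
Proof.
move=> bX cf U oU; apply: (bX (f @^-1` U)).
by apply: open_comp => // x _; exact: cf.
Qed.

Lemma borel_fun_measurable (X : Om -> R) :
  borel_fun (V := R) X <-> measurable_fun setT X.
Proof.
split=> [bX|mX U oU].
  apply: (measurability (@RGenOpens.G R)); first exact: RGenOpens.measurableE.
  move=> _ [_ [a [b ->]] <-]; rewrite setTI; apply: bX.
  exact: interval_open.
by rewrite -[X in measurable X]setTI; apply: mX => //; exact: open_measurable.
Qed.

Lemma borel_fun_cst (V : topologicalType) (v : V) : borel_fun (fun=> v).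
Proof.
move=> U _; have [Uv|Uv] := pselect (U v).
  by rewrite (_ : _ @^-1` _ = setT)//; apply/seteqP; split.
by rewrite (_ : _ @^-1` _ = set0)//; apply/seteqP; split.
Qed.

End VectorRandomVariables.

Section SeparableValued.
Context d (Om : measurableType d) (R : realType) (P : probability Om R).
Context (V : hilbertType R).
Hypothesis sepV : separable_space V.
Implicit Types X Y : Om -> V.

Lemma separable_seq : exists e : nat -> V, forall x (r : R), 0 < r ->
  exists n, `|x - e n| < r.
Proof.
move: sepV => [S cS dS]; have /countable_injP[f fI] := cS.
exists (fun m => xget 0 [set x | S x /\ f x = m]) => x r r0.
have [v Sv xv] := dense_approx dS x r0; exists (f v).
have [Sg fg] : [set y | S y /\ f y = f v] (xget 0 [set x | S x /\ f x = f v]).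
  by apply: xgetPex; exists v.
by rewrite (_ : xget _ _ = v)//; apply: fI; rewrite ?inE.
Qed.

(** By separability the preimage of U is a countable union of events on which X and Y lie in small
    balls, centered in the dense sequence, whose sum set is inside U. *)
Lemma borel_funD X Y : borel_fun X -> borel_fun Y ->
  borel_fun (fun x => X x + Y x).
Proof.
move=> bX bY U oU; have [e eV] := separable_seq.
pose r n : R := n.+1%:R^-1; have r0 n : 0 < r n by rewrite invr_gt0.
pose A n i k := [set x | (forall z, `|e i + e k - z| < 2 * r n -> U z) /\
   (ball (e i) (r n) (X x) /\ ball (e k) (r n) (Y x))].
rewrite (_ : _ @^-1` U = \bigcup_n \bigcup_i \bigcup_k A n i k); last first.
  apply/seteqP; split=> [x /= Ux|x [n _ [i _ [k _ [h [hX hY]]]]] /=]; last first.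
    apply: h; move: hX hY; rewrite -!ball_normE /= => hX hY.
    rewrite opprD addrACA (le_lt_trans (ler_normD _ _))//; lra.
  have /nbhs_ballP[eps /= eps0 hU] := open_nbhs_nbhs (conj oU Ux).
  (* Two radii for the distances of X and Y to the centers, and two for the ball around the sum of
     the centers. *)
  have [n nr] : exists n, 4 * r n < eps.
    have e4 : 0 < eps / 4 by lra.
    have := near_infty_natSinv_lt (PosNum e4) => -[N _ /(_ N (leqnn N)) /= hN].
    exists N; have {}hN : r N < eps / 4 := hN; lra.
  have [i iX] := eV (X x) _ (r0 n); have [k kY] := eV (Y x) _ (r0 n).
  exists n => //; exists i => //; exists k => //; split; last first.
    by rewrite -!ball_normE /= distrC (distrC (e k)).
  move=> z hz; apply: hU; rewrite -ball_normE /=.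
  have -> : X x + Y x - z = (X x - e i) + ((Y x - e k) + (e i + e k - z)).
    by rewrite [RHS]addrA (addrACA (X x)) -opprD [RHS]addrA subrK.
  have h1 := ler_normD (X x - e i) ((Y x - e k) + (e i + e k - z)).
  have h2 := ler_normD (Y x - e k) (e i + e k - z).
  apply: le_lt_trans h1 _; apply: lt_trans nr; lra.
apply: bigcup_measurable => n _; apply: bigcup_measurable => i _.
apply: bigcup_measurable => k _; rewrite /A.
have [h|h] := pselect (forall z, `|e i + e k - z| < 2 * r n -> U z).
  rewrite (_ : mkset _ = X @^-1` (ball (e i) (r n)) `&` Y @^-1` (ball (e k) (r n))).
    by apply: measurableI; [apply: bX|apply: bY]; exact: ball_open.
  by apply/seteqP; split=> [x [_ //]|x].
by rewrite (_ : mkset _ = set0)//; apply/seteqP; split=> [x []|].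
Qed.

Lemma borel_funZ (xi : Om -> R) (v : V) : measurable_fun setT xi ->
  borel_fun (fun x => xi x *: v).
Proof.
move=> /borel_fun_measurable bxi.
apply: (@borel_fun_comp _ _ R V xi (fun a => a *: v)) => // a.
exact: scalel_continuous.
Qed.

Lemma borel_funZl (a : R) X : borel_fun X -> borel_fun (fun x => a *: X x).
Proof.
move=> bX; apply: (@borel_fun_comp _ _ V V X (fun v => a *: v)) => // v.
exact: scaler_continuous.
Qed.

Lemma borel_fun_norm X : borel_fun X -> measurable_fun setT (fun x => `|X x|).
Proof.
move=> bX; apply/borel_fun_measurable.
by apply: (@borel_fun_comp _ _ V R X Num.norm) => //; exact: norm_continuous.
Qed.

Lemma borel_funB X Y : borel_fun X -> borel_fun Y ->
  borel_fun (fun x => X x - Y x).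
Proof.
move=> bX bY; rewrite (_ : (fun _ => _) = (fun x => X x + -1 *: Y x)).
  by apply: borel_funD => //; exact: borel_funZl.
by apply/funext => x; rewrite scaleN1r.
Qed.

Lemma borel_fun_dot X Y : borel_fun X -> borel_fun Y ->
  measurable_fun setT (fun x => '<[X x, Y x]>).
Proof.
move=> bX bY; rewrite (_ : (fun _ => _) =
    (fun x => 2^-1 * (`|X x + Y x| ^+ 2 - (`|X x| ^+ 2 + `|Y x| ^+ 2)))); last first.
  by apply/funext => x; rewrite -!hdot_norm dotDl !dotDr (dotC (Y x) (X x)); field.
apply: measurable_funM; first exact: measurable_cst.
apply: measurable_funB; last apply: measurable_funD; apply: measurable_funX;
  apply: borel_fun_norm => //.
exact: borel_funD.
Qed.

Definition VL2 X := borel_fun X /\ L1 P (fun x => `|X x| ^+ 2).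
Definition vnrm X := nrm2 P (fun x => `|X x|).

Lemma VL2_L2 X : VL2 X -> L2 P (fun x => `|X x|).
Proof. by move=> [bX X2]; split=> //; exact: borel_fun_norm. Qed.

Lemma VL2_le X (xi : Om -> R) : borel_fun X -> L2 P xi ->
  (forall x, `|X x| <= xi x) -> VL2 X.
Proof.
move=> bX [_ xi2] h; split=> //; apply: L1_le xi2 _.
  by apply: measurable_funX; exact: borel_fun_norm.
move=> x; rewrite ger0_norm ?sqr_ge0//.
by rewrite ler_sqr ?nnegrE// (le_trans _ (h x)).
Qed.

Lemma VL2D X Y : VL2 X -> VL2 Y -> VL2 (fun x => X x + Y x).
Proof.
move=> X2 Y2; apply: (VL2_le _ (L2D (VL2_L2 X2) (VL2_L2 Y2))).
  by apply: borel_funD; [case: X2|case: Y2].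
by move=> x; exact: ler_normD.
Qed.

Lemma VL2B X Y : VL2 X -> VL2 Y -> VL2 (fun x => X x - Y x).
Proof.
move=> X2 Y2; apply: (VL2_le _ (L2D (VL2_L2 X2) (VL2_L2 Y2))).
  by apply: borel_funB; [case: X2|case: Y2].
by move=> x; exact: ler_normB.
Qed.

Lemma VL2_0 : VL2 (fun=> 0).
Proof.
split; first exact: borel_fun_cst.
by under eq_fun do rewrite normr0; exact: L1_cst.
Qed.

Lemma VL2_sum I (r : seq I) (F : I -> Om -> V) :
  (forall i, VL2 (F i)) -> VL2 (fun x => \sum_(i <- r) F i x).
Proof.
move=> F2; elim: r => [|i r IH].
  rewrite (_ : (fun _ => _) = fun=> 0); first exact: VL2_0.
  by apply/funext => x; rewrite big_nil.
rewrite (_ : (fun _ => _) = fun x => F i x + \sum_(i <- r) F i x).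
  exact: VL2D.
by apply/funext => x; rewrite big_cons.
Qed.

Lemma VL2Z (xi : Om -> R) (v : V) : L2 P xi -> VL2 (fun x => xi x *: v).
Proof.
move=> xi2; apply: (VL2_le _ (L2Z `|v| (L2_abs xi2))).
  by apply: borel_funZ; case: xi2.
by move=> x; rewrite normrZ mulrC.
Qed.

Lemma VL2_dot X Y : VL2 X -> VL2 Y -> L1 P (fun x => '<[X x, Y x]>).
Proof.
move=> X2 Y2; apply: (L1_le _ (L2_mul (VL2_L2 X2) (VL2_L2 Y2))).
  by apply: borel_fun_dot; [case: X2|case: Y2].
by move=> x; exact: dot_le.
Qed.

Lemma mean_dot_le X Y : VL2 X -> VL2 Y ->
  mean P (fun x => `|'<[X x, Y x]>|) <= vnrm X * vnrm Y.
Proof.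
move=> X2 Y2; apply: le_trans (cauchy_schwarz (VL2_L2 X2) (VL2_L2 Y2)).
apply: le_mean; [exact/L1_abs/VL2_dot|exact/L1_abs/L2_mul/VL2_L2/Y2/VL2_L2|].
by move=> x; rewrite normrM !normr_id dot_le.
Qed.

Lemma le_nrm2 (X Y : Om -> R) : L2 P X -> L2 P Y ->
  (forall x, `|X x| <= `|Y x|) -> nrm2 P X <= nrm2 P Y.
Proof.
move=> [_ X2] [_ Y2] h; apply: ler_wsqrtr; apply: le_mean => // x.
by rewrite -[leLHS]real_normK ?num_real// -[leRHS]real_normK ?num_real// ler_sqr ?nnegrE.
Qed.

Lemma vnrm_ge0 X : 0 <= vnrm X. Proof. exact: nrm2_ge0. Qed.

Lemma sqr_vnrm X : vnrm X ^+ 2 = mean P (fun x => `|X x| ^+ 2).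
Proof. exact: sqr_nrm2. Qed.

Lemma vnrmD X Y : VL2 X -> VL2 Y -> vnrm (fun x => X x + Y x) <= vnrm X + vnrm Y.
Proof.
move=> X2 Y2; apply: le_trans (nrm2D (VL2_L2 X2) (VL2_L2 Y2)).
apply: le_nrm2; first exact/VL2_L2/VL2D.
  by apply: L2D; exact: VL2_L2.
by move=> x; rewrite normr_id (ger0_norm (addr_ge0 _ _))// ler_normD.
Qed.

Lemma vnrmC X Y : vnrm (fun x => X x - Y x) = vnrm (fun x => Y x - X x).
Proof. by rewrite /vnrm; congr nrm2; apply/funext => x; rewrite distrC. Qed.

End SeparableValued.

(** * Multiple integrals *)

Section BoundedLinear.
Context (R : realType) (B : completeNormedModType R) (P : probability (borel B) R).
Context (V : normedModType R) (D : set V) (A : V -> borel B -> R).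
Hypothesis blA : bounded_linear_L2 P D A.
Hypothesis D0 : D 0.
Hypothesis Dlin : forall a f g, D f -> D g -> D (a *: f + g).

Lemma bl_L2 f : D f -> L2 P (A f).
Proof. by case: blA => h _ _ Df; apply/L2P; exact: h. Qed.

Lemma bl_bound : exists2 C : R, 0 <= C & forall f, D f -> nrm2 P (A f) <= C * `|f|.
Proof.
have [_ _ [C hC]] := blA; exists `|C| => // f Df.
have := hC f Df; rewrite Lnorm2_nrm2 ?lee_fin; last exact: bl_L2.
by move=> /le_trans; apply; rewrite ler_wpM2r// ler_norm.
Qed.

Lemma bl_linear a f g : D f -> D g ->
  A (a *: f + g) = (fun x => a * A f x + A g x) %[ae P].
Proof. by case: blA => _ h _; exact: h. Qed.

Lemma bl_0 : A 0 = (fun=> 0) %[ae P].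
Proof.
have := bl_linear 1 D0 D0; apply: filterS => x /(_ Logic.I).
by rewrite scale1r addr0 mul1r => h _; lra.
Qed.

Lemma bl_scale a f : D f -> A (a *: f) = (fun x => a * A f x) %[ae P].
Proof.
move=> Df; apply: filterS2 (bl_linear a Df D0) bl_0
  => x /(_ Logic.I) h1 /(_ Logic.I) h2 _.
by rewrite -[a *: f]addr0 h1 h2 addr0.
Qed.

Lemma blB f g : D f -> D g -> A (f - g) = (fun x => A f x - A g x) %[ae P].
Proof.
move=> Df Dg; apply: filterS (bl_linear (-1) Dg Df) => x /(_ Logic.I) h _.
by rewrite addrC -scaleN1r h mulN1r addrC.
Qed.

Lemma D_sum I (r : seq I) (c : I -> R) (F : I -> V) : (forall i, D (F i)) ->
  D (\sum_(i <- r) c i *: F i).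
Proof.
move=> DF; elim: r => [|i r IH]; first by rewrite big_nil.
by rewrite big_cons; exact: Dlin.
Qed.

Lemma bl_sum I (r : seq I) (c : I -> R) (F : I -> V) : (forall i, D (F i)) ->
  A (\sum_(i <- r) c i *: F i) = (fun x => \sum_(i <- r) c i * A (F i) x) %[ae P].
Proof.
move=> DF; elim: r => [|i r IH].
  by apply: filterS bl_0 => x /(_ Logic.I) h _; rewrite !big_nil.
apply: filterS2 (bl_linear (c i) (DF i) (D_sum r c DF)) IH
  => x /(_ Logic.I) h1 /(_ Logic.I) h2 _.
by rewrite !big_cons h1 h2.
Qed.

Lemma bl_nrm2B f g : D f -> D g ->
  nrm2 P (fun x => A f x - A g x) = nrm2 P (A (f - g)).
Proof.
move=> Df Dg; have Dfg : D (f - g) by rewrite addrC -scaleN1r; exact: Dlin.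
have [m1 _] := bl_L2 Dfg; have [m2 _] := L2B (bl_L2 Df) (bl_L2 Dg).
by apply: nrm2_ae => //; apply: filterS (blB Df Dg) => x /(_ Logic.I) h _.
Qed.

End BoundedLinear.

Lemma mean_diff_le d (Om : measurableType d) (R : realType) (P : probability Om R)
  (X Y : Om -> R) : L1 P X -> L1 P Y ->
  `|mean P X - mean P Y| <= mean P (fun x => `|X x - Y x|).
Proof. by move=> X1 Y1; rewrite -meanB//; apply: norm_mean_le; exact: L1B. Qed.

Section Wiener.
Context (R : realType) (H : hilbertType R) (B : completeNormedModType R).
Context (j : {linear H -> B}) (P : probability (borel B) R).
Hypothesis aws : abstract_wiener_space j P.
Variable tld : H -> borel B -> R.
Hypothesis htld : wiener_map P j tld.
Let blt : bounded_linear_L2 P setT tld := htld.1.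
Let T0 : [set: H] 0. Proof. by []. Qed.
Lemma tld_L2 h : L2 P (tld h). Proof. exact: (bl_L2 blt). Qed.

(** Extends the characteristic function from the dual of B to all of H: the left side is continuous
    in h because f is Lipschitz and [tld] is bounded into L^2. *)
Lemma mean_lipschitz_tld (f : R -> R) (g : H -> R) :
  measurable_fun setT f -> (forall x, `|f x| <= 1) ->
  (forall a b, `|f b - f a| <= `|b - a|) -> continuous g ->
  (forall (l : {linear B -> R^o}) (h : H), continuous l -> represents j l h ->
    (\int[P]_x (f (l x : R))%:E = (g h)%:E)%E) ->
  forall h, mean P (fun x => f (tld h x)) = g h.
Proof.
move=> mf f1 fL cg fg; apply: (dense_continuous_ext (aws_dual_dense aws)) => //.
  have [C C0 hC] := bl_bound blt.
  have f1' (h : H) : L1 P (fun x => f (tld h x)).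
    apply: L1_le (L1_cst P 1) _ => //.
    by apply: (measurableT_comp mf); case: (tld_L2 h).
  move=> h; apply/cvgrPdist_le => e e0.
  have C1 : 0 < C + 1 by rewrite ltr_wpDl.
  near=> k; apply: le_trans (mean_diff_le (f1' h) (f1' k)) _.
  have L2hk := L2B (tld_L2 h) (tld_L2 k).
  apply: (@le_trans _ _ (mean P (fun x => `|tld h x - tld k x|))).
    apply: le_mean; [exact/L1_abs/L1B|exact/L1_abs/L2_L1|].
    by move=> x; exact: fL.
  apply: le_trans (mean_abs_le L2hk) _.
  rewrite (bl_nrm2B blt)//; apply: le_trans (hC _ _) _ => //.
  have : `|h - k| <= e / (C + 1).
    by near: k; apply: cvgr_dist_le; [exact: cvg_id|rewrite divr_gt0].
  rewrite ler_pdivlMr// => hk; apply: le_trans hk.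
  by have := normr_ge0 (h - k); nra.
move=> h [l [cl lh]]; rewrite /mean /Rintegral.
suff -> : (\int[P]_x (f (tld h x))%:E)%E = (g h)%:E by [].
rewrite -(fg l h cl lh); apply: ae_eq_integral => //.
- by apply/measurable_EFinP; apply: (measurableT_comp mf); case: (tld_L2 h).
- apply/measurable_EFinP; apply: (measurableT_comp mf).
  apply/borel_fun_measurable => U oU.
  apply: sub_sigma_algebra; rewrite /preimage.
  by apply: open_comp => // x _; exact: cl.
by apply: filterS (htld.2 l h cl lh) => x /(_ Logic.I) -> _.
Unshelve. all: by end_near. Qed.

Lemma mean_cos_tld h : mean P (fun x => cos (tld h x)) = expR (- (`|h| ^+ 2 / 2)).
Proof.
apply: (@mean_lipschitz_tld cos (fun h => expR (- (`|h| ^+ 2 / 2)))).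
- exact: measurable_cos.
- exact: cos_max.
- by move=> a b; exact: cos_lipschitz.
- move=> k; apply: (@continuous_comp _ _ _ (fun h : H => - (`|h| ^+ 2 / 2)) expR).
    apply: continuousN; apply: (@continuousM _ H (fun h : H => `|h| ^+ 2) (fun=> 2^-1)).
      by apply: (@continuousM _ H Num.norm Num.norm); exact: norm_continuous.
    exact: cst_continuous.
  exact: continuous_expR.
by move=> l h' cl lh; exact: (aws_cos aws).
Qed.

Lemma mean_sin_tld h : mean P (fun x => sin (tld h x)) = 0.
Proof.
apply: (@mean_lipschitz_tld sin (fun=> 0)).
- exact: measurable_sin.
- exact: sin_max.
- by move=> a b; exact: sin_lipschitz.
- by move=> k; exact: cst_continuous.
by move=> l h' cl lh; exact: (aws_sin aws).
Qed.

Variable T : tensor_powers H.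
Variable I : forall n, T n -> borel B -> R.
Hypothesis hI : multiple_integral P tld I.

Let blI n : bounded_linear_L2 P (symmetric T n) (@I n).
Proof. by case: hI. Qed.

Lemma I_L2 n (f : T n) : symmetric T n f -> L2 P (I f).
Proof. by move=> sf; apply: (bl_L2 (blI n)). Qed.

Lemma I_bound n : exists2 C : R, 0 <= C &
  forall f : T n, symmetric T n f -> nrm2 P (I f) <= C * `|f|.
Proof. exact: (bl_bound (blI n)). Qed.

Lemma I_nrm2B n (f g : T n) : symmetric T n f -> symmetric T n g ->
  nrm2 P (fun x => I f x - I g x) = nrm2 P (I (f - g)).
Proof.
move=> sf sg; apply: (bl_nrm2B (blI n)) => //.
by move=> a u v; exact: symmetric_linear.
Qed.

Lemma I_B n (f g : T n) : symmetric T n f -> symmetric T n g ->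
  I (f - g) = (fun x => I f x - I g x) %[ae P].
Proof.
by move=> sf sg; apply: (blB (blI n)).
Qed.

Lemma I_sum n J (r : seq J) (c : J -> R) (F : J -> T n) :
  (forall i, symmetric T n (F i)) ->
  I (\sum_(i <- r) c i *: F i) = (fun x => \sum_(i <- r) c i * I (F i) x) %[ae P].
Proof.
move=> sF; apply: (bl_sum (blI n)) => //; first exact: symmetric0.
by move=> a u v; exact: symmetric_linear.
Qed.

Lemma I_tspan n s : I (tspan T n s) =
  (fun x => \sum_(c <- s) c.1 * I (tpower T n c.2) x) %[ae P].
Proof. by apply: I_sum => c; exact: tpower_symmetric. Qed.

Definition herm h n (x : borel B) : R := (hpoly (`|h| ^+ 2) n).[tld h x].

Lemma hpoly0_0 n : (hpoly (0 : R) n).[0] = (n == 0)%N%:R.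
Proof. by case: n => [|n]; rewrite ?hpolyS /= ?hornerC// mul0r mulr0 mul0r subrr. Qed.

Lemma tpower0 n : tpower T n.+1 0 = 0.
Proof.
apply/eqP; rewrite -normr_eq0 norm_pure; apply/eqP.
by rewrite big_ord_recl normr0 mul0r.
Qed.

(** Includes h = 0, where the Hermite clause of [multiple_integral] is silent: degree 0 falls under
    the clause on constants, and in positive degree the power is the zero tensor. *)
Lemma I_tpower n h : I (tpower T n h) = herm h n %[ae P].
Proof.
have [->|h0] := eqVneq h 0; last first.
  have [_ _ /(_ n h h0)] := hI; apply: filterS => x /(_ Logic.I) -> _.
  by rewrite hermite_hpoly hpoly_scale// normr_eq0.
have [_ I0 _] := hI.
have t0 := bl_0 blt T0.
case: n => [|n].
  apply: filterS (I0 1 (fun=> 0)) => x /(_ Logic.I) E _.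
  by rewrite -[tpower T 0 0]scale1r E /herm /= hornerC.
apply: filterS2 t0 (bl_0 (blI n.+1) (@symmetric0 _ _ T n.+1)) => x.
move=> /(_ Logic.I) h1 /(_ Logic.I) h2 _.
by rewrite tpower0 h2 /herm h1 normr0 expr0n hpoly0_0.
Qed.

Lemma horner_measurable (p : {poly R}) (X : borel B -> R) :
  measurable_fun setT X -> measurable_fun setT (fun x => p.[X x]).
Proof.
move=> mX; under eq_fun do rewrite horner_coef.
apply: measurable_sum => i.
by apply: measurable_funM; [exact: measurable_cst|exact: measurable_funX].
Qed.

Lemma herm_L2 h n : L2 P (herm h n).
Proof.
have [mt _] := tld_L2 h.
apply: L2_ae (I_L2 (@tpower_symmetric _ _ T n h)) _.
  exact: horner_measurable.
by apply: filterS (I_tpower n h) => x /(_ Logic.I).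
Qed.

(** [wiener_map] puts [tld h] in L^2 only. Higher moments come from [I]: Hermite polynomials of
    [tld h] are versions of elements of L^2, and the three-term recurrence exchanges a factor
    [tld h] for a shift of the degree. Hence the induction keeps a factor of arbitrary degree k. *)
Lemma tld_moments h n : L1 P (fun x => tld h x ^+ n).
Proof.
suff : forall k, L1 P (fun x => tld h x ^+ n * herm h k x).
  by move=> /(_ 0%N); under eq_fun do rewrite /herm /= hornerC mulr1.
elim: n => [|n IH] k.
  by under eq_fun do rewrite expr0 mul1r; exact/L2_L1/herm_L2.
rewrite (_ : (fun _ => _) = fun x => tld h x ^+ n * herm h k.+1 x +
  k%:R * `|h| ^+ 2 * (tld h x ^+ n * herm h k.-1 x)).
  by apply: L1D; [exact: IH|apply: L1Z; exact: IH].
by apply/funext => x; rewrite /herm hpolyS exprS; ring.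
Qed.

Lemma mean_herm h n : mean P (herm h n.+1) = 0.
Proof.
(* The characteristic function of [tld h] at t is that of [tld (t *: h)] at 1, by almost sure
   linearity. *)
have tZ (t : R) (f : R -> R) : measurable_fun setT f ->
    mean P (fun x => f (t * tld h x)) = mean P (fun x => f (tld (t *: h) x)) :> R.
  move=> mf; have [mt _] := tld_L2 h; have [mt' _] := tld_L2 (t *: h).
  apply: mean_ae.
  - apply: (measurableT_comp mf).
    by apply: measurable_funM => //; exact: measurable_cst.
  - exact: (measurableT_comp mf).
  by apply: filterS (bl_scale blt T0 t (Logic.I : [set: H] h)) => x /(_ Logic.I) ->.
apply: (@mean_hpoly _ _ _ P (tld h) (`|h| ^+ 2)).
- exact: tld_moments.
- move=> t; rewrite tZ; last exact: measurable_cos.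
  by rewrite mean_cos_tld normrZ exprMn real_normK ?num_real.
- move=> t; rewrite tZ; last exact: measurable_sin.
  exact: mean_sin_tld.
Qed.

Lemma I_symprod_tpower n m h k :
  I (symprod (tpower T n h) (tpower T m k)) =
  (fun x => wick_seq '<[h, k]> (herm h ^~ x) (herm k ^~ x) n m) %[ae P].
Proof.
rewrite symprod_tpower; set N := (n + m)%N.
(* Restricting s to natural numbers i makes one null set serve for all of them. *)
have h1 : \forall x \ae P, forall i : nat,
    tld (i%:R *: h + k) x = i%:R * tld h x + tld k x.
  by apply: ae_foralln => i; apply: filterS (bl_linear blt i%:R (Logic.I : [set: H] h) (Logic.I : [set: H] k))
    => x /(_ Logic.I).
have h2 : \forall x \ae P, forall i : nat,
    I (tpower T N (i%:R *: h + k)) x = herm (i%:R *: h + k) N x.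
  by apply: ae_foralln => i; apply: filterS (I_tpower N (i%:R *: h + k))
    => x /(_ Logic.I).
have h3 : \forall x \ae P, forall i : nat, I (tpower T N (i%:R *: h + k)) x =
    \sum_(l < N.+1) ('C(N, l)%:R * i%:R ^+ l) * I (mixed T N l h k) x.
  apply: ae_foralln => i; rewrite tpower_binomial.
  have sm (l : 'I_N.+1) : symmetric T N (mixed T N l h k)
    by exact: symmetrize_symmetric.
  by apply: filterS (I_sum (index_enum 'I_N.+1) (fun l : 'I_N.+1 => 'C(N, l)%:R * i%:R ^+ l) sm)
    => x /(_ Logic.I).
apply: filterS3 h1 h2 h3 => x h1 h2 h3 _.
pose w l := wick_seq '<[h, k]> (herm h ^~ x) (herm k ^~ x) l (N - l)%N.
(* The difference, as a polynomial in s, between the two expansions of [I] at the N-th power of s h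
   + k, for a fixed x. *)
pose p : {poly R} := \poly_(l < N.+1) ('C(N, l)%:R * (I (mixed T N l h k) x - w l)).
have p0 (i : nat) : p.[i%:R] = 0.
  rewrite /p horner_poly.
  under eq_bigr => l _ do rewrite mulrBr mulrBl mulrAC.
  rewrite sumrB -h3 h2 /herm.
  have -> : tld (i%:R *: h + k) x = i%:R * tld h x + tld k x by exact: h1.
  have -> : `|i%:R *: h + k| ^+ 2 =
      i%:R ^+ 2 * `|h| ^+ 2 + 2 * i%:R * '<[h, k]> + `|k| ^+ 2.
    by rewrite -!hdot_norm dotDl !dotDr !dotZl !dotZr (dotC k h); ring.
  rewrite (@wick_binomial _ (tld h x) (tld k x) (`|h| ^+ 2) (`|k| ^+ 2)
    '<[h, k]> i%:R (herm h ^~ x) (herm k ^~ x)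
    (fun N => (hpoly (i%:R ^+ 2 * `|h| ^+ 2 + 2 * i%:R * '<[h, k]> + `|k| ^+ 2) N).[
       i%:R * tld h x + tld k x])).
  - by rewrite -sumrB big1// => l _; rewrite /w; ring.
  - by rewrite /herm /= hornerC.
  - by move=> l; rewrite /herm hpolyS.
  - by rewrite /herm /= hornerC.
  - by move=> l; rewrite /herm hpolyS.
  - by rewrite /= hornerC.
  - by move=> l; rewrite hpolyS.
have {}p0 : p = 0.
  apply/eqP; apply: contraT => pn0.
  pose rs := [seq i%:R : R | i <- iota 0 N.+1].
  have : (size rs < size p)%N.
    apply: max_poly_roots => //.
      by apply/allP => _ /mapP[i _ ->]; apply/rootP; exact: p0.
    rewrite map_inj_uniq ?iota_uniq// => a b /eqP.
    by rewrite eqr_nat => /eqP.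
  by rewrite size_map size_iota ltnNge size_poly.
(* The coefficient of degree n is the claim multiplied by the nonzero 'C(n + m, n). *)
have := congr1 (fun q : {poly R} => q`_n) p0.
rewrite coef_poly ltnS leq_addr coef0 => /eqP.
rewrite mulf_eq0 pnatr_eq0 -leqn0 leqNgt bin_gt0 leq_addr /= subr_eq0 => /eqP ->.
by rewrite /w addKn.
Qed.

End Wiener.

(** * Isometry and orthogonality of the multiple integrals *)

Section Isometry.
Context (R : realType).

(** Concludes the density arguments. With e <= 1 an approximation of f has norm at most |f| + 1, so
    that K can be fixed before e. *)
Lemma le0_small (x K : R) : (forall e, 0 < e -> e <= 1 -> x <= K * e) -> x <= 0.
Proof.
move=> h; rewrite leNgt; apply/negP => x0.
have K0 : 0 < K by have := h 1 ltr01 (lexx _); lra.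
pose e := Num.min 1 (x / (2 * K)).
have e0 : 0 < e by rewrite lt_min ltr01 divr_gt0// mulr_gt0.
have e1 : e <= 1 by rewrite ge_min lexx.
have e2 : e <= x / (2 * K) by rewrite ge_min lexx orbT.
have := h e e0 e1; have : K * e <= K * (x / (2 * K)) by rewrite ler_wpM2l// ltW.
have -> : K * (x / (2 * K)) = x / 2 by field; rewrite gt_eqF.
lra.
Qed.

Lemma nrm2_le_sub d (Om : measurableType d) (P : probability Om R) (X Y : Om -> R) :
  L2 P X -> L2 P Y -> nrm2 P X <= nrm2 P (fun x => X x - Y x) + nrm2 P Y.
Proof.
move=> X2 Y2; apply: le_trans (nrm2D (L2B X2 Y2) Y2).
by rewrite (_ : (fun _ => _ - _ + _) = X)//; apply/funext => x; rewrite subrK.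
Qed.

Lemma nrm2_distC d (Om : measurableType d) (P : probability Om R) (X Y : Om -> R) :
  nrm2 P (fun x => X x - Y x) = nrm2 P (fun x => Y x - X x).
Proof. by congr (Num.sqrt (mean P _)); apply/funext => x; rewrite -sqrrN opprB. Qed.

Lemma mean_mul_diff d (Om : measurableType d) (P : probability Om R)
  (X X' Y Y' : Om -> R) : L2 P X -> L2 P X' -> L2 P Y -> L2 P Y' ->
  `|mean P (fun x => X x * Y x) - mean P (fun x => X' x * Y' x)| <=
  nrm2 P (fun x => X x - X' x) * nrm2 P Y + nrm2 P X' * nrm2 P (fun x => Y x - Y' x).
Proof.
move=> X2 X2' Y2 Y2'; apply: le_trans (mean_diff_le (L2_mul X2 Y2) (L2_mul X2' Y2')) _.
apply: le_trans (lerD (cauchy_schwarz (L2B X2 X2') Y2)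
  (cauchy_schwarz X2' (L2B Y2 Y2'))).
have l1 := L1_abs (L2_mul (L2B X2 X2') Y2).
have l2 := L1_abs (L2_mul X2' (L2B Y2 Y2')).
rewrite -meanD//; apply: le_mean.
- by apply: L1_abs; apply: L1B; exact: L2_mul.
- exact: L1D.
move=> x; rewrite (_ : _ - _ = (X x - X' x) * Y x + X' x * (Y x - Y' x)); last by ring.
exact: ler_normD.
Qed.

Context (H : hilbertType R) (B : completeNormedModType R).
Context (j : {linear H -> B}) (P : probability (borel B) R).
Hypothesis aws : abstract_wiener_space j P.
Variable tld : H -> borel B -> R.
Hypothesis htld : wiener_map P j tld.
Variable T : tensor_powers H.
Variable I : forall n, T n -> borel B -> R.
Hypothesis hI : multiple_integral P tld I.
Local Notation hm := (@herm R H B tld).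

Let hermL2 h n : L2 P (hm h n). Proof. exact: (herm_L2 htld hI h n). Qed.
Let IL2 n (f : T n) : symmetric T n f -> L2 P (I f).
Proof. by move=> sf; apply: (I_L2 hI). Qed.
Let tsS n s : symmetric T n (tspan T n s). Proof. exact: tspan_symmetric. Qed.

Lemma I_tspan_herm n s :
  I (tspan T n s) = (fun x => \sum_(c <- s) c.1 * hm c.2 n x) %[ae P].
Proof.
have h : \forall x \ae P, forall k : nat,
    I (tpower T n (nth 0 [seq c.2 | c <- s] k)) x = hm (nth 0 [seq c.2 | c <- s] k) n x.
  apply: ae_foralln => k.
  by apply: filterS (I_tpower htld hI n (nth 0 [seq c.2 | c <- s] k)) => x /(_ Logic.I).
apply: filterS2 h (I_tspan hI n s) => x h /(_ Logic.I) -> _.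
rewrite !(big_nth (0, 0)) !big_mkord; apply: eq_bigr => k _.
by have := h k; rewrite (nth_map (0, 0))// => ->.
Qed.

Lemma mean_I n (f : T n.+1) : symmetric T n.+1 f -> mean P (I f) = 0.
Proof.
move=> sf; have [C C0 hC] := I_bound hI n.+1.
apply/eqP; rewrite -normr_le0; apply: (@le0_small _ C) => e e0 _.
have [s fs] := tspan_dense sf e0; set g := tspan T n.+1 s in fs.
have sg : symmetric T n.+1 g by exact: tsS.
have g0 : mean P (I g) = 0.
  have mg : L1 P (fun x => \sum_(c <- s) c.1 * hm c.2 n.+1 x).
    by apply: L1_sum => c _; apply/L1Z/L2_L1.
  rewrite (mean_ae _ _ (I_tspan_herm n.+1 s)); last exact: (L1_measurable mg).
    rewrite mean_sum => [|c _]; last exact/L1Z/L2_L1.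
    by rewrite big1// => c _;
      rewrite meanZ ?(mean_herm aws htld hI) ?mulr0//; exact: L2_L1.
  by case: (IL2 sg).
rewrite -[mean P _]subr0 -g0.
apply: le_trans (mean_diff_le (L2_L1 (IL2 sf)) (L2_L1 (IL2 sg))) _.
apply: le_trans (mean_abs_le (L2B (IL2 sf) (IL2 sg))) _.
rewrite (I_nrm2B hI)//; apply: le_trans (hC _ (symmetricB sf sg)) _.
by rewrite ler_wpM2l// ltW.
Qed.

(** The binomial expansion of (1 - 1)^(n+1) with its first term moved to the other side; it sums the
    coefficients in [mean_herm2]. *)
Lemma sum_alternating_bin n : \sum_(p < n.+1) (-1) ^+ p * 'C(n.+1, p.+1)%:R = 1 :> R.
Proof.
have := exprDn (1 : R) (-1) n.+1; rewrite subrr expr0n /= big_ord_recl /= bin0.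
rewrite expr1n mul1r expr0 => /esym/eqP; rewrite addr_eq0 => /eqP E.
rewrite -[RHS]opprK -[1 in RHS]mulr1n [1 *+ 1]
  (_ : _ = - \sum_(p < n.+1) (-1) ^+ p.+1 * 'C(n.+1, p.+1)%:R).
  rewrite opprK -sumrN; apply: eq_bigr => p _; rewrite exprS; ring.
rewrite -[LHS]mulr1n E; congr (- _); apply: eq_bigr => p _.
by rewrite expr1n mul1r mulr_natr.
Qed.

(** Strong induction on n. A Wick product of positive degree has mean zero; in its expansion the
    term p = 0 is the wanted moment and all others have lower degree. *)
Lemma mean_herm2 n m h k : mean P (fun x => hm h n x * hm k m x) =
  (n == m)%:R * (n`!%:R * '<[h, k]> ^+ n).
Proof.
elim/ltn_ind: n m => -[_ m|n IH m].
  have -> : (fun x => hm h 0 x * hm k m x) = hm k m.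
    by apply/funext => x; rewrite /herm /= hornerC mul1r.
  case: m => [|m]; last by rewrite (mean_herm aws htld hI) mul0r.
  rewrite (_ : hm k 0 = fun=> 1) ?mean_cst ?mulr1//.
  by apply/funext => x; rewrite /herm /= hornerC.
set c := '<[h, k]>.
pose M a b := mean P (fun x => hm h a x * hm k b x).
have HH a b := L2_mul (hermL2 h a) (hermL2 k b).
have sumM : \sum_(p < n.+2) (- c) ^+ p * (p`! * 'C(n.+1, p) * 'C(m, p))%:R *
    M (n.+1 - p)%N (m - p)%N = 0.
  have s0 := symmetrize_symmetric (tprod (tpower T n.+1 h) (tpower T m k)).
  transitivity (mean P (I (symprod (tpower T n.+1 h) (tpower T m k)))); last first.
    exact: (@mean_I (n + m) _ s0).
  have mw : L1 P (fun x => wick_seq c (hm h ^~ x) (hm k ^~ x) n.+1 m).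
    by apply: L1_sum => p _; apply: L1Z; exact: HH.
  rewrite (mean_ae _ (L1_measurable mw) (I_symprod_tpower htld hI n.+1 m h k));
    last first.
    by case: (IL2 s0).
  rewrite mean_sum => [|p _]; last by apply: L1Z; exact: HH.
  by apply: eq_bigr => p _; rewrite [RHS]meanZ.
move: sumM; rewrite big_ord_recl /= expr0 fact0 !bin0 !subn0 !mul1r => /eqP.
rewrite addr_eq0 => /eqP E; rewrite -/(M n.+1 m) E.
(* Lowering two different degrees by the same p keeps them different. For equal degrees, the term
   moved to the right is (n+1)! c^(n+1) times (-1)^p 'C(n.+1, p.+1). *)
have [nm|nm] := eqVneq n.+1 m; last first.
  rewrite mul0r big1 ?oppr0// => p _; rewrite /bump /= add1n.
  have [mp|pm] := ltnP m p.+1; first by rewrite (bin_small mp) muln0 mulr0 mul0r.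
  rewrite /M IH; last by lia.
  rewrite (_ : (_ == _) = false) ?mul0r ?mulr0//; apply/negbTE.
  by apply: contra nm => /eqP nm; apply/eqP; have := ltn_ord p; lia.
rewrite -nm mul1r -sumrN -[RHS]mulr1 -[X in _ * X](sum_alternating_bin n) mulr_sumr.
apply: eq_bigr => p _; rewrite /bump /= add1n /M IH; last by lia.
rewrite eqxx mul1r -(@bin_fact n.+1 p.+1); last by rewrite ltn_ord.
have -> : c ^+ n.+1 = c ^+ p.+1 * c ^+ (n.+1 - p.+1).
  by rewrite -exprD subnKC// ltn_ord.
rewrite !natrM -[- c]mulN1r exprMn exprS; ring.
Qed.

Lemma mean_I_tspan n m s t :
  mean P (fun x => I (tspan T n s) x * I (tspan T m t) x) =
  (n == m)%:R * (n`!%:R * \sum_(c <- s) \sum_(d <- t) c.1 * d.1 * '<[c.2, d.2]> ^+ n).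
Proof.
pose F c d x := c.1 * d.1 * (hm c.2 n x * hm d.2 m x).
have F1 c d : L1 P (F c d) by apply: L1Z; exact: L2_mul.
have FF1 c : L1 P (fun x => \sum_(d <- t) F c d x) by apply: L1_sum => d _.
rewrite (@mean_ae _ _ _ _ _ (fun x => \sum_(c <- s) \sum_(d <- t) F c d x)).
- rewrite mean_sum// mulrA mulr_sumr; apply: eq_bigr => c _.
  rewrite mean_sum// mulr_sumr; apply: eq_bigr => d _.
  by rewrite meanZ ?mean_herm2; [ring|exact: L2_mul].
- apply: L1_measurable; apply: L2_mul; exact: IL2.
- by apply: L1_measurable; exact: L1_sum.
apply: filterS2 (I_tspan_herm n s) (I_tspan_herm m t)
  => x /(_ Logic.I) -> /(_ Logic.I) -> _.
rewrite mulr_suml; apply: eq_bigr => c _; rewrite mulr_sumr.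
by apply: eq_bigr => d _; rewrite /F; ring.
Qed.

Lemma dot_tspan n s t : '<[tspan T n s, tspan T n t]> =
  \sum_(c <- s) \sum_(d <- t) c.1 * d.1 * '<[c.2, d.2]> ^+ n.
Proof.
rewrite /tspan dot_suml; apply: eq_bigr => c _; rewrite dot_sumr.
by apply: eq_bigr => d _; rewrite dotZl dotZr dot_tpower mulrA.
Qed.

(** Exact on combinations of powers, whose second moments are known; the crude bound C |f - g|
    suffices for the passage to f. *)
Lemma I_norm n (f : T n) : symmetric T n f -> nrm2 P (I f) = Num.sqrt n`!%:R * `|f|.
Proof.
move=> sf; have [C C0 hC] := I_bound hI n.
apply/eqP; rewrite -subr_eq0 -normr_le0.
apply: (@le0_small _ (C + Num.sqrt n`!%:R)) => e e0 _.
have [s fs] := tspan_dense sf e0; set g := tspan T n s in fs.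
have sg : symmetric T n g by exact: tsS.
have Eg : nrm2 P (I g) = Num.sqrt n`!%:R * `|g|.
  rewrite /nrm2; under eq_fun do rewrite expr2.
  rewrite mean_I_tspan eqxx mul1r -dot_tspan sqrtrM ?ler0n//.
  by rewrite hdot_norm sqrtr_sqr normr_id.
have h1 := nrm2_le_sub (IL2 sf) (IL2 sg).
have h2 := nrm2_le_sub (IL2 sg) (IL2 sf).
rewrite nrm2_distC in h2; rewrite (I_nrm2B hI sf sg) in h1 h2.
have h3 := hC _ (symmetricB sf sg).
have h4 : C * `|f - g| <= C * e by rewrite ler_wpM2l// ltW.
have h5 : Num.sqrt n`!%:R * `| `|f| - `|g| | <= Num.sqrt n`!%:R * e.
  by rewrite ler_wpM2l ?sqrtr_ge0// (le_trans (ler_dist_dist _ _))// ltW.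
rewrite -[Num.sqrt _ in X in X <= _]ger0_norm ?sqrtr_ge0// -normrM in h5.
move: h5; rewrite mulrBr -Eg ler_norml => /andP[h5 h6].
rewrite ler_norml; apply/andP; split; rewrite mulrDl; lra.
Qed.

Lemma I_ortho n m (f : T n) (g : T m) : n != m ->
  symmetric T n f -> symmetric T m g -> mean P (fun x => I f x * I g x) = 0.
Proof.
move=> nm sf sg; apply/eqP; rewrite -normr_le0.
pose a := Num.sqrt (n`!%:R : R); pose b := Num.sqrt (m`!%:R : R).
have a0 : 0 <= a by exact: sqrtr_ge0.
have b0 : 0 <= b by exact: sqrtr_ge0.
apply: (@le0_small _ (a * b * (`|g| + `|f| + 1))) => e e0 e1.
have [s fs] := tspan_dense sf e0; have [t gt] := tspan_dense sg e0.
set f' := tspan T n s in fs; set g' := tspan T m t in gt.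
have sf' : symmetric T n f' by exact: tsS.
have sg' : symmetric T m g' by exact: tsS.
have z : mean P (fun x => I f' x * I g' x) = 0.
  by rewrite mean_I_tspan (negbTE nm) mul0r.
rewrite -[mean P _]subr0 -z.
apply: le_trans (mean_mul_diff (IL2 sf) (IL2 sf') (IL2 sg) (IL2 sg')) _.
rewrite !(I_nrm2B hI)// !I_norm//; try exact: symmetricB.
rewrite -/a -/b.
have hf' : `|f'| <= `|f| + 1.
  by rewrite -[f'](subKr f) (le_trans (ler_normB _ _))// lerD2l (le_trans (ltW fs)).
have h1 : a * `|f - f'| * (b * `|g|) <= a * b * (e * `|g|).
  rewrite mulrACA; apply: ler_wpM2l; first exact: mulr_ge0.
  by rewrite ler_wpM2r// ltW.
have h2 : a * `|f'| * (b * `|g - g'|) <= a * b * ((`|f| + 1) * e).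
  rewrite mulrACA; apply: ler_wpM2l; first exact: mulr_ge0.
  by apply: ler_pM => //; exact: ltW.
apply: le_trans (lerD h1 h2) _.
by rewrite le_eqVlt; apply/orP; left; apply/eqP; ring.
Qed.

End Isometry.

(** * Malliavin derivatives of multiple integrals *)

Section LimitTheorems.
Context d (Om : measurableType d) (R : realType) (P : probability Om R).

(** The last hypothesis says, with explicit errors, that Y is almost surely at most the lower limit
    of the X i. The integrability of Y is part of the conclusion. *)
Lemma fatou_mean (X : nat -> Om -> R) (Y : Om -> R) (b : R) :
  (forall i, L1 P (X i)) -> (forall i x, 0 <= X i x) ->
  (forall i, mean P (X i) <= b) ->
  measurable_fun setT Y -> (forall x, 0 <= Y x) ->
  (\forall x \ae P, forall e : R, 0 < e ->
     exists N, forall i, (N <= i)%N -> Y x <= X i x + e) ->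
  L1 P Y /\ mean P Y <= b.
Proof.
move=> X1 X0 Xb mY Y0 YX.
pose u i x := (X i x)%:E.
have mu i : measurable_fun setT (u i) by exact/measurable_EFinP/L1_measurable.
have u0 i x : (0 <= u i x)%E by rewrite lee_fin.
have ml : measurable_fun setT (fun x => limn_einf (u^~ x)).
  have -> : (fun x => limn_einf (u^~ x)) =
      (fun x => - limn_esup (fun i => - u i x))%E.
    by apply/funext => x; have := limn_esupN (u^~ x); rewrite /comp => ->; rewrite oppeK.
  apply: measurableT_comp => //.
  apply: (@measurable_fun_limn_esup _ _ _ _ (fun i x => - u i x)%E) => i.
  exact: measurableT_comp.
have einf_le v i : (einfs v i <= limn_einf v :> \bar R)%E.
  rewrite limn_einf_lim (cvg_lim _ (@cvg_einfs_sup _ v))//.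
  by apply: ereal_sup_ubound; exists i.
have YL : (\int[P]_x (Y x)%:E <= b%:E)%E.
  apply: (@le_trans _ _ (\int[P]_x limn_einf (u^~ x))%E).
    apply: ae_ge0_le_integral => //.
    - by move=> x _; rewrite lee_fin.
    - exact/measurable_EFinP.
    - move=> x _; apply: le_trans (einf_le (u^~ x) 0%N).
      by apply: le_ereal_inf_tmp => _ [n _ <-].
    apply: filterS YX => x h _; apply/lee_addgt0Pr => e e0.
    have [N hN] := h e e0; rewrite -leeBlDr//.
    apply: le_trans (einf_le (u^~ x) N); apply: le_ereal_inf_tmp => _ [n /= Nn <-].
    by rewrite -EFinB lee_fin lerBlDr; exact: hN.
  apply: le_trans (@fatou _ _ _ P setT measurableT u mu (fun n x _ => u0 n x)) _.
  rewrite limn_einf_lim; apply: lime_le; first exact: is_cvg_einfs.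
  apply: nearW => n; apply: (@le_trans _ _ (\int[P]_x u n x)%E).
    by apply: ereal_inf_lbound; exists n => /=.
  by rewrite -EFin_mean ?lee_fin.
have Y1 : L1 P Y.
  apply/integrableP; split; first exact/measurable_EFinP.
  apply: le_lt_trans (ltry b); apply: le_trans YL.
  rewrite le_eqVlt; apply/orP; left; apply/eqP; apply: eq_integral => x _ /=.
  by rewrite ger0_norm.
by split=> //; rewrite -lee_fin EFin_mean.
Qed.

Lemma summable_mean_ae (Z : nat -> Om -> R) (M : R) :
  (forall i, L1 P (Z i)) -> (forall i x, 0 <= Z i x) ->
  (forall n, \sum_(i < n) mean P (Z i) <= M) ->
  \forall x \ae P, cvgn (series (Z ^~ x)).
Proof.
move=> Z1 Z0 ZM.
pose z i x := (Z i x)%:E.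
have mz i : measurable_fun setT (z i) by exact/measurable_EFinP/L1_measurable.
have z0 i x : setT x -> (0 <= z i x)%E by rewrite lee_fin.
have mS : measurable_fun setT (fun x => \sum_(0 <= i <oo) z i x)%E.
  by apply: ge0_emeasurable_sum => // i x _ _; exact: z0.
have S0 x : (0 <= \sum_(0 <= i <oo) z i x)%E
  by apply: nneseries_ge0 => i _ _; exact: z0.
have iS : P.-integrable setT (fun x => \sum_(0 <= i <oo) z i x)%E.
  apply/integrableP; split=> //.
  under eq_integral do rewrite gee0_abs//.
  rewrite integral_nneseries//.
  apply: le_lt_trans (ltry M); apply: lime_le.
    by apply: is_cvg_nneseries => i _ _; apply: integral_ge0 => x _; exact: z0.
  apply: nearW => n; rewrite big_mkord.
  under eq_bigr => i _ do rewrite -EFin_mean//.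
  by rewrite sumEFin lee_fin.
apply: filterS (integrable_ae measurableT iS) => x /(_ Logic.I) fS.
apply: nondecreasing_is_cvgn.
  by apply: nondecreasing_series => i _ _; exact: Z0.
exists (fine (\sum_(0 <= i <oo) z i x)%E) => _ [n _ <-].
rewrite -lee_fin fineK// /series /= -sumEFin.
by apply: nneseries_lim_ge => i _ _; exact: z0.
Qed.

End LimitTheorems.

(** With e k close to w, |w|^2 is nearly <w, e k>, hence nearly <w_i, e k>, which is at most
    (|w_i|^2 + |e k|^2) / 2. *)
Lemma weak_lower_semicontinuity (R : realType) (V : hilbertType R) (e : nat -> V)
  (w_ : nat -> V) (w : V) :
  (forall x (r : R), 0 < r -> exists n, `|x - e n| < r) ->
  (forall k, '<[w_ i, e k]> @[i --> \oo] --> '<[w, e k]>) ->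
  forall eps : R, 0 < eps -> exists N, forall i, (N <= i)%N ->
    `|w| ^+ 2 <= `|w_ i| ^+ 2 + eps.
Proof.
(* The errors add up to 4 |w| del + 2 del + del^2, at most (4 |w| + 3) del since del <= 1. *)
move=> ed wk eps eps0; pose del := Num.min 1 (eps / (4 * `|w| + 3)).
have c0 : 0 < 4 * `|w| + 3 by have := normr_ge0 w; lra.
have d0 : 0 < del by rewrite lt_min ltr01 divr_gt0.
have d1 : del <= 1 by rewrite ge_min lexx.
have d2 : del * (4 * `|w| + 3) <= eps by rewrite -ler_pdivlMr// ge_min lexx orbT.
have [k wek] := ed w del d0.
move/cvgrPdist_lt : (wk k) => /(_ del d0) [N _ hN].
exists N => i Ni; have {}hN := hN i Ni.
have hN' : '<[w, e k]> <= '<[w_ i, e k]> + del.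
  by rewrite -lerBlDl (le_trans (ler_norm _))// ltW.
have h1 : `|w| ^+ 2 = '<[w, e k]> + '<[w, w - e k]>.
  by rewrite -hdot_norm dotBr; ring.
have h2 := le_trans (ler_norm _) (dot_le w (w - e k)).
have h3 := le_trans (ler_norm _) (dot_le (w_ i) (e k)).
have h4 : `|e k| <= `|w| + del.
  rewrite -[e k](subKr w) (le_trans (ler_normB _ _))// lerD2l ltW//.
have h5 : `|w| * `|w - e k| <= `|w| * del by rewrite ler_wpM2l// ltW.
have h6 : `|w_ i| * `|e k| <= (`|w_ i| ^+ 2 + `|e k| ^+ 2) / 2.
  by have := sqr_ge0 (`|w_ i| - `|e k|); nra.
have h7 : `|e k| ^+ 2 <= (`|w| + del) ^+ 2.
  by rewrite ler_sqr ?nnegrE// addr_ge0// ltW.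
have h8 : del ^+ 2 <= del by rewrite expr2 ler_piMl// ltW.
nra.
Qed.

Lemma mean_dot_diff d (Om : measurableType d) (R : realType) (P : probability Om R)
  (V : hilbertType R) (sepV : separable_space V) (Y Y' Z Z' : Om -> V) :
  VL2 P Y -> VL2 P Y' -> VL2 P Z -> VL2 P Z' ->
  mean P (fun x => `|'<[Y x, Z x]> - '<[Y' x, Z' x]>|) <=
  vnrm P (fun x => Y x - Y' x) * vnrm P Z + vnrm P Y' * vnrm P (fun x => Z x - Z' x).
Proof.
move=> Y2 Y2' Z2 Z2'; have YY := VL2B sepV Y2 Y2'; have ZZ := VL2B sepV Z2 Z2'.
apply: le_trans (lerD (mean_dot_le sepV YY Z2) (mean_dot_le sepV Y2' ZZ)).
have l1 := L1_abs (VL2_dot sepV YY Z2).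
have l2 := L1_abs (VL2_dot sepV Y2' ZZ).
rewrite -meanD//; apply: le_mean.
- by apply: L1_abs; apply: L1B; exact: VL2_dot.
- exact: L1D.
move=> x; apply: le_trans (ler_normD _ _); rewrite dotBl dotBr.
have -> : '<[Y x, Z x]> - '<[Y' x, Z x]> + ('<[Y' x, Z x]> - '<[Y' x, Z' x]>) =
    '<[Y x, Z x]> - '<[Y' x, Z' x]> by ring.
exact: lexx.
Qed.

(** * Derivatives of multiple integrals and the Wick product of two chaoses *)

Section Derivatives.
Context (R : realType) (H : hilbertType R) (B : completeNormedModType R).
Context (j : {linear H -> B}) (P : probability (borel B) R).
Hypothesis aws : abstract_wiener_space j P.
Variable tld : H -> borel B -> R.
Hypothesis htld : wiener_map P j tld.
Variable T : tensor_powers H.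
Variable I : forall n, T n -> borel B -> R.
Hypothesis hI : multiple_integral P tld I.

Let sepT n : separable_space (T n).
Proof. exact: (tensor_separable T n (aws_separable aws)). Qed.
Let IL2 n (f : T n) : symmetric T n f -> L2 P (I f).
Proof. by move=> sf; apply: (I_L2 hI). Qed.
Let tpS n h : symmetric T n (tpower T n h). Proof. exact: tpower_symmetric. Qed.
Let tsS n s : symmetric T n (tspan T n s). Proof. exact: tspan_symmetric. Qed.

Lemma L2_sym_VL2 p (X : borel B -> T p) : L2_sym P X -> VL2 P X.
Proof.
move=> [bX _ X2]; split=> //; apply/integrableP; split.
  by apply/measurable_EFinP; apply: measurable_funX; exact: borel_fun_norm.
apply: le_lt_trans X2; rewrite le_eqVlt; apply/orP; left; apply/eqP.
by apply: eq_integral => x _ /=; rewrite ger0_norm// sqr_ge0.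
Qed.

Lemma mean_I_tpower n m h k :
  mean P (fun x => I (tpower T n h) x * I (tpower T m k) x) =
  (n == m)%:R * (n`!%:R * '<[h, k]> ^+ n).
Proof.
have := mean_I_tspan aws htld hI n m [:: (1, h)] [:: (1, k)].
by rewrite /tspan !big_seq1 /= !scale1r !mul1r.
Qed.

(* D^p I_{p+q}(f) for [f = tspan T (p + q) s]. *)
Definition dspan p q (s : seq (R * H)) (x : borel B) : T p :=
  \sum_(c <- s) (((p + q) ^_ p)%:R * c.1 * I (tpower T q c.2) x) *: tpower T p c.2.

Lemma dspan_VL2 p q s : VL2 P (dspan p q s).
Proof.
apply: VL2_sum => // c; apply: VL2Z => //.
exact/L2Z/IL2.
Qed.

Lemma dspanB p q s t x :
  dspan p q s x - dspan p q t x = dspan p q (s ++ [seq (- c.1, c.2) | c <- t]) x.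
Proof.
rewrite /dspan big_cat big_map -sumrN; congr (_ + _).
by apply: eq_bigr => c _ /=; rewrite mulrN mulNr scaleNr.
Qed.

Lemma dot_dspan p q s v :
  (fun x => '<[dspan p q s x, v]>) =
  (fun x => ((p + q) ^_ p)%:R * I (contr (tspan T (p + q) s) v) x) %[ae P].
Proof.
have -> : contr (tspan T (p + q) s) v =
    \sum_(c <- s) (c.1 * '<[tpower T p c.2, v]>) *: tpower T q c.2.
  by rewrite /tspan contr_sum; apply: eq_bigr => c _; rewrite contr_tpower scalerA.
have h := I_sum hI s (fun c : R * H => c.1 * '<[tpower T p c.2, v]>)
  (fun c : R * H => @tpS q c.2).
apply: filterS h => x /(_ Logic.I) -> _.
rewrite dot_suml mulr_sumr; apply: eq_bigr => c _; rewrite dotZl; ring.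
Qed.

(** The factor <h,k>^p from the inner product of [T p] and the factor <h,k>^q from the second
    moments of [I] combine to the inner product of powers in degree p + q. *)
Lemma mean_dot_dspan p q q' s t :
  mean P (fun x => '<[dspan p q s x, dspan p q' t x]>) =
  (q == q')%:R * (((p + q) ^_ p)%:R * ((p + q') ^_ p)%:R * q`!%:R *
   '<[tspan T (p + q) s, tspan T (p + q) t]>).
Proof.
have L c d : L1 P (fun x => I (tpower T q c) x * I (tpower T q' d) x).
  by apply: L2_mul; exact: IL2.
pose K c d : R := ((p + q) ^_ p)%:R * ((p + q') ^_ p)%:R * c.1 * d.1 *
  '<[c.2 : H, d.2]> ^+ p.
rewrite (_ : (fun _ => _) = fun x => \sum_(c <- s) \sum_(d <- t)
   K c d * (I (tpower T q c.2) x * I (tpower T q' d.2) x)); last first.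
  apply/funext => x; rewrite dot_suml; apply: eq_bigr => c _.
  rewrite dot_sumr; apply: eq_bigr => d _.
  by rewrite dotZl dotZr dot_tpower /K; ring.
rewrite mean_sum => [|c _]; last by apply: L1_sum => d _; exact: L1Z.
rewrite dot_tspan !mulr_sumr; apply: eq_bigr => c _.
rewrite mean_sum => [|d _]; last exact: L1Z.
rewrite !mulr_sumr; apply: eq_bigr => d _.
rewrite meanZ// mean_I_tpower /K exprD; ring.
Qed.

(** The factor by which f -> D^p I_{p+q}(f), into L^2, scales norms; [vnrm_dspan] shows this for
    combinations of powers. *)
Let kappa p q : R := ((p + q) ^_ p)%:R * Num.sqrt q`!%:R.
Let kappa0 p q : 0 <= kappa p q.
Proof. by rewrite mulr_ge0 ?sqrtr_ge0. Qed.

Lemma vnrm_dspan p q s : vnrm P (dspan p q s) = kappa p q * `|tspan T (p + q) s|.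
Proof.
apply/eqP; rewrite -(@eqrXn2 _ 2) ?mulr_ge0 ?vnrm_ge0//.
rewrite sqr_vnrm; under eq_fun do rewrite -hdot_norm.
rewrite mean_dot_dspan eqxx mul1r hdot_norm /kappa !exprMn sqr_sqrtr//.
Qed.

(* Fatou's lemma along spans converging to [f] so fast that, almost surely, the
   pairings of their derivatives with a dense sequence of [T p] converge. *)
Lemma deriv_approx p q (f : T (p + q)%N) (Y : borel B -> T p) s :
  symmetric T (p + q) f -> is_deriv_integral P I f Y ->
  vnrm P (fun x => Y x - dspan p q s x) <= kappa p q * `|f - tspan T (p + q) s|.
Proof.
move=> sf [/L2_sym_VL2 Y2 Yv].
rewrite -subr_le0; apply: (@le0_small _ _ (kappa p q)) => eps e0 _.
rewrite lerBlDl -mulrDr.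
have [e ed] := separable_seq (sepT p).
have /choice [t ft] : forall i : nat, exists t : seq (R * H),
    `|f - tspan T (p + q) t| < eps / 2 ^+ i.
  by move=> i; apply: tspan_dense => //; rewrite divr_gt0// exprn_gt0.
set b := kappa p q * _.
have b0 : 0 <= b by rewrite mulr_ge0// addr_ge0// ltW.
pose X i x := `|dspan p q (t i) x - dspan p q s x| ^+ 2.
have D2 i := VL2B (sepT p) (dspan_VL2 p q (t i)) (dspan_VL2 p q s).
have conv k : \forall x \ae P,
    '<[dspan p q (t i) x - dspan p q s x, e k]> @[i --> \oo] -->
    '<[Y x - dspan p q s x, e k]>.
  (* Against the fixed vector e k both pairings are values of [I] at contractions, so the isometry
     of [I] bounds the mean of Z i. These means are summable, hence Z i tends to 0 almost surely. *)
  pose Z i x := ('<[dspan p q (t i) x, e k]> - '<[Y x, e k]>) ^+ 2.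
  have VC : VL2 P (fun=> e k).
    split; first exact: borel_fun_cst.
    exact: L1_cst.
  have sc g : symmetric T (p + q) g -> symmetric T q (contr g (e k)).
    exact: contr_symmetric.
  have Zae i : Z i = (fun x => (((p + q) ^_ p)%:R *
      (I (contr (tspan T (p + q) (t i)) (e k)) x - I (contr f (e k)) x)) ^+ 2) %[ae P].
    apply: filterS2 (@dot_dspan p q (t i) (e k)) (Yv (e k))
      => x /(_ Logic.I) h1 /(_ Logic.I) h2 _.
    by rewrite /Z h1 h2 mulrBr.
  have L2Z' i : L2 P (fun x => ((p + q) ^_ p)%:R *
      (I (contr (tspan T (p + q) (t i)) (e k)) x - I (contr f (e k)) x)).
    by apply/L2Z/L2B; apply: IL2; exact: sc.
  have mZ i : measurable_fun setT (Z i).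
    apply: measurable_funX; apply: measurable_funB;
      apply: (borel_fun_dot (sepT p)); try exact: borel_fun_cst.
    - by case: (dspan_VL2 p q (t i)).
    - by case: Y2.
  have Z1 i : L1 P (Z i).
    by have [_ h] := L2Z' i; exact: (L1_ae (mZ i) h (Zae i)).
  have Zm i : mean P (Z i) <= (kappa p q * eps * `|e k|) ^+ 2 * (1 / 2 ^+ i).
    have [_ hZ] := L2Z' i; rewrite (mean_ae (mZ i) (L1_measurable hZ) (Zae i)).
    rewrite (_ : (fun x => _) = fun x => (((p + q) ^_ p)%:R : R) ^+ 2 *
      (I (contr (tspan T (p + q) (t i)) (e k)) x - I (contr f (e k)) x) ^+ 2);
        last first.
      by apply/funext => x; rewrite exprMn.
    have L2I := L2B (IL2 (sc _ (@tsS (p + q)%N (t i)))) (IL2 (sc _ sf)).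
    rewrite meanZ; last by case: L2I.
    rewrite -sqr_nrm2 (I_nrm2B hI); [|exact: sc|exact: sc].
    rewrite (I_norm aws htld hI); last by apply: symmetricB; exact: sc.
    rewrite -contrB -exprMn mulrA -/(kappa p q) exprMn.
    have hh : `|contr (tspan T (p + q) (t i) - f) (e k)| <= (eps / 2 ^+ i) * `|e k|.
      apply: le_trans (norm_contr _ _) _; rewrite ler_wpM2r// distrC.
      exact/ltW.
    have pi0 : 0 < 2 ^+ i :> R by rewrite exprn_gt0.
    have hi : 1 / 2 ^+ i <= 1 :> R.
      by rewrite ler_pdivrMr// mul1r -natrX ler1n expn_gt0.
    apply: (@le_trans _ _ ((kappa p q) ^+ 2 * (eps / 2 ^+ i * `|e k|) ^+ 2)).
      by rewrite ler_wpM2l ?sqr_ge0// ler_sqr ?nnegrE// mulr_ge0// divr_ge0// ltW.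
    have -> : (kappa p q) ^+ 2 * (eps / 2 ^+ i * `|e k|) ^+ 2 =
      (kappa p q * eps * `|e k|) ^+ 2 * ((1 / 2 ^+ i) * (1 / 2 ^+ i)).
      by field; rewrite gt_eqF.
    apply: ler_wpM2l; first exact: sqr_ge0.
    by apply: ler_piMr => //; rewrite divr_ge0// ltW.
  have sum2 n : \sum_(i < n) (1 / 2 ^+ i : R) = 2 - 2 / 2 ^+ n.
    elim: n => [|n IHn]; first by rewrite big_ord0 expr0 divr1 subrr.
    rewrite big_ord_recr /= IHn exprS; field.
    by rewrite expf_neq0.
  have := @summable_mean_ae _ _ _ P Z ((kappa p q * eps * `|e k|) ^+ 2 * 2) Z1
    (fun i x => sqr_ge0 _).
  have hs n : \sum_(i < n) mean P (Z i) <= (kappa p q * eps * `|e k|) ^+ 2 * 2.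
    apply: le_trans (ler_sum _ (fun (i : 'I_n) _ => Zm i)) _.
    rewrite -mulr_sumr sum2 ler_wpM2l ?sqr_ge0//.
    by rewrite gerBl divr_ge0// exprn_ge0.
  move=> /(_ hs); apply: filterS => x /cvg_series_cvg_0 Zx.
  apply/cvgrPdist_le => r r0.
  move/cvgrPdist_le : Zx => /(_ (r ^+ 2)) [|N _ hN]; first by rewrite exprn_gt0.
  exists N => // i Ni; have := hN i Ni.
  rewrite /Z sub0r normrN ger0_norm ?sqr_ge0// => h.
  rewrite -dotBl opprB addrA subrK dotBl distrC.
  by rewrite -ler_sqr ?nnegrE ?(ltW r0)// real_normK ?num_real.
have Yb := VL2B (sepT p) Y2 (dspan_VL2 p q s).
have [] := @fatou_mean _ _ _ P X (fun x => `|Y x - dspan p q s x| ^+ 2) (b ^+ 2).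
- by move=> i; case: (D2 i).
- by move=> i x; exact: sqr_ge0.
(* A difference of explicit derivatives is again one, so its norm is known exactly and b bounds it
   uniformly in i. *)
- move=> i; rewrite -(sqr_vnrm P) ler_sqr ?nnegrE ?vnrm_ge0//.
  rewrite (_ : (fun x => _) = dspan p q (t i ++ [seq (- c.1, c.2) | c <- s])).
    rewrite vnrm_dspan tspan_cat tspanN /b ler_wpM2l//.
    rewrite -(subrK f (tspan T (p + q) (t i))) -addrA (le_trans (ler_normD _ _))//.
    rewrite [leLHS]addrC lerD2l distrC (le_trans (ltW (ft i)))//.
    by rewrite ler_pdivrMr ?exprn_gt0// ler_peMr ?(ltW e0)// -natrX ler1n expn_gt0.
  by apply/funext => x; rewrite dspanB.
- by case: Yb => bY _; apply: measurable_funX; exact: borel_fun_norm.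
- by move=> x; exact: sqr_ge0.
(* The null set of [conv] depends on k; only the countably many k of the dense sequence are
   combined. *)
- apply: filterS (ae_foralln conv) => x; exact: weak_lower_semicontinuity.
move=> _ h; rewrite -ler_sqr ?nnegrE ?vnrm_ge0// sqr_vnrm; exact: h.
Qed.

Lemma deriv_ortho p q q' (f : T (p + q)%N) (g : T (p + q')%N) (Y Z : borel B -> T p) :
  q != q' -> symmetric T (p + q) f -> symmetric T (p + q') g ->
  is_deriv_integral P I f Y -> is_deriv_integral P I g Z ->
  mean P (fun x => '<[Y x, Z x]>) = 0.
Proof.
move=> qq sf sg dY dZ; apply/eqP; rewrite -normr_le0.
have Y2 := L2_sym_VL2 dY.1; have Z2 := L2_sym_VL2 dZ.1.
apply: (@le0_small _ _ (kappa p q * vnrm P Z +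
  kappa p q * (`|f| + 1) * kappa p q')) => e e0 e1.
have [s fs] := tspan_dense sf e0; have [t gt] := tspan_dense sg e0.
have D2 := dspan_VL2 p q s; have E2 := dspan_VL2 p q' t.
have z : mean P (fun x => '<[dspan p q s x, dspan p q' t x]>) = 0.
  by rewrite mean_dot_dspan (negbTE qq) mul0r.
rewrite -[mean P _]subr0 -z.
apply: le_trans (mean_diff_le (VL2_dot (sepT p) Y2 Z2) (VL2_dot (sepT p) D2 E2)) _.
apply: le_trans (mean_dot_diff (sepT p) Y2 D2 Z2 E2) _.
rewrite mulrDl; apply: lerD.
  rewrite mulrAC ler_wpM2r ?vnrm_ge0//.
  apply: le_trans (deriv_approx s sf dY) _.
  by rewrite ler_wpM2l// ltW.
rewrite -mulrA; apply: ler_pM; try exact: vnrm_ge0.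
  rewrite vnrm_dspan ler_wpM2l//.
  rewrite -[tspan _ _ _](subKr f) (le_trans (ler_normB _ _))// lerD2l.
  exact: le_trans (ltW fs) e1.
apply: le_trans (deriv_approx t sg dZ) _.
by rewrite ler_wpM2l// ltW.
Qed.

Lemma norm_symprod_diff n m (f f' : T n) (g g' : T m) :
  `|symprod f g - symprod f' g'| <= `|f - f'| * `|g| + `|f'| * `|g - g'|.
Proof.
have symB (a b : T (n + m)%N) : symmetrize a - symmetrize b = symmetrize (a - b).
  by rewrite [a - b]addrC -(scaleN1r b) symmetrize_linear scaleN1r addrC.
rewrite /symprod symB.
apply: le_trans (norm_symmetrize _) _.
have -> : tprod f g - tprod f' g' = tprod (f - f') g + tprod f' (g - g').
  by rewrite linearBl linearBr addrA subrK.
by apply: le_trans (ler_normD _ _) _; rewrite !tprod_norm.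
Qed.

Lemma symprod_linear n m a (f f' : T n) (g : T m) :
  symprod (a *: f + f') g = a *: symprod f g + symprod f' g.
Proof. by rewrite /symprod linearPl symmetrize_linear. Qed.

Lemma symprod_linearr n m a (f : T n) (g g' : T m) :
  symprod f (a *: g + g') = a *: symprod f g + symprod f g'.
Proof. by rewrite /symprod linearPr symmetrize_linear. Qed.

Lemma symprod_tspan n m s t : symprod (tspan T n s) (tspan T m t) =
  \sum_(c <- [seq (c, d) | c <- s, d <- t])
    (c.1.1 * c.2.1) *: symprod (tpower T n c.1.2) (tpower T m c.2.2).
Proof.
rewrite big_allpairs_dep /tspan.
have S0 (g : T m) : symprod (0 : T n) g = 0.
  have := symprod_linear 1 (0 : T n) 0 g.
  by rewrite scaler0 add0r scale1r -[LHS]addr0 => /addrI.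
have S0r (f : T n) : symprod f (0 : T m) = 0.
  have := symprod_linearr 1 f (0 : T m) 0.
  by rewrite scaler0 add0r scale1r -[LHS]addr0 => /addrI.
elim: s => [|c s IH]; first by rewrite !big_nil S0.
rewrite !big_cons symprod_linear IH; congr (_ + _).
elim: t {IH} => [|d t IH]; first by rewrite !big_nil S0r scaler0.
by rewrite !big_cons symprod_linearr scalerDr scalerA IH.
Qed.

(** Bilinear expansion and the formula for two powers. The range p <= min n m makes the subtractions
    n - p and m - p exact, and the falling factorials divided by p! give p! 'C(n, p) 'C(m, p). *)
Lemma wick_dspan n m s t :
  I (symprod (tspan T n s) (tspan T m t)) = (fun x => \sum_(p < (minn n m).+1)
    (-1) ^+ p / p`!%:R * '<[dspan p (n - p) s x, dspan p (m - p) t x]>) %[ae P].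
Proof.
rewrite symprod_tspan.
pose l := [seq (c, d) | c <- s, d <- t].
pose z : (R * H) * (R * H) := ((0, 0), (0, 0)).
(* The pairs of the list are addressed by their position, with default z, so that only countably
   many null sets are involved. *)
have h1 : \forall x \ae P, forall k, let c := nth z l k in
    I (symprod (tpower T n c.1.2) (tpower T m c.2.2)) x =
    wick_seq '<[c.1.2, c.2.2]> (herm tld c.1.2 ^~ x) (herm tld c.2.2 ^~ x) n m.
  apply: ae_foralln => k; set c := nth z l k.
  have := I_symprod_tpower htld hI n m c.1.2 c.2.2.
  by apply: filterS => x /(_ Logic.I).
have h2 : \forall x \ae P, forall k i, let c := nth z l k in
    I (tpower T i c.1.2) x = herm tld c.1.2 i x /\
    I (tpower T i c.2.2) x = herm tld c.2.2 i x.
  apply: ae_foralln => k; apply: ae_foralln => i; set c := nth z l k.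
  by apply: filterS2 (I_tpower htld hI i c.1.2) (I_tpower htld hI i c.2.2) => x
    /(_ Logic.I) ? /(_ Logic.I) ?.
have h3 := I_sum hI l (fun c : (R * H) * (R * H) => c.1.1 * c.2.1)
  (fun c : (R * H) * (R * H) =>
     symmetrize_symmetric (tprod (tpower T n c.1.2) (tpower T m c.2.2))).
apply: filterS3 h1 h2 h3 => x h1 h2 /(_ Logic.I) -> _.
under [RHS]eq_bigr => p _.
  have -> : '<[dspan p (n - p) s x, dspan p (m - p) t x]> =
      \sum_(c <- l) ((p + (n - p)) ^_ p)%:R * ((p + (m - p)) ^_ p)%:R *
        (c.1.1 * c.2.1) * (I (tpower T (n - p) c.1.2) x *
        I (tpower T (m - p) c.2.2) x) * '<[c.1.2, c.2.2]> ^+ p.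
    rewrite /l big_allpairs_dep dot_suml; apply: eq_bigr => c _.
    rewrite dot_sumr; apply: eq_bigr => d _.
    by rewrite dotZl dotZr dot_tpower /=; ring.
  rewrite mulr_sumr; over.
rewrite exchange_big /= !(big_nth z) !big_mkord; apply: eq_bigr => k _.
set c := nth z l k; rewrite [X in _ * X]h1 -/c.
rewrite (_ : wick_seq _ _ _ n m = \sum_(p < (minn n m).+1)
  (- '<[c.1.2, c.2.2]>) ^+ p * (p`! * 'C(n, p) * 'C(m, p))%:R *
     (herm tld c.1.2 (n - p) x * herm tld c.2.2 (m - p) x)); last first.
  have [nm|mn] := leqP n m; first by [].
  by rewrite wick_seqC; apply: eq_bigr => p _; rewrite mulnAC [X in _ * X]mulrC.
rewrite mulr_sumr; apply: eq_bigr => p _.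
have [pn pm] : (p <= n /\ p <= m)%N.
  by have := ltn_ord p; rewrite ltnS leq_min => /andP.
have [-> _] := h2 k (n - p)%N; have [_ ->] := h2 k (m - p)%N.
rewrite -/c !subnKC// -!bin_ffact !natrM (exprNn (hdot _ _)); field.
exact: fact_neq0.
Qed.

(** The two sides are compared in L^1 through combinations of powers near f n and g m: [wick_dspan]
    removes the middle term, the isometry of [I] and [deriv_approx] bound the outer ones. *)
Lemma wick_deriv n m (f : forall n, T n) (g : forall n, T n)
  (Y Z : forall p : nat, nat -> borel B -> T p) :
  (forall n, symmetric T n (f n)) -> (forall n, symmetric T n (g n)) ->
  (forall p q, is_deriv_integral P I (f (p + q)%N) (Y p q)) ->
  (forall p q, is_deriv_integral P I (g (p + q)%N) (Z p q)) ->
  I (symprod (f n) (g m)) = (fun x => \sum_(p < (minn n m).+1)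
    (-1) ^+ p / p`!%:R * '<[Y p (n - p)%N x, Z p (m - p)%N x]>) %[ae P].
Proof.
move=> sf sg dY dZ.
have Y2 p q := L2_sym_VL2 (dY p q).1; have Z2 p q := L2_sym_VL2 (dZ p q).1.
have sym0 (a : T n) (b : T m) : symmetric T (n + m) (symprod a b).
  exact: symmetrize_symmetric.
pose S x := \sum_(p < (minn n m).+1)
    (-1) ^+ p / p`!%:R * '<[Y p (n - p)%N x, Z p (m - p)%N x]>.
have S1 : L1 P S by apply: L1_sum => p _; apply: L1Z; exact: VL2_dot.
have L1d := L1B (L2_L1 (IL2 (sym0 (f n) (g m)))) S1.
suff /(mean_abs_eq0 L1d) : mean P (fun x => `|I (symprod (f n) (g m)) x - S x|) = 0.
  by apply: filterS => x /(_ Logic.I) h _; apply/eqP; rewrite -subr_eq0; apply/eqP.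
apply/eqP; rewrite eq_le mean_ge0// andbT.
pose a := Num.sqrt ((n + m)`!%:R : R).
have a0 : 0 <= a by exact: sqrtr_ge0.
pose K (p : nat) := kappa p (n - p) * vnrm P (Z p (m - p)%N) +
  kappa p (n - p) * (`|f n| + 1) * kappa p (m - p).
apply: (@le0_small _ _ (a * (`|g m| + (`|f n| + 1)) +
  \sum_(p < (minn n m).+1) p`!%:R^-1 * K p)) => e e0 e1.
have [s fs] := tspan_dense (sf n) e0; have [t gt] := tspan_dense (sg m) e0.
set f' := tspan T n s in fs; set g' := tspan T m t in gt.
have hf' : `|f'| <= `|f n| + 1.
  rewrite -[f'](subKr (f n)) (le_trans (ler_normB _ _))// lerD2l.
  exact: le_trans (ltW fs) e1.
pose S' x := \sum_(p < (minn n m).+1)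
    (-1) ^+ p / p`!%:R * '<[dspan p (n - p) s x, dspan p (m - p) t x]>.
have S1' : L1 P S'.
  by apply: L1_sum => p _; apply: L1Z; apply: VL2_dot => //; exact: dspan_VL2.
pose dS p x := p`!%:R^-1 * `|'<[Y p (n - p)%N x, Z p (m - p)%N x]> -
   '<[dspan p (n - p) s x, dspan p (m - p) t x]>|.
have dS1 p : L1 P (dS p).
  by apply/L1Z/L1_abs/L1B; apply: VL2_dot => //; exact: dspan_VL2.
have L2i := L2B (IL2 (sym0 (f n) (g m))) (IL2 (sym0 f' g')).
have L1i := L1_abs (L2_L1 L2i).
have L1j : L1 P (fun x => `|I (symprod f' g') x - S' x|).
  by apply/L1_abs/L1B => //; exact/L2_L1/IL2.
have L1k : L1 P (fun x => \sum_(p < (minn n m).+1) dS p x) by apply: L1_sum => p _.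
apply: (@le_trans _ _ (mean P (fun x =>
    `|I (symprod (f n) (g m)) x - I (symprod f' g') x| +
    `|I (symprod f' g') x - S' x| + \sum_(p < (minn n m).+1) dS p x))).
  apply: le_mean; first exact: L1_abs.
    by apply: L1D => //; exact: L1D.
  move=> x; set u := I _ x; set v := I _ x.
  have -> : u - S x = (u - v) + (v - S' x) + (S' x - S x) by ring.
  apply: le_trans (ler_normD _ _) _; apply: lerD; first exact: ler_normD.
  rewrite /S' /S -sumrB; apply: le_trans (ler_norm_sum _ _ _) _.
  apply: ler_sum => p _; rewrite -mulrBr normrM /dS distrC ler_wpM2r//.
  by rewrite normrM normrX normrN1 expr1n mul1r ger0_norm// invr_ge0.
rewrite meanD//; last exact: L1D.
rewrite meanD// mean_sum//.
have -> : mean P (fun x => `|I (symprod f' g') x - S' x|) = 0.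
  rewrite (mean_ae (Y := fun=> 0) (L1_measurable L1j)) ?mean_cst//.
  by apply: filterS (wick_dspan n m s t) => x /(_ Logic.I) h _; rewrite h subrr normr0.
rewrite addr0 mulrDl; apply: lerD.
  apply: le_trans (mean_abs_le L2i) _.
  rewrite (I_nrm2B hI)// (I_norm aws htld hI); last exact: symmetricB.
  rewrite -/a -mulrA ler_wpM2l//; apply: le_trans (norm_symprod_diff _ _ _ _) _.
  rewrite mulrDl; apply: lerD; first by rewrite mulrC ler_wpM2l// ltW.
  by apply: ler_pM => //; exact: ltW.
rewrite mulr_suml; apply: ler_sum => p _.
rewrite /dS meanZ; last first.
  by apply/L1_abs/L1B; apply: VL2_dot => //; exact: dspan_VL2.
rewrite -mulrA ler_wpM2l ?invr_ge0//.
have [pn pm] : (p <= n /\ p <= m)%N.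
  by have := ltn_ord p; rewrite ltnS leq_min => /andP.
have tr (h : forall n, T n) k r : k = r -> `|h k - tspan T k s| = `|h r - tspan T r s|.
  by move=> ->.
have tr' (h : forall n, T n) k r : k = r -> `|h k - tspan T k t| = `|h r - tspan T r t|.
  by move=> ->.
have tr0 k r : k = r -> `|tspan T k s| = `|tspan T r s| by move=> ->.
apply: le_trans (mean_dot_diff (sepT p) (Y2 _ _) (dspan_VL2 p (n - p) s)
  (Z2 _ _) (dspan_VL2 p (m - p) t)) _.
rewrite /K mulrDl; apply: lerD.
  rewrite mulrAC ler_wpM2r ?vnrm_ge0//.
  apply: le_trans (deriv_approx s (sf _) (dY p (n - p)%N)) _.
  by rewrite ler_wpM2l// (tr f _ n) ?subnKC// ltW.
rewrite -mulrA; apply: ler_pM; try exact: vnrm_ge0.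
  by rewrite vnrm_dspan ler_wpM2l// (tr0 _ n) ?subnKC.
apply: le_trans (deriv_approx t (sg _) (dZ p (m - p)%N)) _.
by rewrite ler_wpM2l// (tr' g _ m) ?subnKC// ltW.
Qed.

End Derivatives.

(** * Convergence in L^1 *)

Section Vanishing.
Context (R : realType).
Implicit Types a b : nat -> R.

(** One-sided, and applied to nonnegative sequences, for which it is convergence to 0; comparison
    with a larger sequence is then immediate. *)
Definition vanish a := forall e : R, 0 < e ->
  exists N, forall n, (N <= n)%N -> a n <= e.

Lemma vanishP a : (forall n, 0 <= a n) ->
  vanish a <-> ((a n)%:E @[n --> \oo] --> (0 : \bar R)%E).
Proof.
move=> a0; split=> [va|/fine_cvg].
  apply: cvg_EFin; first exact: nearW.
  apply/cvgrPdist_le => e /va [N hN]; exists N => // n /hN.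
  by rewrite sub0r normrN /= ger0_norm.
move=> /cvgrPdist_le va e /va [N _ hN]; exists N => n /hN.
by rewrite sub0r normrN /= ger0_norm.
Qed.

Lemma vanish_le a b : (forall n, a n <= b n) -> vanish b -> vanish a.
Proof. by move=> ab vb e /vb [N hN]; exists N => n /hN; exact: le_trans. Qed.

Lemma vanishD a b : vanish a -> vanish b -> vanish (fun n => a n + b n).
Proof.
move=> va vb e e0; have e2 : 0 < e / 2 by lra.
have [N hN] := va _ e2; have [M hM] := vb _ e2.
exists (maxn N M) => n; rewrite geq_max => /andP[/hN h1 /hM h2]; lra.
Qed.

Lemma vanishZ (k : R) a : 0 <= k -> vanish a -> vanish (fun n => k * a n).
Proof.
move=> k0 va e e0; have k1 : 0 < k + 1 by lra.
have [N hN] := va _ (divr_gt0 e0 k1); exists N => n /hN h.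
apply: (@le_trans _ _ (k * (e / (k + 1)))); first exact: ler_wpM2l.
by rewrite mulrA ler_pdivrMr// mulrC ler_wpM2l// ?ltW//; lra.
Qed.

Lemma vanish_cst0 : vanish (fun=> 0).
Proof. by move=> e e0; exists 0%N => n _; exact: ltW. Qed.

Lemma vanish_sum K (a : nat -> nat -> R) : (forall p, vanish (a ^~ p)) ->
  vanish (fun n => \sum_(p < K) a n p).
Proof.
move=> va; elim: K => [|K IH].
  by apply: vanish_le vanish_cst0 => n; rewrite big_ord0.
by apply: vanish_le (vanishD IH (va K)) => n; rewrite big_ord_recr.
Qed.

Lemma vanishS a : vanish (fun n => a n.+1) <-> vanish a.
Proof.
split=> va e /va [N hN]; last by exists N => n Nn; apply: hN; lia.
by exists N.+1 => -[//|n] Nn; exact: hN.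
Qed.

Lemma vanish_comp a (r : nat -> nat) :
  (forall n, exists N, forall k, (N <= k)%N -> (n <= r k)%N) ->
  vanish a -> vanish (a \o r).
Proof.
move=> hr va e /va [N hN]; have [M hM] := hr N.
by exists M => n /hM /hN.
Qed.

Lemma bounded_sums_tail a (M : R) : (forall n, 0 <= a n) ->
  (forall n, \sum_(i < n) a i <= M) -> forall e : R, 0 < e ->
  exists K, forall n m, (K <= m)%N -> (m <= n)%N -> \sum_(m <= i < n) a i <= e.
Proof.
move=> a0 aM e e0.
have nd : nondecreasing_seq (series a) by apply: nondecreasing_series => i _ _.
have cv : cvgn (series a).
  apply: nondecreasing_is_cvgn => //; exists M => _ [n _ <-].
  by rewrite /series /= big_mkord.
have /cvgrPdist_le /(_ e e0) [K _ hK] := cv.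
exists K => n m Km mn.
have h1 := nondecreasing_cvgn_le nd cv n; have h2 := nondecreasing_cvgn_le nd cv m.
have := hK m Km; rewrite ger0_norm ?subr_ge0//.
have : series a n = series a m + \sum_(m <= i < n) a i.
  by rewrite /series /= (big_cat_nat _ (n := m)).
lra.
Qed.

(** Dominated convergence for sums of growing length: a tail of b bounds the large p uniformly in n,
    and finitely many p remain. *)
Lemma tannery (t : nat -> nat -> R) b (M : R) :
  (forall n p, 0 <= t n p <= b p) -> (forall n, \sum_(p < n) b p <= M) ->
  (forall p, vanish (t ^~ p)) -> vanish (fun n => \sum_(p < n.+1) t n p).
Proof.
move=> tb bM vt e e0; have e2 : 0 < e / 2 by lra.
have b0 p : 0 <= b p by have /andP[] := tb 0%N p; exact: le_trans.
have [K hK] := bounded_sums_tail b0 bM e2.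
have [N hN] := vanish_sum K vt e2.
exists (maxn N K) => n; rewrite geq_max => /andP[Nn Kn].
rewrite -(big_mkord predT (t n)) (big_cat_nat _ (n := K))//=; last by lia.
rewrite big_mkord; have h1 := hN n Nn.
have h2 : \sum_(K <= i < n.+1) t n i <= \sum_(K <= i < n.+1) b i.
  by apply: ler_sum => i _; have /andP[] := tb n i.
have h3 := hK n.+1 K (leqnn K) (leqW Kn); lra.
Qed.

End Vanishing.

Section SeriesL1.
Context d (Om : measurableType d) (R : realType) (P : probability Om R).

(** Completeness of L^1 for series. W is an upper limit, so that it is defined and measurable
    everywhere, although the series converges only almost surely. *)
Lemma series_L1_cvg (t : nat -> Om -> R) (M : R) : (forall p, L1 P (t p)) ->
  (forall n, \sum_(p < n) mean P (fun x => `|t p x|) <= M) ->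
  exists2 W, L1 P W &
    vanish (fun N => mean P (fun x => `|\sum_(p < N) t p x - W x|)).
Proof.
move=> t1 tM.
pose S N x := \sum_(p < N) t p x.
have S1 N : L1 P (S N) by apply: L1_sum.
pose W x := fine (limn_esup (fun N => (S N x)%:E)).
have mW : measurable_fun setT W.
  apply: measurableT_comp => //.
  apply: (@measurable_fun_limn_esup _ _ _ _ (fun N x => (S N x)%:E)) => N.
  exact/measurable_EFinP/L1_measurable.
have aW : \forall x \ae P, S^~ x @ \oo --> W x.
  have := @summable_mean_ae _ _ _ P (fun p x => `|t p x|) M
    (fun p => L1_abs (t1 p)) (fun p x => normr_ge0 _) tM.
  apply: filterS => x /(@normed_cvg _ _ (t^~ x)) cx.
  have {}cx : S^~ x @ \oo --> limn (series (t^~ x)).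
    by apply: cvg_trans cx; apply: near_eq_cvg;
      apply: nearW => n; rewrite /S /series /= big_mkord.
  suff -> : W x = limn (series (t^~ x)) by [].
  rewrite /W; have -> // : limn_esup (fun N => (S N x)%:E) = (limn (series (t^~ x)))%:E.
  have h : (fun N => (S N x)%:E) @ \oo --> (limn (series (t^~ x)))%:E.
    by apply: cvg_EFin; [exact: nearW|exact: cx].
  by have [] := cvg_limn_einf_sup h.
(* Fatou along S (N + i), i tending to infinity. With N = 0 it gives the integrability of W, with
   large N the convergence. *)
have tail N e : (forall n, (N <= n)%N ->
    \sum_(N <= p < n) mean P (fun x => `|t p x|) <= e) ->
    L1 P (fun x => `|S N x - W x|) /\ mean P (fun x => `|S N x - W x|) <= e.
  move=> he.
  apply: (@fatou_mean _ _ _ P (fun i x => `|S N x - S (N + i)%N x|)).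
  - by move=> i; apply/L1_abs/L1B.
  - by move=> i x; exact: normr_ge0.
  - move=> i; apply: le_trans (he (N + i)%N (leq_addr _ _)).
    rewrite -mean_sum; last by move=> p _; exact: L1_abs.
    apply: le_mean; [exact/L1_abs/L1B|by apply: L1_sum => p _; exact: L1_abs|].
    move=> x; rewrite distrC /S -!(big_mkord predT (t^~ x)).
    rewrite (big_cat_nat _ (n := N) (p := (N + i)%N)) ?leq_addr//= [X in X - _]addrC addrK.
    exact: ler_norm_sum.
  - by apply: measurableT_comp => //; apply: measurable_funB => //; exact: L1_measurable.
  - by move=> x; exact: normr_ge0.
  apply: filterS aW => x /cvgrPdist_le Wx r r0.
  have [K _ hK] := Wx r r0; exists K => i Ki.
  have := hK (N + i)%N (leq_trans Ki (leq_addl _ _)) => h.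
  have -> : S N x - W x = (S N x - S (N + i)%N x) + (S (N + i)%N x - W x) by ring.
  apply: le_trans (ler_normD _ _) _; rewrite lerD2l distrC; exact: h.
have M0 n : (0 <= n)%N -> \sum_(0 <= p < n) mean P (fun x => `|t p x|) <= M.
  by move=> _; rewrite big_mkord.
exists W.
  have [h _] := tail 0%N M M0.
  apply: (L1_le mW h) => x.
  by rewrite /S big_ord0 sub0r normrN.
move=> e e0; have m0 p : 0 <= mean P (fun x => `|t p x|) by exact: mean_ge0.
have [K hK] := bounded_sums_tail m0 tM e0.
by exists K => n Kn; apply: (tail n e _).2 => m nm; exact: hK.
Qed.

Lemma cvg_Lr1P (B : completeNormedModType R) (Q : probability (borel B) R)
    (u : nat -> borel B -> R) W :
  cvg_Lr Q 1%:E u W <-> [/\ forall N, L1 Q (u N), L1 Q W &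
    vanish (fun N => mean Q (fun x => `|u N x - W x|))].
Proof.
have E N : L1 Q (u N) -> L1 Q W ->
    ('N[Q]_(1%:E)[EFin \o (u N \- W)%R])%E = (mean Q (fun x => `|u N x - W x|))%:E.
  by move=> u1 W1; exact: (Lnorm1_mean (L1B u1 W1)).
split=> -[u1 W1 h].
  have u1' N : L1 Q (u N) by apply/L1P; exact: u1.
  have W1' : L1 Q W by apply/L1P.
  split=> //; apply/vanishP => [n|]; first exact: mean_ge0.
  by under eq_fun do rewrite -E//.
split; [by move=> N; apply/L1P|exact/L1P|].
by under eq_fun do rewrite E//; apply/vanishP => // n; exact: mean_ge0.
Qed.

Lemma cvg_Lr2P (B : completeNormedModType R) (Q : probability (borel B) R)
    (u : nat -> borel B -> R) W :
  cvg_Lr Q 2%:E u W <-> [/\ forall N, L2 Q (u N), L2 Q W &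
    vanish (fun N => nrm2 Q (fun x => u N x - W x))].
Proof.
have E N : L2 Q (u N) -> L2 Q W ->
    ('N[Q]_(2%:E)[EFin \o (u N \- W)%R])%E = (nrm2 Q (fun x => u N x - W x))%:E.
  by move=> u1 W1; exact: (Lnorm2_nrm2 (L2B u1 W1)).
split=> -[u1 W1 h].
  have u1' N : L2 Q (u N) by apply/L2P; exact: u1.
  have W1' : L2 Q W by apply/L2P.
  split=> //; apply/vanishP => [n|]; first exact: nrm2_ge0.
  by under eq_fun do rewrite -E//.
split; [by move=> N; apply/L2P|exact/L2P|].
by under eq_fun do rewrite E//; apply/vanishP => // n; exact: nrm2_ge0.
Qed.

End SeriesL1.

(** * The Wick product as a series of derivatives *)

Section WickSeries.
Context (R : realType) (H : hilbertType R) (B : completeNormedModType R).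
Context (j : {linear H -> B}) (P : probability (borel B) R).
Hypothesis aws : abstract_wiener_space j P.
Variable tld : H -> borel B -> R.
Hypothesis htld : wiener_map P j tld.
Variable T : tensor_powers H.
Variable I : forall n, T n -> borel B -> R.
Hypothesis hI : multiple_integral P tld I.

Let sepT n : separable_space (T n).
Proof. exact: (tensor_separable T n (aws_separable aws)). Qed.
Let IL2 n (f : T n) : symmetric T n f -> L2 P (I f).
Proof. by move=> sf; apply: (I_L2 hI). Qed.

(** Paired with [I d] for d = f n - f' n, the difference of the partial sums retains only the n-th
    chaos, which contributes n! |d|^2; yet this difference tends to 0 in L^2. *)
Lemma chaos_unique (F : borel B -> R) (f f' : forall n, T n) :
  chaos_expansion P I F f -> chaos_expansion P I F f' -> f = f'.
Proof.
move=> [sf /cvg_Lr2P[u2 F2 uF]] [sf' /cvg_Lr2P[u2' _ uF']].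
apply: functional_extensionality_dep => n.
have sd : symmetric T n (f n - f' n) by exact: symmetricB.
have d2 := IL2 sd; set d := f n - f' n in sd d2.
pose u N x := \sum_(k < N.+1) I (f k) x; pose u' N x := \sum_(k < N.+1) I (f' k) x.
have key N : (n <= N)%N ->
    n`!%:R * `|d| ^+ 2 <= nrm2 P (I d) * nrm2 P (fun x => u N x - u' N x).
  move=> nN; apply: le_trans (cauchy_schwarz d2 (L2B (u2 N) (u2' N))).
  have LL := L2_mul d2 (L2B (u2 N) (u2' N)).
  apply: le_trans (le_trans (ler_norm _) (norm_mean_le LL)).
  rewrite le_eqVlt; apply/orP; left; apply/eqP.
  have Lk k : L1 P (fun x => I d x * (I (f k) x - I (f' k) x)).
    by apply: L2_mul => //; apply: L2B; exact: IL2.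
  rewrite (_ : (fun x => _) = fun x => \sum_(k < N.+1) I d x * (I (f k) x - I (f' k) x));
    last first.
    by apply/funext => x; rewrite -sumrB mulr_sumr.
  rewrite mean_sum// (bigD1 (Ordinal (nN : (n < N.+1)%N)))//= big1 => [|k kn].
    rewrite addr0 (mean_ae (Y := fun x => I d x ^+ 2) (L1_measurable (Lk n))).
    - rewrite -sqr_nrm2 (I_norm aws htld hI)// exprMn sqr_sqrtr//.
    - by apply: measurable_funX; case: d2.
    apply: filterS (I_B hI (sf n) (sf' n)) => x /(_ Logic.I) h _.
    by rewrite expr2 -h.
  have nk : n != k by apply: contra kn => /eqP nk; apply/eqP/val_inj; rewrite /= -nk.
  rewrite (_ : (fun x => _) = fun x => I d x * I (f k) x - I d x * I (f' k) x);
    last first.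
    by apply/funext => x; rewrite mulrBr.
  rewrite meanB; [|exact/L2_mul/IL2|exact/L2_mul/IL2].
  by rewrite !(I_ortho aws htld hI)// subrr.
have V : vanish (fun N => nrm2 P (fun x => u N x - u' N x)).
  apply: vanish_le (vanishD uF uF') => N.
  have := nrm2D (L2B (u2 N) F2) (L2B F2 (u2' N)).
  rewrite [X in _ <= _ + X]nrm2_distC; apply: le_trans.
  rewrite le_eqVlt; apply/orP; left; apply/eqP; congr (nrm2 P _).
  by apply/funext => x; rewrite addrA subrK.
have : n`!%:R * `|d| ^+ 2 <= 0.
  apply: (@le0_small _ _ (nrm2 P (I d))) => e e0 _.
  have [N hN] := V e e0; apply: le_trans (key (maxn n N) (leq_maxl _ _)) _.
  by rewrite ler_wpM2l ?nrm2_ge0// hN// leq_maxr.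
rewrite pmulr_rle0 ?ltr0n ?fact_gt0// => d0.
have : `|d| ^+ 2 == 0 by rewrite eq_le d0 sqr_ge0.
by rewrite sqrf_eq0 normr_eq0 subr_eq0 => /eqP.
Qed.

(* With [<D^0 F, D^0 G> = F G] realized in the one-dimensional space [T 0], the
   case p = 0 needs no special treatment. *)
Definition full_deriv (F : borel B -> R) (DF : forall p, borel B -> T p) (p : nat) :
    borel B -> T p :=
  match p return borel B -> T p with
  | 0 => fun x => F x *: tunit T
  | p'.+1 => DF p'.+1
  end.

Lemma deriv_pairingE F G DF DG p x : deriv_pairing F G DF DG p x =
  '<[full_deriv F DF p x, full_deriv G DG p x]>.
Proof. by case: p => //=; rewrite dotZl dotZr dot_tunit mulr1. Qed.

Lemma L2_sym_scale_tunit (X : borel B -> R) : L2 P X ->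
  L2_sym P (fun x => X x *: tunit T).
Proof.
move=> X2; split.
- by apply: borel_funZ; case: X2.
- by move=> x; exact: symmetric_tensor0.
- under eq_integral => x _ do
    rewrite normrZ norm_tunit mulr1 real_normK ?num_real//.
  by case: X2 => _ X2; exact: (integrable_lty measurableT X2).
Qed.

Lemma is_deriv_integral0 q (f : T q) : symmetric T q f ->
  is_deriv_integral P I (p := 0) (q := q) f (fun x => I f x *: tunit T).
Proof.
move=> sf; split=> [|v]; first exact/L2_sym_scale_tunit/IL2.
have [bl _ _] := hI.
rewrite contr_tensor0.
apply: filterS (bl_scale (bl q) (@symmetric0 _ _ T q) '<[tunit T, v]> sf) => x.
by move=> /(_ Logic.I) -> _; rewrite dotZl ffactn0 mul1r mulrC.
Qed.

(** [Y p q] is D^p of the chaos component of degree p + q, and [D p] is their sum over q, with one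
    family f of kernels for all p, including p = 0. *)
Definition derivatives (F : borel B -> R) (f : forall n, T n)
    (D : forall p, borel B -> T p) (Y : forall p : nat, nat -> borel B -> T p) :=
  [/\ chaos_expansion P I F f,
      forall p q, is_deriv_integral P I (f (p + q)%N) (Y p q),
      forall p, VL2 P (D p) &
      forall p, vanish (fun N => vnrm P (fun x => \sum_(q < N) Y p q x - D p x))].

Lemma VL2_integral p (X : borel B -> T p) : VL2 P X ->
  (\int[P]_x (`|X x| ^+ 2)%:E)%E = (vnrm P X ^+ 2)%:E.
Proof. by move=> [_ X2]; rewrite sqr_vnrm EFin_mean. Qed.

Lemma derivatives_exist (F : borel B -> R) (DF : forall p, borel B -> T p) :
  L2 P F -> (forall p, (1 <= p)%N -> is_malliavin P I F (DF p)) ->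
  exists f Y, derivatives F f (full_deriv F DF) Y.
Proof.
move=> F2 hDF; have [f [cF _]] := hDF 1%N isT; exists f.
have [sf /cvg_Lr2P[u2 _ uF]] := cF.
have ex p : exists Y : nat -> borel B -> T p,
    [/\ forall q, is_deriv_integral P I (f (p + q)%N) (Y q),
       VL2 P (full_deriv F DF p) &
       vanish (fun N => vnrm P (fun x => \sum_(q < N) Y q x - full_deriv F DF p x))].
  case: p => [|p].
    exists (fun q x => I (f q) x *: tunit T); split.
    - by move=> q; exact: is_deriv_integral0.
    - exact/L2_sym_VL2/L2_sym_scale_tunit.
    (* The partial sums of a chaos expansion have [N.+1] terms, those of a derivative N. *)
    apply/vanishS; apply: vanish_le uF => N.
    rewrite le_eqVlt; apply/orP; left; apply/eqP; congr (Num.sqrt (mean P _)).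
    apply/funext => x /=.
    by rewrite -scaler_suml -scalerBl normrZ norm_tunit mulr1 real_normK ?num_real.
  have [f' [cF' [Y [dY X2 lim]]]] := hDF p.+1 isT.
  rewrite (chaos_unique cF' cF) in dY; exists Y; split=> //.
    exact: L2_sym_VL2.
  have D2 N : VL2 P (fun x => \sum_(q < N) Y q x - DF p.+1 x).
    apply: (VL2B (sepT _)); last exact: L2_sym_VL2.
    by apply: (VL2_sum (sepT _)) => q; apply: L2_sym_VL2; case: (dY q).
  have V : vanish (fun N => vnrm P (fun x => \sum_(q < N) Y q x - DF p.+1 x) ^+ 2).
    apply/vanishP => [N|]; first exact: sqr_ge0.
    by under eq_fun do rewrite -VL2_integral//.
  move=> e e0; have [N hN] := V _ (exprn_gt0 2 e0); exists N => n /hN.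
  by rewrite ler_sqr ?nnegrE ?vnrm_ge0// ltW.
exists (fun p => sval (cid (ex p))); split=> // p; by case: (svalP (cid (ex p))).
Qed.

Section OneVariable.
Variables (F : borel B -> R) (f : forall n, T n) (D : forall p, borel B -> T p)
  (Y : forall p : nat, nat -> borel B -> T p).
Hypothesis dF : derivatives F f D Y.

(** D^p of the truncation to degrees below p + N; the truncation to degrees at most N therefore
    appears as [N.+1 - p]. *)
Definition partial_deriv (p N : nat) (x : borel B) : T p := \sum_(q < N) Y p q x.

Let Y2 p q : VL2 P (Y p q).
Proof. by case: dF => _ h _ _; apply: L2_sym_VL2; case: (h p q). Qed.

Lemma partial_deriv_VL2 p N : VL2 P (partial_deriv p N).
Proof. by apply: (VL2_sum (sepT p)) => q. Qed.

Let A2 := partial_deriv_VL2.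
Let D2 p : VL2 P (D p). Proof. by case: dF. Qed.

Lemma partial_deriv_pythagoras p N M : (N <= M)%N ->
  vnrm P (partial_deriv p M) ^+ 2 = vnrm P (partial_deriv p N) ^+ 2 +
  vnrm P (fun x => partial_deriv p M x - partial_deriv p N x) ^+ 2.
Proof.
move=> NM; have [[sf _] dY _ _] := dF.
have AB := VL2B (sepT p) (A2 p M) (A2 p N).
have L := VL2_dot (sepT p) (A2 p N) AB.
have z : mean P (fun x => '<[partial_deriv p N x,
    partial_deriv p M x - partial_deriv p N x]>) = 0.
  rewrite (_ : (fun x => _) = fun x => \sum_(q < N) \sum_(N <= r < M) '<[Y p q x, Y p r x]>);
    last first.
    apply/funext => x; rewrite {1}/partial_deriv dot_suml.
    apply: eq_bigr => q _; rewrite -dot_sumr; congr ('<[_, _]>).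
    rewrite /partial_deriv -!(big_mkord predT (fun q => Y p q x)).
    by rewrite (big_cat_nat _ (n := N) (p := M))//= [X in X - _]addrC addrK.
  have Lqr q r : L1 P (fun x => '<[Y p q x, Y p r x]>) by exact: (VL2_dot (sepT p)).
  rewrite mean_sum => [|q _]; last by apply: L1_sum => r _.
  rewrite big1// => q _; rewrite mean_sum// big_nat big1// => r /andP[Nr _].
  apply: (deriv_ortho aws htld hI) (dY p q) (dY p r) => //.
  by rewrite ltn_eqF// (leq_trans (ltn_ord q)).
rewrite !sqr_vnrm.
rewrite (_ : (fun x => `|partial_deriv p M x| ^+ 2) = fun x =>
  (`|partial_deriv p N x| ^+ 2 +
   `|partial_deriv p M x - partial_deriv p N x| ^+ 2) +
  2 * '<[partial_deriv p N x, partial_deriv p M x - partial_deriv p N x]>); last first.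
  apply/funext => x; rewrite -!hdot_norm !(dotBl, dotBr).
  by rewrite (dotC (partial_deriv p M x) (partial_deriv p N x)); ring.
have [_ AN] := A2 p N; have [_ ABs] := AB.
rewrite meanD; [|exact: L1D|exact: L1Z].
by rewrite meanD// meanZ// z mulr0 addr0.
Qed.

(** Pythagoras holds between two partial sums, so [D p] is reached through a partial sum M >= N
    within e of it; at most two such errors occur. *)
Lemma partial_deriv_le p N : vnrm P (partial_deriv p N) <= vnrm P (D p) /\
  vnrm P (fun x => partial_deriv p N x - D p x) <= vnrm P (D p).
Proof.
have [_ _ _ /(_ p) lim] := dF.
have h e : 0 < e -> exists M, (N <= M)%N /\
    vnrm P (fun x => partial_deriv p M x - D p x) <= e.
  move=> /lim [M hM]; exists (maxn N M); split; first exact: leq_maxl.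
  exact/hM/leq_maxr.
have h1 M e : vnrm P (fun x => partial_deriv p M x - D p x) <= e ->
    vnrm P (partial_deriv p M) <= vnrm P (D p) + e.
  move=> he; have := vnrmD (sepT p) (VL2B (sepT p) (A2 p M) (D2 p)) (D2 p).
  rewrite (_ : (fun x => _) = partial_deriv p M); first lra.
  by apply/funext => x; rewrite subrK.
split; rewrite -subr_le0; apply: (@le0_small _ _ 2) => e e0 _.
  have [M [NM he]] := h e e0; have := h1 M e he.
  have : vnrm P (partial_deriv p N) <= vnrm P (partial_deriv p M).
    rewrite -ler_sqr ?nnegrE ?vnrm_ge0// (partial_deriv_pythagoras p NM).
    by rewrite lerDl sqr_ge0.
  lra.
have [M [NM he]] := h e e0; have := h1 M e he.
have : vnrm P (fun x => partial_deriv p M x - partial_deriv p N x) <=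
    vnrm P (partial_deriv p M).
  rewrite -ler_sqr ?nnegrE ?vnrm_ge0// (partial_deriv_pythagoras p NM).
  by rewrite lerDr sqr_ge0.
rewrite vnrmC => h3 h4.
have := vnrmD (sepT p) (VL2B (sepT p) (A2 p N) (A2 p M))
  (VL2B (sepT p) (A2 p M) (D2 p)).
rewrite (_ : (fun x => _) = fun x => partial_deriv p N x - D p x); first lra.
by apply/funext => x; rewrite addrA subrK.
Qed.

Lemma vanish_partial_deriv p :
  vanish (fun N => vnrm P (fun x => partial_deriv p (N.+1 - p) x - D p x)).
Proof.
have [_ _ _ /(_ p) lim] := dF.
apply: (@vanish_comp _ (fun N => vnrm P (fun x => partial_deriv p N x - D p x))
  (fun N => N.+1 - p)%N) => // n.
by exists (n + p)%N => k; lia.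
Qed.

End OneVariable.

Lemma bounded_sums_deriv (F : borel B -> R) (DF : forall p, borel B -> T p) :
  (forall p, VL2 P (full_deriv F DF p)) ->
  (\sum_(1 <= p <oo) ((p`!%:R)^-1)%:E * \int[P]_x (`|DF p x| ^+ 2)%:E < +oo)%E ->
  exists M : R, forall n,
    \sum_(p < n) p`!%:R^-1 * vnrm P (full_deriv F DF p) ^+ 2 <= M.
Proof.
move=> D2 sumF; set S := (\sum_(1 <= p <oo) _)%E in sumF.
pose a p : R := p`!%:R^-1 * vnrm P (full_deriv F DF p) ^+ 2.
have a0 p : 0 <= a p by rewrite mulr_ge0 ?invr_ge0// sqr_ge0.
have aE p : (1 <= p)%N ->
    (((p`!%:R)^-1)%:E * \int[P]_x (`|DF p x| ^+ 2)%:E = (a p)%:E)%E.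
  by case: p => // p _; rewrite /a EFinM -VL2_integral.
have S0 k : (\sum_(1 <= p < k) (a p)%:E <= S)%E.
  have := @nneseries_lim_ge R (fun p => ((p`!%:R)^-1)%:E * \int[P]_x (`|DF p x| ^+ 2)%:E)%E
    predT 1 k.
  rewrite -/S big_nat; under eq_bigr => p /andP[p1 _] do rewrite aE//.
  rewrite -big_nat; apply => p p1 _.
  by rewrite aE// lee_fin.
have Sf : S \is a fin_num.
  by rewrite ge0_fin_numE// (le_trans _ (S0 0%N))// big_geq.
(* The series of the hypothesis starts at p = 1; the term p = 0, the squared L^2 norm of F, is
   added. *)
exists (a 0%N + fine S) => -[|n].
  by rewrite big_ord0 addr_ge0// -lee_fin fineK// (le_trans _ (S0 0%N))// big_geq.
rewrite -(big_mkord predT a) big_ltn// lerD2l -lee_fin fineK// -sumEFin.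
exact: S0.
Qed.

(** * Comparison of truncated Wick products with the series of derivatives *)

Section TwoVariables.
Variables (F G : borel B -> R) (f g : forall n, T n)
  (D E : forall p, borel B -> T p)
  (Y Z : forall p : nat, nat -> borel B -> T p).
Hypotheses (dF : derivatives F f D Y) (dG : derivatives G g E Z).
Variables (MF MG : R).
Hypothesis sumF : forall n, \sum_(p < n) p`!%:R^-1 * vnrm P (D p) ^+ 2 <= MF.
Hypothesis sumG : forall n, \sum_(p < n) p`!%:R^-1 * vnrm P (E p) ^+ 2 <= MG.

Let D2 p : VL2 P (D p). Proof. by case: dF. Qed.
Let E2 p : VL2 P (E p). Proof. by case: dG. Qed.
Let AD2 p N : VL2 P (partial_deriv Y p N). Proof. exact: partial_deriv_VL2 dF p N. Qed.
Let AE2 p N : VL2 P (partial_deriv Z p N). Proof. exact: partial_deriv_VL2 dG p N. Qed.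

Let t p x : R := (-1) ^+ p / p`!%:R * '<[D p x, E p x]>.

Lemma pairing_L1 p : L1 P (t p).
Proof. by apply/L1Z/(VL2_dot (sepT p)). Qed.

(** For fixed p the pairs (n, m) with p <= n, m <= N form a full square, so their sum is the pairing
    of two partial sums of length [N.+1 - p]. *)
Lemma triangle_sum (N : nat) x :
  \sum_(n < N.+1) \sum_(m < N.+1) \sum_(p < (minn n m).+1)
    (-1) ^+ p / p`!%:R * '<[Y p (n - p)%N x, Z p (m - p)%N x]> =
  \sum_(p < N.+1) (-1) ^+ p / p`!%:R *
    '<[partial_deriv Y p (N.+1 - p) x, partial_deriv Z p (N.+1 - p) x]>.
Proof.
have pdE (X : forall p : nat, nat -> borel B -> T p) p : (p <= N.+1)%N ->
    partial_deriv X p (N.+1 - p) x = \sum_(n < N.+1 | (p <= n)%N) X p (n - p)%N x.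
  move=> pN; rewrite /partial_deriv -(big_mkord predT (fun q => X p q x)).
  transitivity (\sum_(p <= n < N.+1) X p (n - p)%N x); last by rewrite big_geq_mkord.
  have := big_addn 0 N.+1 p predT (fun n => X p (n - p)%N x).
  rewrite add0n => ->; by apply: eq_bigr => i _; rewrite addnK.
transitivity (\sum_(n < N.+1) \sum_(m < N.+1) \sum_(p < N.+1 | (p <= n)%N && (p <= m)%N)
    (-1) ^+ p / p`!%:R * '<[Y p (n - p)%N x, Z p (m - p)%N x]>).
  apply: eq_bigr => n _; apply: eq_bigr => m _.
  have nm : ((minn n m).+1 <= N.+1)%N by rewrite ltnS geq_min -ltnS ltn_ord.
  rewrite (big_ord_widen _ (fun p =>
    (-1) ^+ p / p`!%:R * '<[Y p (n - p)%N x, Z p (m - p)%N x]>) nm).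
  by apply: eq_bigl => p; rewrite ltnS leq_min.
under eq_bigr do rewrite (exchange_big_dep predT)//=.
rewrite exchange_big /=; apply: eq_bigr => p _.
rewrite !pdE; [|exact/ltnW/ltn_ord..].
rewrite dot_suml mulr_sumr [RHS]big_mkcond; apply: eq_bigr => n _.
by case: ifP => _; [rewrite dot_sumr mulr_sumr|rewrite big_pred0].
Qed.

Lemma wick_partial_sum_diff :
  vanish (fun N => mean P (fun x => `|\sum_(n < N.+1) \sum_(m < N.+1)
     I (symprod (f n) (g m)) x - \sum_(p < N.+1) t p x|)).
Proof.
have [[sf _] dY _ _] := dF; have [[sg _] dZ _ _] := dG.
pose A p N := partial_deriv Y p (N.+1 - p).
pose C p N := partial_deriv Z p (N.+1 - p).
pose tau N p : R := p`!%:R^-1 *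
  (vnrm P (fun x => A p N x - D p x) * vnrm P (E p) +
   vnrm P (D p) * vnrm P (fun x => C p N x - E p x)).
have i0 p : 0 <= p`!%:R^-1 :> R by rewrite invr_ge0.
(* Each of the two products in [tau] is at most |D p| |E p| by [partial_deriv_le], and 2 |D p| |E p|
   <= |D p|^2 + |E p|^2. *)
pose b p : R := p`!%:R^-1 * vnrm P (D p) ^+ 2 + p`!%:R^-1 * vnrm P (E p) ^+ 2.
apply: (@vanish_le _ _ (fun N => \sum_(p < N.+1) tau N p)); last first.
  apply: (@tannery _ _ b (MF + MG)).
  - move=> N p; have n1 := vnrm_ge0 P (D p); have n2 := vnrm_ge0 P (E p).
    have n3 := vnrm_ge0 P (fun x => A p N x - D p x).
    have n4 := vnrm_ge0 P (fun x => C p N x - E p x).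
    have [_ l3] := partial_deriv_le dF p (N.+1 - p).
    have [_ l4] := partial_deriv_le dG p (N.+1 - p).
    apply/andP; split; first by rewrite mulr_ge0// addr_ge0// mulr_ge0.
    rewrite /tau /b -mulrDr ler_wpM2l//.
    have l5 := ler_wpM2r n2 l3; have l6 := ler_wpM2l n1 l4.
    have := sqr_ge0 (vnrm P (D p) - vnrm P (E p)); rewrite sqrrB.
    rewrite /A /C in l5 l6 *; lra.
  - by move=> n; rewrite big_split lerD.
  move=> p; apply: vanishZ => //; apply: vanishD.
    under eq_fun do rewrite mulrC; apply: vanishZ; first exact: vnrm_ge0.
    exact: vanish_partial_deriv dF p.
  apply: vanishZ; first exact: vnrm_ge0.
  exact: vanish_partial_deriv dG p.
move=> N.
pose u x := \sum_(n < N.+1) \sum_(m < N.+1) I (symprod (f n) (g m)) x.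
pose v x := \sum_(p < N.+1) (-1) ^+ p / p`!%:R * '<[A p N x, C p N x]>.
have uv : u = v %[ae P].
  have h : \forall x \ae P, forall n m : nat, I (symprod (f n) (g m)) x =
      \sum_(p < (minn n m).+1)
        (-1) ^+ p / p`!%:R * '<[Y p (n - p)%N x, Z p (m - p)%N x]>.
    apply: ae_foralln => n; apply: ae_foralln => m.
    by apply: filterS (wick_deriv aws htld hI n m sf sg dY dZ) => x /(_ Logic.I).
  apply: filterS h => x h _; rewrite /v /A /C -triangle_sum.
  by apply: eq_bigr => n _; apply: eq_bigr => m _.
have u1 : L1 P u.
  apply: L1_sum => n _; apply: L1_sum => m _; apply/L2_L1/IL2.
  exact: symmetrize_symmetric.
have v1 : L1 P v.
  apply: L1_sum => p _; apply: L1Z.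
  exact: (VL2_dot (sepT p) (AD2 p _) (AE2 p _)).
have s1 : L1 P (fun x => \sum_(p < N.+1) t p x).
  by apply: L1_sum => p _; exact: pairing_L1.
have us1 := L1_measurable (L1_abs (L1B u1 s1)).
have vs1 := L1_measurable (L1_abs (L1B v1 s1)).
rewrite (mean_ae us1 vs1); last by apply: filterS uv => x /(_ Logic.I) h _; rewrite h.
have dd p : L1 P (fun x => '<[A p N x, C p N x]> - '<[D p x, E p x]>).
  apply: L1B; first exact: (VL2_dot (sepT p) (AD2 p _) (AE2 p _)).
  exact: (VL2_dot (sepT p) (D2 p) (E2 p)).
apply: (@le_trans _ _ (mean P (fun x => \sum_(p < N.+1)
    p`!%:R^-1 * `|'<[A p N x, C p N x]> - '<[D p x, E p x]>|))).
  apply: le_mean; first exact/L1_abs/L1B.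
    by apply: L1_sum => p _; apply/L1Z/L1_abs.
  move=> x; rewrite -sumrB; apply: le_trans (ler_norm_sum _ _ _) _.
  apply: ler_sum => p _; rewrite /t -mulrBr normrM ler_wpM2r//.
  by rewrite normrM normrX normrN1 expr1n mul1r ger0_norm.
rewrite mean_sum => [|p _]; last exact/L1Z/L1_abs.
apply: ler_sum => p _; rewrite meanZ; last exact: L1_abs.
rewrite ler_wpM2l//.
(* In this order [mean_dot_diff] yields |C - E| |A| + |E| |A - D|, and |A| <= |D| turns it into
   [tau]. *)
rewrite (_ : (fun x => _) = fun x => `|'<[C p N x, A p N x]> - '<[E p x, D p x]>|);
  last first.
  by apply/funext => x; rewrite (dotC (C p N x)) (dotC (E p x)).
apply: le_trans (mean_dot_diff (sepT p) (AE2 p _) (E2 p) (AD2 p _) (D2 p)) _.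
rewrite -/(A p N) -/(C p N).
have [l1 _] := partial_deriv_le dF p (N.+1 - p).
have := vnrm_ge0 P (fun x => C p N x - E p x).
rewrite -/(A p N) in l1 => h; have := ler_wpM2l h l1; rewrite /A /C; lra.
Qed.

Lemma pairing_series_summable n :
  \sum_(p < n) mean P (fun x => `|t p x|) <= MF + MG.
Proof.
apply: le_trans (lerD (sumF n) (sumG n)); rewrite -big_split /=.
apply: ler_sum => p _; rewrite -mulrDr.
have i0 : 0 <= p`!%:R^-1 :> R by rewrite invr_ge0.
rewrite (_ : (fun x => _) = fun x => p`!%:R^-1 * `|'<[D p x, E p x]>|); last first.
  apply/funext => x; rewrite /t normrM; congr (_ * _).
  by rewrite normrM normrX normrN1 expr1n mul1r ger0_norm.
rewrite meanZ; last exact/L1_abs/(VL2_dot (sepT p)).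
rewrite ler_wpM2l//; apply: le_trans (mean_dot_le (sepT p) (D2 p) (E2 p)) _.
have := sqr_ge0 (vnrm P (D p) - vnrm P (E p)).
have := sqr_ge0 (vnrm P (D p)); have := sqr_ge0 (vnrm P (E p)); rewrite sqrrB; lra.
Qed.

End TwoVariables.
End WickSeries.

Theorem theorem4p10 (R : realType) (H : hilbertType R)
    (B : completeNormedModType R) (j : {linear H -> B})
    (P : probability (borel B) R) (aws : abstract_wiener_space j P)
    (tld : H -> borel B -> R) (htld : wiener_map P j tld)
    (T : tensor_powers H)
    (I : forall n, T n -> borel B -> R) (hI : multiple_integral P tld I)
    (F G : borel B -> R) (hF : F \in Lfun P 2%:E) (hG : G \in Lfun P 2%:E)
    (DF DG : forall p, borel B -> T p)
    (hDF : forall p, (1 <= p)%N -> is_malliavin P I F (DF p))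
    (hDG : forall p, (1 <= p)%N -> is_malliavin P I G (DG p))
    (sumF : (\sum_(1 <= p <oo)
               ((p`!%:R)^-1)%:E * \int[P]_x (`|DF p x| ^+ 2)%:E < +oo)%E)
    (sumG : (\sum_(1 <= p <oo)
               ((p`!%:R)^-1)%:E * \int[P]_x (`|DG p x| ^+ 2)%:E < +oo)%E) :
  (exists W : borel B -> R, is_wick P I 1%:E F G W) /\
  (forall W : borel B -> R, is_wick P I 1%:E F G W ->
     cvg_Lr P 1%:E
       (fun N x => \sum_(p < N)
          (-1) ^+ p / p`!%:R * deriv_pairing F G DF DG p x) W).
Proof.
have F2 : L2 P F by apply/L2P.
have G2 : L2 P G by apply/L2P.
have [f [Y dF]] := derivatives_exist aws htld hI F2 hDF.
have [g [Z dG]] := derivatives_exist aws htld hI G2 hDG.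
have [cF _ D2 _] := dF; have [cG _ E2 _] := dG.
have [MF bF] := bounded_sums_deriv D2 sumF.
have [MG bG] := bounded_sums_deriv E2 sumG.
pose t p x := (-1) ^+ p / p`!%:R * deriv_pairing F G DF DG p x.
have tE : t = fun p x => (-1) ^+ p / p`!%:R *
    '<[full_deriv F DF p x, full_deriv G DG p x]>.
  by apply/funext => p; apply/funext => x; rewrite /t deriv_pairingE.
have t1 p : L1 P (t p) by rewrite tE; exact: (pairing_L1 aws dF dG).
pose S N x := \sum_(p < N) t p x.
pose U N x := \sum_(n < N.+1) \sum_(m < N.+1) I _ (symprod (f n) (g m)) x.
have S1 N : L1 P (S N) by apply: L1_sum.
have U1 N : L1 P (U N).
  apply: L1_sum => n _; apply: L1_sum => m _; apply/L2_L1/(I_L2 hI).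
  exact: symmetrize_symmetric.
have US : vanish (fun N => mean P (fun x => `|U N x - S N.+1 x|)).
  by rewrite /S tE; exact: (wick_partial_sum_diff aws htld hI dF dG bF bG).
have tri (X X' X'' : borel B -> R) : L1 P X -> L1 P X' -> L1 P X'' ->
    mean P (fun x => `|X x - X'' x|) <=
    mean P (fun x => `|X x - X' x|) + mean P (fun x => `|X' x - X'' x|).
  move=> l l' l''; rewrite -meanD; [|exact/L1_abs/L1B|exact/L1_abs/L1B].
  apply: le_mean; [exact/L1_abs/L1B|by apply: L1D; exact/L1_abs/L1B|move=> x].
  have -> : X x - X'' x = (X x - X' x) + (X' x - X'' x) by ring.
  exact: ler_normD.
(* The truncated products [U N] and the sums [S N.+1] have vanishing L^1 distance, so a limit of
   either is a limit of the other; summability provides one for S. *)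
split.
  have tM : forall n, \sum_(p < n) mean P (fun x => `|t p x|) <= MF + MG.
    by rewrite tE; exact: (pairing_series_summable aws dF dG bF bG).
  have [W W1 SW] := series_L1_cvg t1 tM.
  exists W, f, g; split=> //; apply/cvg_Lr1P; split=> //.
  apply: vanish_le (vanishD US (iffRL (vanishS _) SW)) => N.
  exact: (tri (U N) (S N.+1) W (U1 N) (S1 N.+1) W1).
(* W may come with other kernels f' and g'; uniqueness of the chaos expansion replaces them by f and
   g. *)
move=> W [f' [g' [cF' cG' /cvg_Lr1P[_ W1 UW]]]].
rewrite (chaos_unique aws htld hI cF' cF) (chaos_unique aws htld hI cG' cG) in UW.
apply/cvg_Lr1P; split=> //; apply/vanishS.
apply: vanish_le (vanishD US UW) => N.
have := tri _ _ _ (S1 N.+1) (U1 N) W1; rewrite -/(S N.+1).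
rewrite (_ : (fun x => `|S N.+1 x - U N x|) = fun x => `|U N x - S N.+1 x|) //.
by apply/funext => x; rewrite distrC.
Qed.
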